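(* Let $m \ge 2$ be an integer, $\Omega=(a,b)$, $\beta\in\mathbb{R}$, $0<T<T_{\max}$, where $T_{\max}>0$ is the maximal existence time of the exact solution $\psi$ of the Gross-Pitaevskii equation $$ i\partial_t\psi(x,t) = -\Delta\psi(x,t) + V(x,t)\psi(x,t) + \beta|\psi(x,t)|^2\psi(x,t),\quad x\in\Omega,\ t>0,\qquad \psi(x,0)=\psi_0(x), $$ with periodic boundary conditions on $\Omega$ and a real-valued potential $V$. Assume that $$ V\in C([0,T];L^\infty(\Omega))\cap C^1([0,T];L^2(\Omega)), \qquad \psi\in C([0,T];H^m_{\rm per}(\Omega))\cap C^1([0,T];L^2(\Omega)). $$ Let $\psi^n$ be the numerical solution produced by the Lawson-time-splitting extended Fourier pseudospectral (LTSeFP) scheme (defined in the context) with mesh size $h$ and time step size $\tau$. Then there exist $h_0>0$ sufficiently small and a constant $C>0$, with $C$ independent of $h$, $\tau$ and $n$, such that whenever $0<h<h_0$ and $0<\tau\le h^2/\pi$, $$ \|\psi(\cdot,t_n)-I_N\psi^n\|_{L^2}\le C(\tau+h^m),\qquad \|\psi(\cdot,t_n)-I_N\psi^n\|_{H^1}\le C(\tau^{1/2}+h^{m-1}),\qquad 0\le n\le T/\tau. $$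
   Context: Notation. $H^m_{\rm per}(\Omega)=\{\phi\in H^m(\Omega):\phi^{(k)}(a)=\phi^{(k)}(b),\ k=0,\dots,m-1\}$. $\Delta=\partial_{xx}$ with periodic boundary conditions on $\Omega=(a,b)$. The mesh size is $h=(b-a)/N$ with $N$ a positive even integer; grid points are $x_j=a+jh$, $j\in\mathcal{T}_N^0=\{0,1,\dots,N\}$; time steps are $t_n=n\tau$, $n = 0,1,\dots$, with $\tau>0$. Let $\mathcal{T}_N=\{-N/2,\dots,N/2-1\}$, $\mu_l=2\pi l/(b-a)$, $X_N=\mathrm{span}\{e^{i\mu_l(x-a)}:l\in\mathcal{T}_N\}$, $Y_N=\{v=(v_0,\dots,v_N)^T\in\mathbb{C}^{N+1}:v_0=v_N\}$. For $u\in L^2(\Omega)$, $\widehat u_l=\frac{1}{b-a}\int_a^b u(x)e^{-i\mu_l(x-a)}\,dx$. The Fourier interpolation operator $I_N:Y_N\to X_N$ is $(I_Nv)(x)=\sum_{l\in\mathcal{T}_N}\widetilde v_l e^{i\mu_l(x-a)}$ with $\widetilde v_l=\frac1N\sum_{j=0}^{N-1}v_je^{-i\mu_l(x_j-a)}$. Set $f(\rho)=\beta\rho$ for $\rho\ge0$. LTSeFP scheme. $\psi^n=(\psi^n_0,\dots,\psi^n_N)^T\in Y_N$ is defined by $\psi^0_j=\psi_0(x_j)$ for $j\in\mathcal{T}_N^0$ and, for $n\ge0$, $$\psi^{(1)}(x)=\bigl(1-i\tau V(x,t_n)\bigr)\,I_N\bigl(\psi^n e^{-i\tau f(|\psi^n|^2)}\bigr)(x),\quad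 x\in\Omega,$$ $$\psi^{n+1}_j=\sum_{l\in\mathcal{T}_N}e^{-i\tau\mu_l^2}\,\widehat{(\psi^{(1)})}_l\,e^{i\mu_l(x_j-a)},\quad j\in\mathcal{T}_N^0,$$ where $\psi^ne^{-i\tau f(|\psi^n|^2)}\in Y_N$ is understood componentwise. *)

(* Defs.v *)
From HB Require Import structures.
From mathcomp Require Import all_boot all_order all_algebra.
From mathcomp Require Import complex.
From mathcomp Require Import all_classical all_reals all_analysis.
Import Order.TTheory GRing.Theory Num.Theory.
Import numFieldNormedType.Exports.

Set Implicit Arguments.
Unset Strict Implicit.
Unset Printing Implicit Defensive.

Local Open Scope classical_set_scope.
Local Open Scope complex_scope.
Local Open Scope ring_scope.

(** Functions of [x] on the interval ]a, b[ are total functions [R -> R[i]], of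
    which only the values on [a, b] matter; functions of time and space are
    written [u t x], i.e. as functions of time with values in a space of
    functions of [x]. *)

Section FunctionSpaces.
Context {R : realType}.
Implicit Types (a b : R) (p : \bar R) (u g : R -> R[i]) (chi : R -> R).

(** The real modulus, since the MathComp norm [`|z|] has values in [R[i]]. *)
Definition cabs (z : R[i]) : R := ComplexField.Normc.normc z.

Definition expi (theta : R) : R[i] := cos theta +i* sin theta.

Definition cintegral a b u : R[i] :=
  Rintegral lebesgue_measure `]a, b[ (fun x => complex.Re (u x)) +i*
  Rintegral lebesgue_measure `]a, b[ (fun x => complex.Im (u x)).

Definition Lp_norm a b p u : \bar R :=
  Lnorm lebesgue_measure p ((fun x => (cabs (u x))%:E) \_ `]a, b[).

Definition in_Lp a b p u : Prop :=
  [/\ measurable_fun `]a, b[ (fun x => complex.Re (u x)),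
      measurable_fun `]a, b[ (fun x => complex.Im (u x)) &
      (Lp_norm a b p u < +oo)%E].

Definition L2_norm a b u : \bar R := Lp_norm a b 2%:E u.
Definition in_L2 a b u : Prop := in_Lp a b 2%:E u.

(** C^1 functions with compact support in ]a, b[. As for the one-dimensional
    Sobolev spaces in Brezis' textbook, weak derivatives are tested against
    these, and derivatives of higher order are obtained by iteration. *)
Definition test_function a b chi : Prop :=
  [/\ forall x, derivable chi x 1,
      continuous (derive1 chi) &
      exists c d : R, [/\ a < c, d < b &
        forall x, ~ (c <= x <= d) -> chi x = 0]].

Definition weak_derivative a b u g : Prop :=
  forall chi, test_function a b chi ->
    cintegral a b (fun x => u x * (derive1 chi x)%:C) =
    - cintegral a b (fun x => g x * (chi x)%:C).

(** A representative of the weak derivative of [u] in L^2, unique up to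
    a.e. equality; the dummy value 0 is used when there is none. *)
Definition wderiv a b u : R -> R[i] :=
  xget (fun=> 0 : R[i]) [set g | in_L2 a b g /\ weak_derivative a b u g].

Definition wderivn a b (k : nat) u : R -> R[i] := iter k (wderiv a b) u.

Definition in_H a b (m : nat) u : Prop :=
  in_L2 a b u /\
  forall k, (k < m)%N ->
    exists g, in_L2 a b g /\ weak_derivative a b (wderivn a b k u) g.

Definition H_norm a b (m : nat) u : \bar R :=
  if `[< in_H a b m u >] then
    ((\sum_(k < m.+1) (L2_norm a b (wderivn a b k u)) `^ 2) `^ 2^-1)%E
  else +oo%E.

Definition continuous_on_itv a b u : Prop :=
  {within `[a, b], continuous (fun x => complex.Re (u x))} /\
  {within `[a, b], continuous (fun x => complex.Im (u x))}.

(** [g] is the representative of [u] that is continuous on [a, b]; it gives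
    their meaning to the boundary values of [u]. *)
Definition continuous_representative a b u g : Prop :=
  continuous_on_itv a b g /\
  {ae lebesgue_measure, forall x, a < x < b -> u x = g x}.

(** For [m > 0] an element of H^m is identified with its continuous
    representative, so that it can be sampled at grid points. *)
Definition in_Hper a b (m : nat) u : Prop :=
  [/\ in_H a b m u,
      (0 < m)%N -> continuous_on_itv a b u &
      forall k, (k < m)%N ->
        exists g, continuous_representative a b (wderivn a b k u) g /\
                  g a = g b].

(** Time regularity: [X] is a space of functions of [x] and [N] its norm. *)
Definition C0_time (X : (R -> R[i]) -> Prop) (N : (R -> R[i]) -> \bar R)
    (T : R) (v : R -> R -> R[i]) : Prop :=
  (forall t, 0 <= t <= T -> X (v t)) /\
  (forall t, 0 <= t <= T ->
    N (fun x => v s x - v t x) @[s --> within `[0, T] (nbhs t)] --> 0%E).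

Definition C1_time (X : (R -> R[i]) -> Prop) (N : (R -> R[i]) -> \bar R)
    (T : R) (v : R -> R -> R[i]) : Prop :=
  C0_time X N T v /\
  exists dv : R -> R -> R[i], C0_time X N T dv /\
    forall t, 0 <= t <= T ->
      N (fun x => (v s x - v t x) / (s - t)%:C - dv t x)
        @[s --> within `[0, T] t^'] --> 0%E.

End FunctionSpaces.

Section GrossPitaevskii.
Context {R : realType}.
Variables (a b beta : R) (V : R -> R -> R) (psi0 : R -> R[i]).

(** [psi] solves the initial value problem for times [0 <= t < S]: the time
    derivative is taken in L^2, and the equation holds a.e. in space. *)
Definition GPE_solution (S : \bar R) (psi : R -> R -> R[i]) : Prop :=
  [/\ forall x, a <= x <= b -> psi 0 x = psi0 x,
      forall t, 0 <= t -> (t%:E < S)%E -> in_Hper a b 2 (psi t),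
      L2_norm a b (fun x => psi t x - psi 0 x) @[t --> 0^'+] --> 0%E &
      forall t, 0 < t -> (t%:E < S)%E ->
        exists dpsi : R -> R[i],
          [/\ in_L2 a b dpsi,
              L2_norm a b
                (fun x => (psi s x - psi t x) / (s - t)%:C - dpsi x)
                @[s --> t^'] --> 0%E &
              {ae lebesgue_measure, forall x, a < x < b ->
                'i%C * dpsi x =
                - wderivn a b 2 (psi t) x + (V t x)%:C * psi t x +
                (beta * cabs (psi t x) ^+ 2)%:C * psi t x}]].

(** [Tmax], possibly infinite, is the maximal existence time of [psi]: the
    solution cannot be continued beyond [Tmax]. *)
Definition maximal_GPE_solution (Tmax : \bar R) (psi : R -> R -> R[i]) : Prop :=
  [/\ (0 < Tmax)%E,
      GPE_solution Tmax psi &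
      forall (S : \bar R) (phi : R -> R -> R[i]),
        (Tmax < S)%E -> GPE_solution S phi ->
        ~ (forall t x, 0 <= t -> (t%:E < Tmax)%E -> a <= x <= b ->
             phi t x = psi t x)].

End GrossPitaevskii.

Section Scheme.
Context {R : realType}.
Variables (a b : R) (N : nat).

Definition mesh : R := (b - a) / N%:R.
Definition grid (j : nat) : R := a + j%:R * mesh.

(** [l : 'I_N] enumerates the frequencies -N/2, ..., N/2 - 1 ([N] even). *)
Definition freq (l : 'I_N) : int := l%:Z - N./2%:Z.

Definition mu (l : int) : R := 2 * pi * l%:~R / (b - a).

Definition fourier_coef (u : R -> R[i]) (l : int) : R[i] :=
  ((b - a)^-1)%:C * cintegral a b (fun x => u x * expi (- (mu l * (x - a)))).

Definition discrete_fourier_coef (v : 'I_N.+1 -> R[i]) (l : int) : R[i] :=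
  (N%:R^-1)%:C *
  \sum_(j < N.+1 | (j < N)%N) v j * expi (- (mu l * (grid j - a))).

Definition interpolation (v : 'I_N.+1 -> R[i]) (x : R) : R[i] :=
  \sum_(l < N) discrete_fourier_coef v (freq l) * expi (mu (freq l) * (x - a)).

Variables (beta : R) (V : R -> R -> R) (psi0 : R -> R[i]) (tau : R).

Definition nonlinearity (rho : R) : R := beta * rho.

Definition LTSeFP_step (n : nat) (v : 'I_N.+1 -> R[i]) : 'I_N.+1 -> R[i] :=
  let w := fun j => v j * expi (- (tau * nonlinearity (cabs (v j) ^+ 2))) in
  let psi1 := fun x =>
    (1 - 'i%C * (tau * V (n%:R * tau) x)%:C) * interpolation w x in
  fun j =>
    \sum_(l < N) expi (- (tau * mu (freq l) ^+ 2)) *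
                 fourier_coef psi1 (freq l) *
                 expi (mu (freq l) * (grid j - a)).

Fixpoint LTSeFP (n : nat) : 'I_N.+1 -> R[i] :=
  if n is n'.+1 then LTSeFP_step n' (LTSeFP n') else fun j => psi0 (grid j).

End Scheme.

(* Main.v *)
Require Import Defs.
From HB Require Import structures.
From mathcomp Require Import all_boot all_order all_algebra.
From mathcomp Require Import complex.
From mathcomp Require Import all_classical all_reals all_analysis.
From mathcomp Require Import measurable_realfun ess_sup_inf ring lra zify.
Import Order.TTheory GRing.Theory Num.Theory.
Import numFieldNormedType.Exports.

Local Open Scope classical_set_scope.
Local Open Scope complex_scope.
Local Open Scope ring_scope.

(** Expand the exact solution in Fourier modes. With [g = V psi + beta |psi|^2 psi]
    frozen over one step, Duhamel's integral of a mode differs from the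
    rectangle rule used by the scheme by [O(tau)], since [tau mu_l^2] is not
    small. But this defect equals [tau c (1 - exp(-i theta)) g_l], where
    [theta = tau mu_l^2] and [c = c(theta)] stays bounded for [theta <= pi], which is
    what [tau <= h^2/pi] guarantees. Hence it telescopes: the trigonometric
    polynomial [W(t)] with coefficients [psi_l + tau c(theta) g_l], at
    distance [O(tau + h^m)] from [psi(t)], satisfies the scheme up to
    [O(tau (tau + h^m))], because [g] is Lipschitz in time with values in L^2.
    Aliasing of the cubic term is controlled by comparing [W] with the projection
    of [psi] on the modes below [N/6], whose cube is interpolated exactly.

    Stability of one step in the discrete L^2 norm requires a bound on grid
    values. It is propagated together with the error estimate, as an L^2 error
    [O(tau + h^m) = O(h^2)] is [o(1)] on the grid; Gronwall's lemma concludes.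
    In H^1 the inverse inequality costs [1/h], and [tau/h <= sqrt tau]. *)

Set Implicit Arguments.
Unset Strict Implicit.
Unset Printing Implicit Defensive.

(** The symbol [c(theta)] divides the defect of the rectangle rule by [1 - exp(-i theta)]. Both
    vanish at [theta = 0], but at [theta = 2 pi] only the divisor does: the step size restriction
    keeps every mode of [X_N] away from that resonance.

    Two obstacles shape the rest. First, the solution is differentiable in time only in the L^2
    norm. No vector-valued integral is formed: to bound the norm of an increment, the increment is
    paired with itself, frozen, and the scalar mean value theorem is applied to the pairing. Second,
    derivatives in space are weak and tested against functions vanishing near the endpoints, so
    boundary values have to be recovered by cutoffs before periodicity can act on Fourier
    coefficients. The tail of a Fourier series is then bounded by a Parseval inequality for
    functions with a weak derivative in L^2: their Fourier series converge almost everywhere by an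
    elementary pointwise argument, and Fatou's lemma does the rest. *)

Arguments cabs : simpl never.
Arguments fourier_coef : simpl never.

(** * Complex numbers *)

Section ComplexNumbers.
Context {R : realType}.
Implicit Types (z w : R[i]) (x y : R).

Lemma cReD z w : complex.Re (z + w) = complex.Re z + complex.Re w.
Proof. by case: z w => [? ?] [? ?]. Qed.
Lemma cImD z w : complex.Im (z + w) = complex.Im z + complex.Im w.
Proof. by case: z w => [? ?] [? ?]. Qed.
Lemma cReN z : complex.Re (- z) = - complex.Re z.
Proof. by case: z. Qed.
Lemma cImN z : complex.Im (- z) = - complex.Im z.
Proof. by case: z. Qed.
Lemma cReM z w : complex.Re (z * w) =
  complex.Re z * complex.Re w - complex.Im z * complex.Im w.
Proof. by case: z w => [? ?] [? ?]. Qed.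
Lemma cImM z w : complex.Im (z * w) =
  complex.Re z * complex.Im w + complex.Im z * complex.Re w.
Proof. by case: z w => [? ?] [? ?]. Qed.
Lemma cRe_conj z : complex.Re (conjc z) = complex.Re z.
Proof. by case: z. Qed.
Lemma cIm_conj z : complex.Im (conjc z) = - complex.Im z.
Proof. by case: z. Qed.

Definition cReImE := (cReD, cImD, cReN, cImN, cReM, cImM, cRe_conj, cIm_conj).

Lemma complex_ext z w :
  complex.Re z = complex.Re w -> complex.Im z = complex.Im w -> z = w.
Proof. by case: z w => [? ?] [? ?] /= -> ->. Qed.

Lemma cabsE z : cabs z = Num.sqrt (complex.Re z ^+ 2 + complex.Im z ^+ 2).
Proof. by case: z. Qed.
Lemma sqr_cabs z : cabs z ^+ 2 = complex.Re z ^+ 2 + complex.Im z ^+ 2.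
Proof. by rewrite cabsE sqr_sqrtr// addr_ge0// sqr_ge0. Qed.
Lemma cabs_ge0 z : 0 <= cabs z.
Proof. by rewrite cabsE sqrtr_ge0. Qed.
Lemma cabsM z w : cabs (z * w) = cabs z * cabs w.
Proof. exact: ComplexField.Normc.normcM. Qed.
Lemma cabs_norm z : `|z| = (cabs z)%:C.
Proof. by []. Qed.
Lemma cabsD z w : cabs (z + w) <= cabs z + cabs w.
Proof. by have := ler_normD z w; rewrite !cabs_norm -rmorphD lecR. Qed.
Lemma cabsN z : cabs (- z) = cabs z.
Proof. by case: z => ? ? /=; rewrite /cabs /= !sqrrN. Qed.
Lemma cabsB z w : cabs (z - w) <= cabs z + cabs w.
Proof. by rewrite -(cabsN w) cabsD. Qed.
Lemma cabsBC z w : cabs (z - w) = cabs (w - z).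
Proof. by rewrite -cabsN opprB. Qed.
Lemma cabs0 : cabs (0 : R[i]) = 0.
Proof. exact: ComplexField.Normc.normc0. Qed.
Lemma cabs1 : cabs (1 : R[i]) = 1.
Proof. exact: ComplexField.Normc.normc1. Qed.
Lemma cabs_i : cabs ('i%C : R[i]) = 1.
Proof. by rewrite cabsE /= expr0n /= add0r expr1n sqrtr1. Qed.
Lemma cabs_real x : cabs x%:C = `|x|.
Proof. by rewrite cabsE /= expr0n /= addr0 sqrtr_sqr. Qed.
Lemma cabs_conj z : cabs (conjc z) = cabs z.
Proof. by case: z => ? ?; rewrite /cabs /= sqrrN. Qed.
Lemma cabs_eq0 z : (cabs z == 0) = (z == 0).
Proof.
by apply/eqP/eqP => [/ComplexField.Normc.eq0_normc//|->]; rewrite cabs0.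
Qed.
Lemma cabsV z : cabs z^-1 = (cabs z)^-1.
Proof. exact: ComplexField.Normc.normcV. Qed.
Lemma mul_conj z : z * conjc z = (cabs z ^+ 2)%:C.
Proof.
by rewrite sqr_cabs; apply: complex_ext; rewrite !cReImE /=; ring.
Qed.
Lemma conjcM z w : conjc (z * w) = conjc z * conjc w.
Proof. by apply: complex_ext; rewrite !cReImE /=; ring. Qed.
Lemma conjcD z w : conjc (z + w) = conjc z + conjc w.
Proof. by apply: complex_ext; rewrite !cReImE /=; ring. Qed.
Lemma conjcN z : conjc (- z) = - conjc z.
Proof. by apply: complex_ext; rewrite !cReImE /=; ring. Qed.
Lemma conjc_sum I (r : seq I) (P : pred I) (F : I -> R[i]) :
  conjc (\sum_(i <- r | P i) F i) = \sum_(i <- r | P i) conjc (F i).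
Proof.
apply: (big_morph (fun z => conjc z)) => [z w|]; first exact: conjcD.
by apply: complex_ext; rewrite /= ?oppr0.
Qed.

Lemma ler_Re_cabs z : `|complex.Re z| <= cabs z.
Proof.
by rewrite -sqrtr_sqr cabsE ler_wsqrtr// lerDl sqr_ge0.
Qed.
Lemma ler_Im_cabs z : `|complex.Im z| <= cabs z.
Proof.
by rewrite -sqrtr_sqr cabsE ler_wsqrtr// lerDr sqr_ge0.
Qed.
Lemma cabs_ReIm z : cabs z <= `|complex.Re z| + `|complex.Im z|.
Proof.
rewrite cabsE -(@ler_pXn2r _ 2) ?nnegrE ?sqrtr_ge0 ?addr_ge0 ?normr_ge0//.
rewrite sqr_sqrtr ?addr_ge0 ?sqr_ge0// sqrrD !real_normK ?num_real//.
by rewrite -addrA lerD2l lerDr mulrn_wge0// mulr_ge0.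
Qed.

Lemma expiD x y : expi (x + y) = expi x * expi y.
Proof.
by rewrite /expi cosD sinD; apply: complex_ext; rewrite !cReImE /=; ring.
Qed.
Lemma expi0 : expi (0 : R) = 1.
Proof. by rewrite /expi cos0 sin0. Qed.
Lemma expiN x : expi (- x) = conjc (expi x).
Proof. by rewrite /expi cosN sinN. Qed.
Lemma cabs_expi x : cabs (expi x) = 1.
Proof. by rewrite cabsE /= cos2Dsin2 sqrtr1. Qed.
Lemma expiNM x : expi (- x) * expi x = 1.
Proof. by rewrite -expiD addNr expi0. Qed.
Lemma expiMn x n : expi (x *+ n) = expi x ^+ n.
Proof.
elim: n => [|n IH]; first by rewrite mulr0n expi0 expr0.
by rewrite mulrS expiD IH exprS.
Qed.
Lemma expi_2pi_int (k : int) : expi (2 * pi * k%:~R : R) = 1.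
Proof.
have H n : expi (2 * pi * n%:R : R) = 1.
  rewrite mulr_natl mulr_natr.
  by rewrite expiMn /expi cos2pi sin2pi expr1n.
case: k => n; first exact: H.
by rewrite NegzE mulrNz mulrN expiN H conjc_real.
Qed.
End ComplexNumbers.

(** * Square integrable functions *)

Section SquareIntegrable.
Context {R : realType}.
Variables (a b : R).
Implicit Types (u v w : R -> R[i]) (f g : R -> R) (c : R[i]).
Notation leb := (@lebesgue_measure R).
Notation D := (`]a, b[%classic : set R).

Definition cmeas u : Prop :=
  measurable_fun D (fun x => complex.Re (u x)) /\
  measurable_fun D (fun x => complex.Im (u x)).

(** Real-valued, so that estimates stay out of the extended reals. It is the L^2 norm on [in_L2]
    only ([L2_nrm]): an infinite integral would be read as 0. Hence membership in L^2 accompanies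
    most bounds. *)
Definition nrm u : R := Num.sqrt (Rintegral leb D (fun x => cabs (u x) ^+ 2)).

Lemma nrm_ge0 u : 0 <= nrm u.
Proof. exact: sqrtr_ge0. Qed.

Lemma Rint_ge0 f : (forall x, 0 <= f x) -> 0 <= Rintegral leb D f.
Proof. by move=> f0; apply: Rintegral_ge0 => x _. Qed.

Lemma sqr_nrm u : nrm u ^+ 2 = Rintegral leb D (fun x => cabs (u x) ^+ 2).
Proof. by rewrite sqr_sqrtr// Rint_ge0// => x; rewrite sqr_ge0. Qed.

Lemma aeS (P Q : R -> Prop) : (forall x, P x -> Q x) ->
  {ae leb, forall x, P x} -> {ae leb, forall x, Q x}.
Proof.
by move=> PQ; apply: filterS => //; exact: (ae_filter_ringOfSetsType leb).
Qed.

Lemma aeI (P Q : R -> Prop) : {ae leb, forall x, P x} ->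
  {ae leb, forall x, Q x} -> {ae leb, forall x, P x /\ Q x}.
Proof. by move=> aeP aeQ; apply: filterI; first exact: (ae_filter_ringOfSetsType leb). Qed.

Lemma leb_itv_oo : (leb D < +oo)%E.
Proof.
have H := lebesgue_measure_itv `]a, b[%R.
by rewrite [X in (X < _)%E]H /=; case: ifP => _; rewrite ?ltry// -EFinD ltry.
Qed.

Definition intg f : Prop := leb.-integrable D (EFin \o f).

Lemma intgD f g : intg f -> intg g -> intg (fun x => f x + g x).
Proof. by move=> fi gi; exact: (integrableD _ fi gi). Qed.

Lemma intgB f g : intg f -> intg g -> intg (fun x => f x - g x).
Proof. by move=> fi gi; exact: (integrableB _ fi gi). Qed.

Lemma intgZ (k : R) f : intg f -> intg (fun x => k * f x).
Proof. by move=> fi; exact: (integrableZl _ k fi). Qed.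

Lemma intg_le f g : measurable_fun D f ->
  (forall x, a < x < b -> `|f x| <= `|g x|) -> intg g -> intg f.
Proof.
move=> mf fg; move=> gi; apply: (le_integrable _ _ _ gi) => //; first exact/measurable_EFinP.
Qed.

Lemma cmeas_ext u v : (forall x, u x = v x) -> cmeas v -> cmeas u.
Proof. by move=> /funext ->. Qed.

Lemma cmeasD u v : cmeas u -> cmeas v -> cmeas (fun x => u x + v x).
Proof.
move=> [u1 u2] [v1 v2]; split; cbv beta.
  rewrite (funext (fun x => cReD (u x) (v x))); exact: measurable_funD.
rewrite (funext (fun x => cImD (u x) (v x))); exact: measurable_funD.
Qed.

Lemma cmeasM u v : cmeas u -> cmeas v -> cmeas (fun x => u x * v x).
Proof.
move=> [u1 u2] [v1 v2]; split; cbv beta.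
  rewrite (funext (fun x => cReM (u x) (v x))); apply: measurable_funB; exact: measurable_funM.
rewrite (funext (fun x => cImM (u x) (v x))); apply: measurable_funD; exact: measurable_funM.
Qed.

Lemma cmeas_conj u : cmeas u -> cmeas (fun x => conjc (u x)).
Proof.
move=> [u1 u2]; split; cbv beta; first by rewrite (funext (fun x => cRe_conj (u x))).
rewrite (funext (fun x => cIm_conj (u x))); exact: measurable_funN.
Qed.

Lemma cmeas_cst c : cmeas (fun=> c).
Proof. by split; exact: measurable_cst. Qed.

Lemma cmeas_real f : measurable_fun D f -> cmeas (fun x => (f x)%:C).
Proof. by move=> mf; split => //=; exact: measurable_cst. Qed.

Lemma cmeasN u : cmeas u -> cmeas (fun x => - u x).
Proof.
move=> mu; apply: cmeas_ext (cmeasM (cmeas_cst (- 1)) mu) => x.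
by rewrite mulN1r.
Qed.

Lemma cmeasB u v : cmeas u -> cmeas v -> cmeas (fun x => u x - v x).
Proof. by move=> mu mv; apply: cmeasD => //; exact: cmeasN. Qed.

Lemma cmeas_sqr u : cmeas u -> measurable_fun D (fun x => cabs (u x) ^+ 2).
Proof.
move=> [u1 u2]; rewrite (funext (fun x => sqr_cabs (u x))).
by apply: measurable_funD; exact: measurable_funX.
Qed.

Lemma cmeas_cabs u : cmeas u -> measurable_fun D (fun x => cabs (u x)).
Proof.
move=> mu; have -> : (fun x => cabs (u x)) = Num.sqrt \o (fun x => cabs (u x) ^+ 2).
  by apply/funext => x /=; rewrite sqrtr_sqr ger0_norm// cabs_ge0.
apply: measurableT_comp; last exact: cmeas_sqr.
exact: continuous_measurable_fun (@sqrt_continuous R).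
Qed.

Definition sqintegrable u : Prop :=
  cmeas u /\ leb.-integrable D (EFin \o (fun x => cabs (u x) ^+ 2)).

Lemma L2_normE u : L2_norm a b u =
  ((\int[leb]_(x in D) (cabs (u x) ^+ 2)%:E) `^ 2^-1)%E.
Proof.
have H : (\int[leb]_(x in D) (cabs (u x) ^+ 2)%:E =
          Lnorm leb 2%:E ((fun x => (cabs (u x))%:E) \_ D) `^ 2)%E.
  rewrite poweR_Lnorm// [LHS]integral_mkcond; apply: eq_integral => x _.
  rewrite /patch; case: ifP => _ /=.
    by rewrite ger0_norm ?cabs_ge0// powR_mulrn ?cabs_ge0.
  by rewrite normr0 powR0.
by rewrite H -poweRrM mulfV ?pnatr_eq0// poweRe1//; exact: Lnorm_ge0.
Qed.

Lemma in_L2P u : in_L2 a b u <-> sqintegrable u.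
Proof.
rewrite /in_L2 /in_Lp; have -> : Lp_norm a b 2%:E u = L2_norm a b u by [].
rewrite L2_normE; split.
  move=> [m1 m2 fin]; split=> //; apply/integrableP; split.
    by apply/measurable_EFinP; exact: cmeas_sqr.
  under eq_integral do rewrite /= ger0_norm ?sqr_ge0//.
  rewrite ltNge leye_eq; apply/negP => /eqP E; move: fin.
  by rewrite E poweRyr ?invr_eq0 ?pnatr_eq0// ltxx.
move=> [[m1 m2] /integrableP[_ fin]]; split => //.
move: fin; under eq_integral do rewrite /= ger0_norm ?sqr_ge0//.
by move=> fin; exact: poweR_lty.
Qed.

Lemma L2_nrm u : in_L2 a b u -> L2_norm a b u = (nrm u)%:E.
Proof.
move=> /in_L2P[_ iu]; rewrite L2_normE.
rewrite -[X in (X `^ _)%E]fineK; last exact: integrable_fin_num.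
rewrite poweR_EFin powR12_sqrt//.
by apply: Rint_ge0 => x; rewrite sqr_ge0.
Qed.

Lemma in_L2_cmeas u : in_L2 a b u -> cmeas u.
Proof. by move=> /in_L2P[]. Qed.

(** Membership and bound come from the same comparison of integrals of squares. The domination is
    only almost everywhere because the potential is bounded only in that sense. *)
Lemma in_L2_le u w (M : R) : 0 <= M -> in_L2 a b u -> cmeas w ->
  {ae leb, forall x, a < x < b -> cabs (w x) <= M * cabs (u x)} ->
  in_L2 a b w /\ nrm w <= M * nrm u.
Proof.
move=> M0 /in_L2P[mu iu] mw wu.
have key : (\int[leb]_(x in D) (cabs (w x) ^+ 2)%:E <=
            \int[leb]_(x in D) (M ^+ 2 * cabs (u x) ^+ 2)%:E)%E.
  apply: ae_ge0_le_integral => //.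
  - by move=> x _; rewrite lee_fin sqr_ge0.
  - by apply/measurable_EFinP; exact: cmeas_sqr.
  - by move=> x _; rewrite lee_fin mulr_ge0 ?sqr_ge0.
  - apply/measurable_EFinP; apply: measurable_funM => //; exact: cmeas_sqr.
  - apply: (aeS _ wu) => x H; rewrite /= in_itv /= => Dx.
    by rewrite lee_fin -exprMn lerXn2r// ?nnegrE ?mulr_ge0 ?cabs_ge0 ?H.
have iMu : leb.-integrable D (fun x => (M ^+ 2 * cabs (u x) ^+ 2)%:E).
  exact: (integrableZl _ (M ^+ 2) iu).
have iw : leb.-integrable D (EFin \o (fun x => cabs (w x) ^+ 2)).
  apply/integrableP; split; first by apply/measurable_EFinP; exact: cmeas_sqr.
  under eq_integral do rewrite /= ger0_norm ?sqr_ge0//.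
  apply: (le_lt_trans key).
  have /integrableP[_] := iMu.
  congr (_ < _)%E; apply: eq_integral => x _.
  by rewrite /= ger0_norm// mulr_ge0 ?sqr_ge0.
split; first by apply/in_L2P.
rewrite -ler_sqr ?nnegrE ?mulr_ge0 ?nrm_ge0// ?ger0_norm ?mulr_ge0 ?nrm_ge0//.
rewrite exprMn !sqr_nrm -RintegralZl//.
apply: fine_le => //; exact: integrable_fin_num.
Qed.

Lemma in_L2_le_pt u w (M : R) : 0 <= M -> in_L2 a b u -> cmeas w ->
  (forall x, a < x < b -> cabs (w x) <= M * cabs (u x)) ->
  in_L2 a b w /\ nrm w <= M * nrm u.
Proof.
by move=> M0 uL2 mw wu; apply: (in_L2_le M0 uL2 mw); exact: aeW.
Qed.

Lemma in_L2_ae u w : in_L2 a b u -> cmeas w ->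
  {ae leb, forall x, a < x < b -> w x = u x} -> in_L2 a b w /\ nrm w = nrm u.
Proof.
move=> uL2 mw wu.
have [wL2 wle] : in_L2 a b w /\ nrm w <= 1 * nrm u.
  apply: (in_L2_le ler01 uL2 mw); apply: (aeS _ wu) => x H Dx.
  by rewrite mul1r H.
have [_ ule] : in_L2 a b u /\ nrm u <= 1 * nrm w.
  apply: (in_L2_le ler01 wL2 (in_L2_cmeas uL2)); apply: (aeS _ wu) => x H Dx.
  by rewrite mul1r H.
by split => //; apply/eqP; rewrite eq_le -{1}[nrm u]mul1r wle -[nrm w]mul1r.
Qed.

Lemma in_L2_cst c : in_L2 a b (fun=> c).
Proof.
apply/in_L2P; split; first exact: cmeas_cst.
apply: (@measurable_bounded_integrable _ _ _ leb (fun=> cabs c ^+ 2)) => //.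
- exact: leb_itv_oo.
- exact: bounded_cst.
Qed.

Lemma in_L2_bounded u (M : R) : cmeas u ->
  (forall x, a < x < b -> cabs (u x) <= M) -> in_L2 a b u.
Proof.
move=> mu uM.
have [] := @in_L2_le_pt (fun=> 1) u `|M| (normr_ge0 M) (in_L2_cst 1) mu => //.
by move=> x /uM H; rewrite cabs1 mulr1 (le_trans H)// ler_norm.
Qed.

Lemma in_L2Z c u : in_L2 a b u ->
  in_L2 a b (fun x => c * u x) /\ nrm (fun x => c * u x) <= cabs c * nrm u.
Proof.
move=> uL2; apply: (in_L2_le_pt (cabs_ge0 c) uL2).
  exact: cmeasM (cmeas_cst c) (in_L2_cmeas uL2).
by move=> x _; rewrite cabsM.
Qed.

Lemma in_L2N u : in_L2 a b u -> in_L2 a b (fun x => - u x).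
Proof.
move=> uL2; have [+ _] := in_L2Z (- 1) uL2; congr in_L2.
by apply/funext => x; rewrite mulN1r.
Qed.

Lemma in_L2_conj u : in_L2 a b u -> in_L2 a b (fun x => conjc (u x)).
Proof.
move=> uL2; have [] // := @in_L2_le_pt u (fun x => conjc (u x)) 1 ler01 uL2.
  exact: cmeas_conj (in_L2_cmeas uL2).
by move=> x _; rewrite cabs_conj mul1r.
Qed.

Lemma nrmN u : nrm (fun x => - u x) = nrm u.
Proof. by congr Num.sqrt; apply: eq_Rintegral => x _; rewrite cabsN. Qed.

Lemma nrm_conj u : nrm (fun x => conjc (u x)) = nrm u.
Proof. by congr Num.sqrt; apply: eq_Rintegral => x _; rewrite cabs_conj. Qed.

Lemma nrmBC u v : nrm (fun x => u x - v x) = nrm (fun x => v x - u x).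
Proof. by rewrite -nrmN; congr nrm; apply/funext => x; rewrite opprB. Qed.

Lemma integrable_cabsM u v : in_L2 a b u -> in_L2 a b v ->
  leb.-integrable D (EFin \o (fun x => cabs (u x) * cabs (v x))).
Proof.
move=> /in_L2P[mu iu] /in_L2P[mv iv].
apply: (@le_integrable _ _ _ leb D _ _
  (fun x => (cabs (u x) ^+ 2)%:E + (cabs (v x) ^+ 2)%:E)%E) => //.
- by apply/measurable_EFinP; apply: measurable_funM; exact: cmeas_cabs.
- move=> x _; rewrite /= lee_fin ger0_norm ?mulr_ge0 ?cabs_ge0//.
  rewrite ger0_norm ?addr_ge0 ?sqr_ge0//.
  have := sqr_ge0 (cabs (u x) - cabs (v x)).
  have := mulr_ge0 (cabs_ge0 (u x)) (cabs_ge0 (v x)).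
  by rewrite sqrrB; lra.
- exact: integrableD.
Qed.

(** The integral of [(s |u| - |v|)^2] is a quadratic polynomial in [s] that is never negative. *)
Lemma cauchy_schwarz_real u v : in_L2 a b u -> in_L2 a b v ->
  Rintegral leb D (fun x => cabs (u x) * cabs (v x)) <= nrm u * nrm v.
Proof.
move=> uL2 vL2; have /in_L2P[mu iu] := uL2; have /in_L2P[mv iv] := vL2.
have iuv := integrable_cabsM uL2 vL2.
set B := Rintegral _ _ _.
have key (s : R) : 0 <= s ^+ 2 * nrm u ^+ 2 - 2 * s * B + nrm v ^+ 2.
  rewrite !sqr_nrm -!RintegralZl// -RintegralB//; last 2 first.
  - exact: (integrableZl _ (s ^+ 2) iu).
  - exact: (integrableZl _ (2 * s) iuv).
  rewrite -RintegralD//; last first.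
    apply: (@integrableB _ _ _ leb D _
      (fun x => (s ^+ 2 * cabs (u x) ^+ 2)%:E)
      (fun x => (2 * s * (cabs (u x) * cabs (v x)))%:E)) => //.
    - exact: (integrableZl _ (s ^+ 2) iu).
    - exact: (integrableZl _ (2 * s) iuv).
  apply: Rint_ge0 => x; have := sqr_ge0 (s * cabs (u x) - cabs (v x)); lra.
have B0 : 0 <= B by apply: Rint_ge0 => x; rewrite mulr_ge0 ?cabs_ge0.
have [nu0|nu0] := eqVneq (nrm u) 0.
  rewrite nu0 mul0r; have [->//|Bn0] := eqVneq B 0.
  (* Without its leading term the quadratic is affine in [s]; at this [s] it would equal -1. *)
  have := key ((nrm v ^+ 2 + 1) / (2 * B)).
  rewrite nu0 expr0n /= mulr0 sub0r.
  have -> : 2 * ((nrm v ^+ 2 + 1) / (2 * B)) * B = nrm v ^+ 2 + 1 by field.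
  lra.
have nu2 : 0 < nrm u ^+ 2 by rewrite exprn_gt0// lt_def nu0 nrm_ge0.
rewrite -ler_sqr ?nnegrE ?mulr_ge0 ?nrm_ge0// exprMn.
(* The minimiser of the quadratic. *)
have := key (B / nrm u ^+ 2).
have -> : (B / nrm u ^+ 2) ^+ 2 * nrm u ^+ 2 - 2 * (B / nrm u ^+ 2) * B
  + nrm v ^+ 2 = nrm v ^+ 2 - B ^+ 2 / nrm u ^+ 2 by field.
by rewrite subr_ge0 ler_pdivrMr// mulrC.
Qed.

Lemma in_L2D u v : in_L2 a b u -> in_L2 a b v -> in_L2 a b (fun x => u x + v x).
Proof.
move=> uL2 vL2; have /in_L2P[mu iu] := uL2; have /in_L2P[mv iv] := vL2.
apply/in_L2P; split; first exact: cmeasD.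
apply: (intg_le _ _ (intgZ 2 (intgD iu iv))).
- by apply: cmeas_sqr; exact: cmeasD.
- move=> x _; rewrite !ger0_norm ?mulr_ge0 ?addr_ge0 ?sqr_ge0 ?cabs_ge0//.
  apply: (@le_trans _ _ ((cabs (u x) + cabs (v x)) ^+ 2)).
    by rewrite ler_sqr ?nnegrE ?cabs_ge0 ?addr_ge0 ?cabs_ge0 ?cabsD.
  have := sqr_ge0 (cabs (u x) - cabs (v x)); lra.
Qed.

Lemma in_L2B u v : in_L2 a b u -> in_L2 a b v -> in_L2 a b (fun x => u x - v x).
Proof. by move=> uL2 vL2; apply: in_L2D => //; exact: in_L2N. Qed.

Lemma in_L2_sum I (r : seq I) (F : I -> R -> R[i]) :
  (forall i, in_L2 a b (F i)) -> in_L2 a b (fun x => \sum_(i <- r) F i x).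
Proof.
move=> mF; elim: r => [|i r IH].
  rewrite (_ : (fun _ => _) = fun=> 0); first exact: in_L2_cst.
  by apply/funext => x; rewrite big_nil.
rewrite (_ : (fun _ => _) = fun x => F i x + \sum_(j <- r) F j x).
  exact: in_L2D.
by apply/funext => x; rewrite big_cons.
Qed.

Lemma ler_nrmD u v : in_L2 a b u -> in_L2 a b v ->
  nrm (fun x => u x + v x) <= nrm u + nrm v.
Proof.
move=> uL2 vL2; have /in_L2P[mu iu] := uL2; have /in_L2P[mv iv] := vL2.
have /in_L2P[muv iuv] := in_L2D uL2 vL2.
have ip := integrable_cabsM uL2 vL2.
have i1 : leb.-integrable D (EFin \o (fun x => cabs (u x) ^+ 2 + cabs (v x) ^+ 2)).
  exact: intgD.
have i2 : leb.-integrable D (EFin \o (fun x => 2 * (cabs (u x) * cabs (v x)))).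
  exact: (intgZ 2 ip).
rewrite -ler_sqr ?nnegrE ?addr_ge0 ?nrm_ge0// sqrrD !sqr_nrm.
apply: (@le_trans _ _ (Rintegral leb D (fun x =>
  (cabs (u x) ^+ 2 + cabs (v x) ^+ 2) + 2 * (cabs (u x) * cabs (v x))))).
  apply: le_Rintegral => //; first exact: (intgD i1 i2).
  move=> x _; apply: (@le_trans _ _ ((cabs (u x) + cabs (v x)) ^+ 2)).
    by rewrite ler_sqr ?nnegrE ?cabs_ge0 ?addr_ge0 ?cabs_ge0 ?cabsD.
  by rewrite le_eqVlt; apply/orP; left; apply/eqP; ring.
rewrite RintegralD// RintegralD// RintegralZl//.
have := cauchy_schwarz_real uL2 vL2.
by rewrite -mulr_natl; lra.
Qed.

Lemma ler_nrmB u v : in_L2 a b u -> in_L2 a b v ->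
  nrm (fun x => u x - v x) <= nrm u + nrm v.
Proof.
by move=> uL2 vL2; rewrite -(nrmN v); apply: ler_nrmD => //; exact: in_L2N.
Qed.

Lemma ler_nrm_split u v w : in_L2 a b u -> in_L2 a b v -> in_L2 a b w ->
  nrm (fun x => u x - w x) <= nrm (fun x => u x - v x) + nrm (fun x => v x - w x).
Proof.
move=> uL2 vL2 wL2.
have := ler_nrmD (in_L2B uL2 vL2) (in_L2B vL2 wL2).
by under [X in nrm X <= _ -> _]eq_fun do rewrite addrA subrK.
Qed.

End SquareIntegrable.

(** * Integrals of complex-valued functions *)

Section ComplexIntegral.
Context {R : realType}.
Variables (a b : R).
Hypothesis hab : a < b.
Implicit Types (u v w : R -> R[i]) (f g : R -> R) (c : R[i]).
Notation leb := (@lebesgue_measure R).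
Notation D := (`]a, b[%classic : set R).
Notation in2 := (in_L2 a b).
Notation nrm := (nrm a b).
Notation cmeas := (cmeas a b).
Notation intg := (intg a b).

Definition cintg u : Prop :=
  intg (fun x => complex.Re (u x)) /\ intg (fun x => complex.Im (u x)).

Lemma cintg_cmeas u : cintg u -> cmeas u.
Proof.
by move=> [/integrableP[m1 _] /integrableP[m2 _]]; split; apply/measurable_EFinP.
Qed.

Lemma cintg_le u f : cmeas u -> (forall x, a < x < b -> cabs (u x) <= f x) ->
  intg f -> cintg u.
Proof.
move=> [m1 m2] uf fi; split; apply: (intg_le _ _ fi) => // x /uf H.
  by rewrite (le_trans (ler_Re_cabs _))// (le_trans H)// ler_norm.
by rewrite (le_trans (ler_Im_cabs _))// (le_trans H)// ler_norm.
Qed.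

Lemma intg_cabs u : cintg u -> intg (fun x => cabs (u x)).
Proof.
move=> ui; have [i1 i2] := ui.
have n1 := integrable_norm i1; have n2 := integrable_norm i2.
apply: (intg_le _ _ (intgD n1 n2)); first exact: cmeas_cabs (cintg_cmeas ui).
move=> x _; rewrite [leLHS]ger0_norm ?cabs_ge0// [leRHS]ger0_norm ?addr_ge0 /= ?normr_ge0//.
exact: cabs_ReIm.
Qed.

Lemma cintgM u v : in2 u -> in2 v -> cintg (fun x => u x * v x).
Proof.
move=> uL2 vL2; apply: (cintg_le _ _ (integrable_cabsM uL2 vL2)).
  by apply: cmeasM; exact: in_L2_cmeas.
by move=> x _; rewrite cabsM.
Qed.

Lemma cintg_in_L2 u : in2 u -> cintg u.
Proof.
move=> uL2; have := cintgM uL2 (in_L2_cst a b 1).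
by rewrite (_ : (fun x => _) = u)//; apply/funext => x; rewrite mulr1.
Qed.

Lemma cintgD u v : cintg u -> cintg v -> cintg (fun x => u x + v x).
Proof.
move=> [u1 u2] [v1 v2]; split.
  by rewrite (funext (fun x => cReD (u x) (v x))); exact: intgD.
by rewrite (funext (fun x => cImD (u x) (v x))); exact: intgD.
Qed.

Lemma cintgZ c u : cintg u -> cintg (fun x => c * u x).
Proof.
move=> [u1 u2]; split.
  by rewrite (funext (fun x => cReM c (u x))); apply: intgB; exact: intgZ.
by rewrite (funext (fun x => cImM c (u x))); apply: intgD; exact: intgZ.
Qed.

Lemma cintegralD u v : cintg u -> cintg v ->
  cintegral a b (fun x => u x + v x) = cintegral a b u + cintegral a b v.
Proof.
move=> [u1 u2] [v1 v2]; rewrite /cintegral.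
rewrite (funext (fun x => cReD (u x) (v x))) (funext (fun x => cImD (u x) (v x))).
by rewrite !RintegralD.
Qed.

Lemma cintegralZ c u : cintg u ->
  cintegral a b (fun x => c * u x) = c * cintegral a b u.
Proof.
move=> [u1 u2]; rewrite /cintegral.
rewrite (funext (fun x => cReM c (u x))) (funext (fun x => cImM c (u x))).
rewrite RintegralB//; [|exact: intgZ|exact: intgZ].
rewrite RintegralD//; [|exact: intgZ|exact: intgZ].
by rewrite !RintegralZl//; apply: complex_ext; rewrite !cReImE.
Qed.

Lemma cintegralN u : cintg u ->
  cintegral a b (fun x => - u x) = - cintegral a b u.
Proof.
move=> ui; rewrite -mulN1r -cintegralZ//; congr cintegral.
by apply/funext => x; rewrite mulN1r.
Qed.

Lemma cintegralB u v : cintg u -> cintg v ->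
  cintegral a b (fun x => u x - v x) = cintegral a b u - cintegral a b v.
Proof.
move=> ui vi; rewrite cintegralD// ?cintegralN//.
have := cintgZ (- 1) vi; congr cintg; apply/funext => x; exact: mulN1r.
Qed.

Lemma cintegral_sum I (r : seq I) (F : I -> R -> R[i]) :
  (forall i, cintg (F i)) ->
  cintegral a b (fun x => \sum_(i <- r) F i x) = \sum_(i <- r) cintegral a b (F i)
  /\ cintg (fun x => \sum_(i <- r) F i x).
Proof.
move=> Fi; elim: r => [|i r [IH1 IH2]].
  rewrite (_ : (fun _ => _) = (fun x : R => 0 * 1 : R[i])); last first.
    by apply/funext => x; rewrite big_nil mulr1.
  have i1 : cintg (fun=> 1) by apply: cintg_in_L2; exact: in_L2_cst.
  by split; [rewrite cintegralZ// mul0r big_nil|exact: cintgZ].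
rewrite (_ : (fun _ => _) = fun x => F i x + \sum_(j <- r) F j x).
  by split; [rewrite cintegralD// IH1 big_cons|exact: cintgD].
by apply/funext => x; rewrite big_cons.
Qed.

Lemma eq_cintegral u v : (forall x, a < x < b -> u x = v x) ->
  cintegral a b u = cintegral a b v.
Proof.
move=> uv; congr (_ +i* _); apply: eq_Rintegral => x;
  by rewrite inE /= in_itv /= => /uv ->.
Qed.

Lemma ae_eq_Rintegral f g : measurable_fun D f -> measurable_fun D g ->
  {ae leb, forall x, a < x < b -> f x = g x} ->
  Rintegral leb D f = Rintegral leb D g.
Proof.
move=> mf mg fg; congr fine; apply: ae_eq_integral => //.
- exact/measurable_EFinP.
- exact/measurable_EFinP.
- by apply: (aeS _ fg) => x H; rewrite /= in_itv /= => /H ->.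
Qed.

Lemma ae_eq_cintegral u v : cmeas u -> cmeas v ->
  {ae leb, forall x, a < x < b -> u x = v x} ->
  cintegral a b u = cintegral a b v.
Proof.
move=> [u1 u2] [v1 v2] uv; congr (_ +i* _); apply: ae_eq_Rintegral => //;
  by apply: (aeS _ uv) => x H /H ->.
Qed.

Lemma cintegral_conj u : cintg u ->
  cintegral a b (fun x => conjc (u x)) = conjc (cintegral a b u).
Proof.
move=> [u1 u2]; rewrite /cintegral /=; congr (_ +i* _).
  by apply: eq_Rintegral => x _; rewrite cRe_conj.
rewrite -mulN1r -RintegralZl//; apply: eq_Rintegral => x _.
by rewrite cIm_conj mulN1r.
Qed.

(** Multiplying [u] by the conjugate of its integral [z] makes the integral equal to [|z|^2], a real
    number, so that monotonicity of the real integral applies; then one factor [|z|] is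
    cancelled. *)
Lemma cabs_cintegral u : cintg u ->
  cabs (cintegral a b u) <= Rintegral leb D (fun x => cabs (u x)).
Proof.
move=> ui; set z := cintegral a b u.
have [->|z0] := eqVneq z 0.
  by rewrite cabs0; apply: Rint_ge0 => x; exact: cabs_ge0.
have zp : 0 < cabs z by rewrite lt_def cabs_eq0 z0 cabs_ge0.
have H : complex.Re (conjc z * z) = Rintegral leb D (fun x => complex.Re (conjc z * u x)).
  by rewrite -cintegralZ.
have : complex.Re (conjc z * z) <= cabs z * Rintegral leb D (fun x => cabs (u x)).
  rewrite H -RintegralZl//; last exact: intg_cabs.
  apply: le_Rintegral => //.
  - exact: (cintgZ (conjc z) ui).1.
  - exact: intgZ (intg_cabs ui).
  - move=> x _; rewrite (le_trans (ler_norm _))// (le_trans (ler_Re_cabs _))//.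
    by rewrite cabsM cabs_conj.
by rewrite mulrC mul_conj /= expr2 ler_pM2l.
Qed.

Lemma cauchy_schwarz u v : in2 u -> in2 v ->
  cabs (cintegral a b (fun x => u x * v x)) <= nrm u * nrm v.
Proof.
move=> uL2 vL2; apply: le_trans (cabs_cintegral (cintgM uL2 vL2)) _.
apply: le_trans (cauchy_schwarz_real uL2 vL2).
by rewrite le_eqVlt; apply/orP; left; apply/eqP; apply: eq_Rintegral => x _; rewrite cabsM.
Qed.

Lemma cintegral_mul_conj u : in2 u ->
  cintegral a b (fun x => u x * conjc (u x)) = (nrm u ^+ 2)%:C.
Proof.
move=> uL2; rewrite /cintegral sqr_nrm.
congr (_ +i* _); first by apply: eq_Rintegral => x _; rewrite mul_conj.
rewrite (@eq_Rintegral _ _ _ _ _ (fun=> 0)) ?Rintegral_cst ?mul0r// => x _.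
by rewrite mul_conj.
Qed.

Lemma cintegral_cst c : cintegral a b (fun=> c) = ((b - a)%:C) * c.
Proof.
have H : fine (leb D) = b - a.
  have E := lebesgue_measure_itv `]a, b[%R.
  by rewrite [X in fine X]E /= lte_fin hab.
rewrite /cintegral !Rintegral_cst// H.
by apply: complex_ext; rewrite !cReImE /=; ring.
Qed.

End ComplexIntegral.

(** * Derivatives of complex-valued functions of a real variable *)

Section Calculus.
Context {R : realType}.
Implicit Types (u v du dv : R -> R[i]) (f g df dg : R -> R) (c z w : R[i]) (x : R).
Notation leb := (@lebesgue_measure R).

Lemma isderD f g (x p q : R) : is_derive x 1 f p -> is_derive x 1 g q ->
  is_derive x 1 (fun y => f y + g y) (p + q).
Proof. by move=> *; exact: is_deriveD. Qed.

Lemma isderB f g (x p q : R) : is_derive x 1 f p -> is_derive x 1 g q ->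
  is_derive x 1 (fun y => f y - g y) (p - q).
Proof. by move=> *; exact: is_deriveB. Qed.

Lemma isderM f g (x p q : R) : is_derive x 1 f p -> is_derive x 1 g q ->
  is_derive x 1 (fun y => f y * g y) (p * g x + f x * q).
Proof.
move=> fp gq; have := @is_deriveM _ _ f g x 1 p q fp gq.
by rewrite addrC [p * _]mulrC.
Qed.

Lemma isder_cst (k x : R) : is_derive x 1 (fun=> k) 0.
Proof. exact: is_derive_cst. Qed.

Lemma isder_affine (k l x : R) : is_derive x 1 (fun y => k * (y - l)) k.
Proof.
have := isderM (isder_cst k x) (isderB (@is_derive_id _ _ x 1) (isder_cst l x)).
by rewrite mul0r add0r subr0 mulr1.
Qed.

Lemma isder_comp_affine f (k l x p : R) : is_derive (k * (x - l)) 1 f p ->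
  is_derive x 1 (fun y => f (k * (y - l))) (k * p).
Proof.
move=> fp; have := @is_derive1_comp _ f (fun y => k * (y - l)) x _ _ fp (isder_affine k l x).
by rewrite mulrC.
Qed.

Lemma isder_continuous f df : (forall x : R, is_derive x 1 f (df x)) -> continuous f.
Proof.
move=> fdf x; apply: differentiable_continuous; apply/derivable1_diffP.
exact: (@ex_derive _ _ _ _ _ _ _ (fdf x)).
Qed.

Lemma Rint_FTC (a b : R) f df : a < b -> (forall x : R, is_derive x 1 f (df x)) ->
  continuous df -> Rintegral leb `]a, b[ df = f b - f a.
Proof.
move=> ab fdf cdf.
have cw : {within `[a, b], continuous df} by exact: continuous_subspaceT.
have i0 : leb.-integrable `[a, b] (EFin \o df).
  by apply: continuous_compact_integrable => //; exact: segment_compact.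
have i1 : leb.-integrable `]a, b] (EFin \o df).
  by apply: integrableS i0 => //; exact: subset_itv_oc_cc.
have i2 : leb.-integrable `]a, b[ (EFin \o df).
  by apply: integrableS i0 => //; exact: subset_itv_oo_cc.
rewrite Rintegral_itv_bndo_bndc// Rintegral_itv_obnd_cbnd//.
rewrite /Rintegral (@continuous_FTC2 _ df f)//.
  split.
  - by move=> x _; exact: (@ex_derive _ _ _ _ _ _ _ (fdf x)).
  - by apply: cvg_at_right_filter; exact: isder_continuous fdf a.
  - by apply: cvg_at_left_filter; exact: isder_continuous fdf b.
by move=> x _; rewrite derive1E (@derive_val _ _ _ _ _ _ _ (fdf x)).
Qed.

Lemma intg_continuous (a b : R) f : continuous f -> intg a b f.
Proof.
move=> cf; have i0 : leb.-integrable `[a, b] (EFin \o f).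
  apply: continuous_compact_integrable; first exact: segment_compact.
  exact: continuous_subspaceT.
by apply: integrableS i0 => //; exact: subset_itv_oo_cc.
Qed.

Definition ccont u : Prop :=
  continuous (fun x => complex.Re (u x)) /\ continuous (fun x => complex.Im (u x)).

(** Componentwise, so that the real derivative rules and the real mean value theorem apply
    directly. *)
Definition cder u (x : R) (z : R[i]) : Prop :=
  is_derive x 1 (fun y => complex.Re (u y)) (complex.Re z) /\
  is_derive x 1 (fun y => complex.Im (u y)) (complex.Im z).

Lemma cder_ccont u du : (forall x, cder u x (du x)) -> ccont u.
Proof.
by move=> ud; split; [apply: (isder_continuous (fun x => (ud x).1))|
                      apply: (isder_continuous (fun x => (ud x).2))].
Qed.

Lemma cderD u v x z w : cder u x z -> cder v x w ->
  cder (fun y => u y + v y) x (z + w).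
Proof.
move=> [u1 u2] [v1 v2]; split; rewrite cReImE.
  by rewrite (funext (fun x => cReD (u x) (v x))); exact: isderD.
by rewrite (funext (fun x => cImD (u x) (v x))); exact: isderD.
Qed.

Lemma cderM u v x z w : cder u x z -> cder v x w ->
  cder (fun y => u y * v y) x (z * v x + u x * w).
Proof.
move=> [u1 u2] [v1 v2]; split.
  rewrite (funext (fun x => cReM (u x) (v x))).
  have := isderB (isderM u1 v1) (isderM u2 v2).
  by congr is_derive; rewrite !cReImE; ring.
rewrite (funext (fun x => cImM (u x) (v x))).
have := isderD (isderM u1 v2) (isderM u2 v1).
by congr is_derive; rewrite !cReImE; ring.
Qed.

Lemma cder_cst c x : cder (fun=> c) x 0.
Proof. by split; exact: isder_cst. Qed.

Lemma cderZ c u x z : cder u x z -> cder (fun y => c * u y) x (c * z).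
Proof. by move=> uz; have := cderM (cder_cst c x) uz; rewrite mul0r add0r. Qed.

Lemma cder_sum I (r : seq I) (F : I -> R -> R[i]) (dF : I -> R[i]) x :
  (forall i, cder (F i) x (dF i)) ->
  cder (fun y => \sum_(i <- r) F i y) x (\sum_(i <- r) dF i).
Proof.
move=> FdF; elim: r => [|i r IH].
  rewrite big_nil (_ : (fun _ => _) = fun=> 0); first exact: cder_cst.
  by apply/funext => y; rewrite big_nil.
rewrite big_cons (_ : (fun _ => _) = fun y => F i y + \sum_(j <- r) F j y).
  exact: cderD.
by apply/funext => y; rewrite big_cons.
Qed.

Lemma cder_expi (k l x : R) :
  cder (fun y => expi (k * (y - l))) x ('i%C * k%:C * expi (k * (x - l))).
Proof.
split.
  have := isder_comp_affine (is_derive_cos (k * (x - l))).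
  by congr is_derive; rewrite !cReImE /=; ring.
have := isder_comp_affine (is_derive_sin (k * (x - l))).
by congr is_derive; rewrite !cReImE /=; ring.
Qed.

Lemma cder_real f (x p : R) : is_derive x 1 f p -> cder (fun y => (f y)%:C) x p%:C.
Proof. by move=> fp; split => //=; exact: isder_cst. Qed.

Lemma ccont_cmeas (a b : R) u : ccont u -> cmeas a b u.
Proof.
move=> [u1 u2]; split; apply: measurable_funTS; exact: continuous_measurable_fun.
Qed.

Lemma cint_FTC (a b : R) u du : a < b -> (forall x, cder u x (du x)) -> ccont du ->
  cintegral a b du = u b - u a.
Proof.
move=> ab ud [c1 c2]; rewrite /cintegral.
rewrite (Rint_FTC ab (fun x => (ud x).1) c1) (Rint_FTC ab (fun x => (ud x).2) c2).
by apply: complex_ext; rewrite !cReImE.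
Qed.

Lemma cintg_ccont (a b : R) u : ccont u -> cintg a b u.
Proof. by move=> [u1 u2]; split; exact: intg_continuous. Qed.

Lemma ccont_bounded (a b : R) u : ccont u ->
  exists M, forall x, a <= x <= b -> cabs (u x) <= M.
Proof.
move=> [c1 c2].
have bd f : continuous f -> exists M, forall x, a <= x <= b -> `|f x| <= M.
  move=> cf; have [ab|ba] := leP a b; last first.
    by exists 0 => x; lra.
  have cw : {within `[a, b], continuous (fun x => `|f x|)}.
    apply: continuous_subspaceT => x; apply: continuous_comp; first exact: cf.
    exact: norm_continuous.
  have [c _ cmax] := EVT_max ab cw; exists `|f c| => x xab; apply: cmax.
  by rewrite in_itv.
have [M1 H1] := bd _ c1; have [M2 H2] := bd _ c2.
exists (M1 + M2) => x xab; apply: le_trans (cabs_ReIm _) _.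
by apply: lerD; [exact: H1|exact: H2].
Qed.

Lemma ccont_in_L2 (a b : R) u : ccont u -> in_L2 a b u.
Proof.
move=> uc; have [M HM] := ccont_bounded a b uc.
apply: (@in_L2_bounded _ _ _ _ M); first exact: ccont_cmeas.
by move=> x /andP[ax xb]; apply: HM; rewrite !ltW.
Qed.

Lemma ccontM u v : ccont u -> ccont v -> ccont (fun x => u x * v x).
Proof.
move=> [u1 u2] [v1 v2]; split.
  rewrite (funext (fun x => cReM (u x) (v x))) => x.
  apply: cvgB; apply: cvgM; [exact: u1|exact: v1|exact: u2|exact: v2].
rewrite (funext (fun x => cImM (u x) (v x))) => x.
apply: cvgD; apply: cvgM; [exact: u1|exact: v2|exact: u2|exact: v1].
Qed.

Lemma ccontD u v : ccont u -> ccont v -> ccont (fun x => u x + v x).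
Proof.
move=> [u1 u2] [v1 v2]; split.
  by rewrite (funext (fun x => cReD (u x) (v x))) => x; apply: cvgD; [exact: u1|exact: v1].
by rewrite (funext (fun x => cImD (u x) (v x))) => x; apply: cvgD; [exact: u2|exact: v2].
Qed.

Lemma ccont_real f : continuous f -> ccont (fun x => (f x)%:C).
Proof. by move=> cf; split => //=; exact: cst_continuous. Qed.

Lemma ccont_cst c : ccont (fun=> c).
Proof. by split; exact: cst_continuous. Qed.

(** The derivative of [u * chi] integrates to 0, since [chi] vanishes at both ends. *)
Lemma cder_weak_derivative (a b : R) u du : a < b ->
  (forall x, cder u x (du x)) -> ccont du -> weak_derivative a b u du.
Proof.
move=> ab ud cdu chi [dchi cdchi [c [d [ac db chi0]]]].
have dchi' (x : R) : is_derive x 1 chi (derive1 chi x).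
  by rewrite derive1E; exact: derivableP.
have cchi := isder_continuous dchi'.
have cu := cder_ccont ud.
have H := @cint_FTC a b (fun x => u x * (chi x)%:C) _ ab
  (fun x => cderM (ud x) (cder_real (dchi' x))).
have chia : chi a = 0 by apply: chi0; lra.
have chib : chi b = 0 by apply: chi0; lra.
have c1 : ccont (fun x => du x * (chi x)%:C) by apply: ccontM => //; exact: ccont_real.
have c2 : ccont (fun x => u x * (derive1 chi x)%:C) by apply: ccontM => //; exact: ccont_real.
have := H (ccontD c1 c2).
rewrite chia chib !mulr0 subrr cintegralD; [|exact: cintg_ccont|exact: cintg_ccont].
by move/eqP; rewrite addrC addr_eq0 => /eqP.
Qed.

End Calculus.

(** * Trigonometric polynomials *)

Section TrigonometricPolynomials.
Context {R : realType}.
Variables (a b : R).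
Hypothesis hab : a < b.
Implicit Types (u v : R -> R[i]) (c z w : R[i]) (x : R).
Notation leb := (@lebesgue_measure R).
Notation in2 := (in_L2 a b).
Notation nrm := (nrm a b).
Notation mu := (mu a b).
Notation fc := (fourier_coef a b).

Definition em (l : int) (x : R) : R[i] := expi (mu l * (x - a)).

Lemma emE l x : em l x = expi (mu l * (x - a)).
Proof. by []. Qed.

Definition tp N (d : 'I_N -> R[i]) (x : R) : R[i] :=
  \sum_(l < N) d l * em (freq l) x.

Let ba0 : 0 < b - a. Proof. by rewrite subr_gt0. Qed.
Let ban0 : b - a != 0. Proof. by rewrite gt_eqF. Qed.
Lemma muD k l : mu (k + l) = mu k + mu l.
Proof. by rewrite /Defs.mu rmorphD /= mulrDr mulrDl. Qed.

Lemma muN l : mu (- l) = - mu l.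
Proof. by rewrite /Defs.mu rmorphN /= mulrN mulNr. Qed.

Lemma mu0 : mu 0 = 0.
Proof. by rewrite /Defs.mu mulr0 mul0r. Qed.

Lemma mu_neq0 l : l != 0 -> mu l != 0.
Proof.
move=> l0; rewrite /Defs.mu; apply: mulf_neq0; last by rewrite invr_eq0.
by rewrite !mulf_neq0 ?intr_eq0 ?pnatr_eq0// gt_eqF// pi_gt0.
Qed.

Lemma emD k l x : em (k + l) x = em k x * em l x.
Proof. by rewrite /em muD mulrDl expiD. Qed.

Lemma emN l x : em (- l) x = conjc (em l x).
Proof. by rewrite /em muN mulNr expiN. Qed.

Lemma em0 x : em 0 x = 1.
Proof. by rewrite /em mu0 mul0r expi0. Qed.

Lemma cabs_em l x : cabs (em l x) = 1.
Proof. exact: cabs_expi. Qed.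

Lemma em_a l : em l a = 1.
Proof. by rewrite /em subrr mulr0 expi0. Qed.

Lemma em_b l : em l b = 1.
Proof.
rewrite /em /Defs.mu -[_ / (b - a) * _]mulrA mulVf// mulr1.
exact: expi_2pi_int.
Qed.

Lemma em_cder l x : cder (em l) x ('i%C * (mu l)%:C * em l x).
Proof. exact: cder_expi. Qed.

Lemma em_ccont l : ccont (em l).
Proof. exact: cder_ccont (em_cder l). Qed.

Lemma em_in_L2 l : in2 (em l).
Proof. exact: ccont_in_L2 (em_ccont l). Qed.

(** For [l != 0] the derivative of the mode is a nonzero multiple of the mode, and its integral is
    the difference of two equal end values. *)
Lemma cintegral_em l : cintegral a b (em l) = if l == 0 then (b - a)%:C else 0.
Proof.
have [->|l0] := eqVneq l 0.
  rewrite (_ : em 0 = fun=> 1); first by rewrite cintegral_cst// mulr1.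
  by apply/funext => x; rewrite em0.
have ml0 : 'i%C * (mu l)%:C != 0 :> R[i].
  by rewrite -cabs_eq0 cabsM cabs_i mul1r cabs_real normr_eq0 mu_neq0.
apply/(mulfI ml0); rewrite mulr0 -cintegralZ; last exact: cintg_ccont (em_ccont l).
rewrite (cint_FTC hab (em_cder l)) ?em_a ?em_b ?subrr//.
by apply: ccontM; [exact: ccont_cst|exact: em_ccont].
Qed.

Lemma fourier_coefE u l : fc u l =
  ((b - a)^-1)%:C * cintegral a b (fun x => u x * em (- l) x).
Proof.
rewrite /fourier_coef; congr (_ * _); apply: eq_cintegral => x _.
by rewrite /em muN mulNr.
Qed.

Lemma eq_fourier_coef u v l : (forall x, a < x < b -> u x = v x) -> fc u l = fc v l.
Proof.
by move=> uv; congr (_ * _); apply: eq_cintegral => x xab; rewrite uv.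
Qed.

Lemma fourier_coefD u v l : in2 u -> in2 v ->
  fc (fun x => u x + v x) l = fc u l + fc v l.
Proof.
move=> uL2 vL2; rewrite !fourier_coefE -mulrDr -cintegralD.
- by congr (_ * _); apply: eq_cintegral => x _; rewrite mulrDl.
- by apply: cintgM => //; exact: em_in_L2.
- by apply: cintgM => //; exact: em_in_L2.
Qed.

Lemma fourier_coefZ c u l : in2 u -> fc (fun x => c * u x) l = c * fc u l.
Proof.
move=> uL2; rewrite !fourier_coefE [RHS]mulrCA.
rewrite -(cintegralZ c (cintgM uL2 (em_in_L2 (- l)))).
by congr (_ * _); apply: eq_cintegral => x _; rewrite mulrA.
Qed.

Lemma fourier_coefB u v l : in2 u -> in2 v ->
  fc (fun x => u x - v x) l = fc u l - fc v l.
Proof.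
move=> uL2 vL2; rewrite fourier_coefD//; last exact: in_L2N.
congr (_ + _); rewrite -[RHS]mulN1r -(fourier_coefZ (- 1) l vL2).
by apply: eq_fourier_coef => x _; rewrite mulN1r.
Qed.

Lemma fourier_coef_sum I (r : seq I) (F : I -> R -> R[i]) l :
  (forall i, in2 (F i)) ->
  fc (fun x => \sum_(i <- r) F i x) l = \sum_(i <- r) fc (F i) l.
Proof.
move=> FL2; elim: r => [|i r IH].
  rewrite big_nil (_ : (fun _ => _) = fun x => 0 * em 0 x).
    by rewrite (fourier_coefZ 0 l (em_in_L2 0)) mul0r.
  by apply/funext => x; rewrite big_nil mul0r.
rewrite big_cons -IH -fourier_coefD//; last exact: in_L2_sum.
by apply: eq_fourier_coef => x _; rewrite big_cons.
Qed.

Lemma ae_eq_fourier_coef u v l : cmeas a b u -> cmeas a b v ->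
  {ae leb, forall x, a < x < b -> u x = v x} -> fc u l = fc v l.
Proof.
move=> mu mv uv; rewrite !fourier_coefE; congr (_ * _); apply: ae_eq_cintegral.
- exact: cmeasM mu (in_L2_cmeas (em_in_L2 _)).
- exact: cmeasM mv (in_L2_cmeas (em_in_L2 _)).
- by apply: (aeS _ uv) => x H /H ->.
Qed.

Lemma fourier_coef_em k l : fc (em k) l = (k == l)%:R.
Proof.
rewrite fourier_coefE (@eq_cintegral _ _ _ _ (em (k - l))); last first.
  by move=> x _; rewrite emD.
rewrite cintegral_em subr_eq0; case: eqVneq => _; last by rewrite mulr0.
by rewrite -rmorphM mulVf.
Qed.

Lemma freq_inj N : injective (@freq N).
Proof. by move=> i j /addIr [] /val_inj. Qed.

Lemma tp_in_L2 N (d : 'I_N -> R[i]) : in2 (tp d).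
Proof. by apply: in_L2_sum => l; exact: (in_L2Z _ (em_in_L2 _)).1. Qed.

Lemma tp_cder N (d : 'I_N -> R[i]) x :
  cder (tp d) x (tp (fun l => 'i%C * (mu (freq l))%:C * d l) x).
Proof.
apply: cder_sum => l; have := cderZ (d l) (em_cder (freq l) x).
by congr cder; ring.
Qed.

Lemma tp_ccont N (d : 'I_N -> R[i]) : ccont (tp d).
Proof. exact: cder_ccont (tp_cder d). Qed.

Lemma tpD N (d d' : 'I_N -> R[i]) x : tp d x + tp d' x = tp (fun l => d l + d' l) x.
Proof. by rewrite /tp -big_split; apply: eq_bigr => l _; rewrite mulrDl. Qed.

Lemma tpZ N c (d : 'I_N -> R[i]) x : c * tp d x = tp (fun l => c * d l) x.
Proof. by rewrite /tp mulr_sumr; apply: eq_bigr => l _; rewrite mulrA. Qed.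

Lemma tpB N (d d' : 'I_N -> R[i]) x : tp d x - tp d' x = tp (fun l => d l - d' l) x.
Proof. by rewrite /tp -sumrB; apply: eq_bigr => l _; rewrite mulrBl. Qed.

Lemma fourier_coef_tp N (d : 'I_N -> R[i]) (l : 'I_N) : fc (tp d) (freq l) = d l.
Proof.
rewrite fourier_coef_sum; last by move=> k; exact: (in_L2Z _ (em_in_L2 _)).1.
rewrite (bigD1 l)//= fourier_coefZ ?fourier_coef_em ?eqxx ?mulr1; last exact: em_in_L2.
rewrite big1 ?addr0// => k kl; rewrite fourier_coefZ; last exact: em_in_L2.
by rewrite fourier_coef_em (inj_eq (@freq_inj N)) (negbTE kl) mulr0.
Qed.

Definition inner u v : R[i] := cintegral a b (fun x => u x * conjc (v x)).

Lemma inner_tp N u (d : 'I_N -> R[i]) : in2 u ->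
  inner u (tp d) = (b - a)%:C * \sum_(l < N) fc u (freq l) * conjc (d l).
Proof.
move=> uL2; rewrite /inner mulr_sumr.
rewrite (@eq_cintegral _ _ _ _
  (fun x => \sum_(l < N) conjc (d l) * (u x * em (- freq l) x))); last first.
  move=> x _; rewrite /tp conjc_sum mulr_sumr; apply: eq_bigr => l _.
  by rewrite conjcM emN; ring.
have i1 (l : 'I_N) : cintg a b (fun x => u x * em (- freq l) x).
  by apply: cintgM => //; exact: em_in_L2.
rewrite (cintegral_sum _ (fun l => cintgZ (conjc (d l)) (i1 l))).1.
apply: eq_bigr => l _; rewrite cintegralZ// fourier_coefE.
rewrite !mulrA -rmorphM mulfV// rmorph1 mul1r.
by rewrite mulrC.
Qed.

Lemma sqr_nrmB u v : in2 u -> in2 v ->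
  nrm (fun x => u x - v x) ^+ 2 =
  nrm u ^+ 2 + nrm v ^+ 2 - 2 * complex.Re (inner u v).
Proof.
move=> uL2 vL2; have uvL2 := in_L2B uL2 vL2.
have iu := cintgM uL2 (in_L2_conj uL2); have iv := cintgM vL2 (in_L2_conj vL2).
have iuv := cintgM uL2 (in_L2_conj vL2); have ivu := cintgM vL2 (in_L2_conj uL2).
have E : inner v u = conjc (inner u v).
  rewrite -cintegral_conj//; apply: eq_cintegral => x _.
  by rewrite conjcM conjcK mulrC.
have : ((nrm (fun x => u x - v x) ^+ 2)%:C = (nrm u ^+ 2)%:C + (nrm v ^+ 2)%:C
  - (inner u v + inner v u) :> R[i]).
  rewrite -!cintegral_mul_conj// -!cintegralD// -cintegralB//.
  - by apply: eq_cintegral => x _; rewrite conjcD conjcN; ring.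
  - exact: cintgD.
  - exact: cintgD.
move/(congr1 (@complex.Re R)); rewrite E !cReImE /= => ->; ring.
Qed.

Lemma sqr_nrm_tp N (d : 'I_N -> R[i]) :
  nrm (tp d) ^+ 2 = (b - a) * \sum_(l < N) cabs (d l) ^+ 2.
Proof.
apply: complexI; rewrite -cintegral_mul_conj; last exact: tp_in_L2.
rewrite -/(inner (tp d) (tp d)) inner_tp; last exact: tp_in_L2.
rewrite rmorphM rmorph_sum; congr (_ * _); apply: eq_bigr => l _ /=.
by rewrite fourier_coef_tp mul_conj.
Qed.

(** The predicate selects the retained frequencies, so that the full projection and the
    low-frequency one share the same Pythagorean identity. *)
Definition trig_proj (A : pred int) N u : R -> R[i] :=
  tp (fun l : 'I_N => if A (freq l) then fc u (freq l) else 0).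

Lemma sqr_nrm_sub_trig_proj (A : pred int) N u : in2 u ->
  nrm (fun x => u x - trig_proj A N u x) ^+ 2 =
  nrm u ^+ 2 - (b - a) * \sum_(l < N | A (freq l)) cabs (fc u (freq l)) ^+ 2.
Proof.
move=> uL2; rewrite sqr_nrmB//; last exact: tp_in_L2.
rewrite sqr_nrm_tp inner_tp//.
set S := \sum_(l < N | A (freq l)) cabs (fc u (freq l)) ^+ 2.
have -> : \sum_(l < N) cabs (if A (freq l) then fc u (freq l) else 0) ^+ 2 = S.
  rewrite /S [RHS]big_mkcond; apply: eq_bigr => l _.
  by case: ifP => // _; rewrite cabs0 expr0n.
have -> : \sum_(l < N) fc u (freq l) *
    conjc (if A (freq l) then fc u (freq l) else 0) = S%:C.
  rewrite /S [X in _ = X%:C]big_mkcond rmorph_sum; apply: eq_bigr => l _ /=.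
  case: ifP => _; first by rewrite mul_conj.
  by rewrite conjc_real mulr0.
rewrite -rmorphM /=; ring.
Qed.

Lemma bessel N u : in2 u ->
  (b - a) * \sum_(l < N) cabs (fc u (freq l)) ^+ 2 <= nrm u ^+ 2.
Proof.
move=> uL2; rewrite -subr_ge0 -(sqr_nrm_sub_trig_proj predT)//.
exact: sqr_ge0.
Qed.

(** Bound for Fourier multipliers: every operator acting mode by mode (propagator, corrector,
    projection, differentiation on [X_N]) is estimated through it. *)
Lemma nrm_trig_proj_le N u (d : 'I_N -> R[i]) (k : R) : 0 <= k -> in2 u ->
  (forall l, cabs (d l) <= k * cabs (fc u (freq l))) -> nrm (tp d) <= k * nrm u.
Proof.
move=> k0 uL2 dk; rewrite -ler_sqr ?nnegrE ?mulr_ge0 ?nrm_ge0// exprMn sqr_nrm_tp.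
apply: le_trans (ler_wpM2l (sqr_ge0 k) (bessel N uL2)).
rewrite mulrCA ler_pM2l// mulr_sumr; apply: ler_sum => l _.
by rewrite -exprMn ler_sqr ?nnegrE ?mulr_ge0 ?cabs_ge0.
Qed.

End TrigonometricPolynomials.

(** * Functions with a weak derivative *)

Section Ramp.
Context {R : realType}.
Implicit Types (x y : R).
Notation leb := (@lebesgue_measure R).

Definition pos x : R := Num.max x 0.

Lemma posE x : pos x = if 0 <= x then x else 0.
Proof. by rewrite /pos; case: leP. Qed.

Lemma pos_continuous : continuous pos.
Proof.
have -> : pos = (fun x => (x + `|x|) / 2).
  apply/funext => x; rewrite posE; case: leP => x0.
    by rewrite ger0_norm//; lra.
  by rewrite ltr0_norm//; lra.
move=> x; apply: cvgM; last exact: cvg_cst.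
by apply: cvgD; [exact: cvg_id|exact: norm_continuous].
Qed.

Lemma is_derive_pos_sqr x : is_derive x 1 (fun y => pos y ^+ 2) (2 * pos x).
Proof.
have [x0|x0|->] := ltgtP x 0.
- apply: (@near_eq_is_derive _ _ _ (fun=> 0)).
    near=> y; rewrite posE ifF ?expr0n//; apply/negbTE; rewrite -ltNge.
    by near: y; exact: lt_nbhsl.
  by rewrite posE leNgt x0 /= mulr0; exact: isder_cst.
- apply: (@near_eq_is_derive _ _ _ (fun y => y * y)).
    near=> y; rewrite posE ifT ?expr2//.
    by apply/ltW; near: y; exact: lt_nbhsr.
  have := isderM (@is_derive_id _ _ x 1) (@is_derive_id _ _ x 1).
  by congr is_derive; rewrite posE (ltW x0) /=; lra.
- have p0 : pos 0 = 0 by rewrite posE lexx.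
  rewrite p0 mulr0.
  have H : (fun h : R => h^-1 *: (pos (h *: 1 + 0) ^+ 2 - pos 0 ^+ 2)) @ 0^' --> (0 : R).
    apply/cvgrPdist_le => e e0; near=> h.
    rewrite sub0r normrN addr0 p0 expr0n subr0 [_ *: 1]mulr1.
    have h0 : h != 0 by near: h; exact: nbhs_dnbhs_neq.
    have he : `|h| <= e.
      by near: h; exact: dnbhs0_le.
    rewrite [_ *: _](_ : _ = h^-1 * pos h ^+ 2)// posE; case: (leP 0 h) => hh.
      by rewrite expr2 mulrA mulVf// mul1r.
    by rewrite expr0n mulr0 normr0 ltW.
  by apply: DeriveDef; [apply/cvg_ex; exists 0|exact: cvg_lim H].
Unshelve. all: by end_near.
Qed.

(** The triangle function with support [0, 2] and integral 1. Its primitive [ramp] is a C^1 step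
    from 0 to 1, which supplies the cutoffs used as test functions. *)
Definition hat x : R := pos x - 2 * pos (x - 1) + pos (x - 2).

Definition ramp x : R := (pos x ^+ 2 - 2 * pos (x - 1) ^+ 2 + pos (x - 2) ^+ 2) / 2.

Lemma is_derive_shift f (l x p : R) : is_derive (x - l) 1 f p ->
  is_derive x 1 (fun y : R => f (y - l) : R) p.
Proof.
move=> fp; have := @isder_comp_affine _ f 1 l x p; rewrite !mul1r => /(_ fp).
by congr is_derive; apply/funext => y; rewrite mul1r.
Qed.

Lemma is_derive_ramp x : is_derive x 1 ramp (hat x).
Proof.
have := isderM (isderD (isderB (is_derive_pos_sqr x)
   (isderM (isder_cst 2 x) (is_derive_shift (is_derive_pos_sqr (x - 1)))))
   (is_derive_shift (is_derive_pos_sqr (x - 2)))) (isder_cst 2^-1 x).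
by congr is_derive; rewrite /hat; field.
Qed.

Lemma hat_ge0 x : 0 <= hat x.
Proof.
by rewrite /hat !posE; case: (leP 0 x); case: (leP 0 (x - 1)); case: (leP 0 (x - 2)); lra.
Qed.

Lemma hat_out x : x <= 0 \/ 2 <= x -> hat x = 0.
Proof.
by rewrite /hat !posE => -[] ?; do 3 case: leP => ?; lra.
Qed.

Lemma ramp_le0 x : x <= 0 -> ramp x = 0.
Proof.
move=> x0; rewrite /ramp !posE; do 3 case: leP => ?; rewrite ?expr0n /=; try lra.
have -> : x = 0 by lra.
by lra.
Qed.

Lemma ramp_ge2 x : 2 <= x -> ramp x = 1.
Proof.
move=> x0; rewrite /ramp !posE; do 3 case: leP => ?; rewrite ?expr0n /=; try lra.
Qed.

Lemma ramp_itv x : 0 <= ramp x <= 1.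
Proof.
rewrite /ramp !posE; case: (leP 0 x); case: (leP 0 (x - 1));
  case: (leP 0 (x - 2)); rewrite ?expr0n /= => *; apply/andP; split; nra.
Qed.

Lemma hat_continuous : continuous hat.
Proof.
have sh (l : R) : continuous (fun y => pos (y - l)).
  move=> x; apply: (@continuous_comp _ _ _ (fun y => y - l) pos); last exact: pos_continuous.
  by apply: cvgB; [exact: cvg_id|exact: cvg_cst].
move=> x; apply: cvgD; last exact: sh.
apply: cvgB; first exact: pos_continuous.
by apply: cvgM; [exact: cvg_cst|exact: sh].
Qed.

(** The triangle rescaled to [p, p + 2e] with mass 1, an approximate Dirac mass at [p]. *)
Definition kern (e p x : R) : R := e^-1 * hat (e^-1 * (x - p)).

Lemma kern_ge0 (e p x : R) : 0 < e -> 0 <= kern e p x.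
Proof. by move=> e0; rewrite mulr_ge0 ?hat_ge0// invr_ge0 ltW. Qed.

Lemma kern_out (e p x : R) : 0 < e -> ~ (p <= x <= p + 2 * e) -> kern e p x = 0.
Proof.
move=> e0 px; rewrite /kern hat_out ?mulr0//.
have [xp|xp] := leP x p.
  by left; rewrite mulr_ge0_le0 ?subr_le0// invr_ge0 ltW.
right; rewrite ler_pdivlMl// leNgt; apply/negP => H; apply: px; lra.
Qed.

Lemma kern_continuous (e p : R) : continuous (kern e p).
Proof.
move=> x; apply: cvgM; first exact: cvg_cst.
apply: (@continuous_comp _ _ _ (fun y => e^-1 * (y - p)) hat); last exact: hat_continuous.
apply: cvgM; first exact: cvg_cst.
by apply: cvgB; [exact: cvg_id|exact: cvg_cst].
Qed.

Lemma is_derive_kern (e p x : R) :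
  is_derive x 1 (fun y => ramp (e^-1 * (y - p))) (kern e p x).
Proof. exact: isder_comp_affine (is_derive_ramp _). Qed.

Lemma Rint_kern (a b e p : R) : 0 < e -> a <= p -> p + 2 * e <= b ->
  Rintegral leb `]a, b[ (kern e p) = 1.
Proof.
move=> e0 ap pb; have ab : a < b by lra.
rewrite (Rint_FTC ab (is_derive_kern e p) (@kern_continuous e p)).
rewrite ramp_ge2; last by rewrite ler_pdivlMl//; lra.
by rewrite ramp_le0 ?subr0// mulr_ge0_le0 ?invr_ge0 ?(ltW e0) ?subr_le0.
Qed.

End Ramp.

(** * Continuity on a closed interval and approximate identities *)

Section WithinContinuous.
Context {R : realType}.
Variables (a b : R).
Notation leb := (@lebesgue_measure R).
Implicit Types (f w : R -> R).

Lemma within_eps w : {within `[a, b], continuous w} -> forall c eta : R,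
  a <= c <= b -> 0 < eta -> exists2 delta, 0 < delta &
  forall x, a <= x <= b -> `|x - c| < delta -> `|w x - w c| <= eta.
Proof.
move=> /subspace_continuousP cw c eta cab eta0.
have /= := cw c; rewrite in_itv /= => /(_ cab) /cvgrPdist_le /(_ eta eta0).
rewrite /prop_near1 /within /= => /nbhs_ballP[delta /= delta0 H].
exists delta => // x xab xc; rewrite distrC.
have := H x; rewrite in_itv /=; apply => //.
by rewrite /ball /= distrC.
Qed.

Lemma intg_within w : {within `[a, b], continuous w} -> intg a b w.
Proof.
move=> cw; have i0 : leb.-integrable `[a, b] (EFin \o w).
  by apply: continuous_compact_integrable => //; exact: segment_compact.
by apply: integrableS i0 => //; exact: subset_itv_oo_cc.
Qed.

Lemma withinM w f : {within `[a, b], continuous w} -> continuous f ->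
  {within `[a, b], continuous (fun x => w x * f x)}.
Proof.
move=> cw /continuous_subspaceT cf x.
by apply: cvgM; [exact: cw|exact: cf].
Qed.

Lemma within_bounded w : a <= b -> {within `[a, b], continuous w} ->
  exists M, forall x, a <= x <= b -> `|w x| <= M.
Proof.
move=> ab cw; have cw' : {within `[a, b], continuous (fun x => `|w x|)}.
  by move=> x; apply: cvg_norm; exact: cw.
have [c _ cmax] := EVT_max ab cw'; exists `|w c| => x xab; apply: cmax.
by rewrite in_itv.
Qed.

(** As the kernel has mass 1, [y] may be moved under the integral; only the support of the kernel
    then matters. *)
Lemma approximate_identity w (e p y eta : R) : {within `[a, b], continuous w} ->
  0 < e -> a <= p -> p + 2 * e <= b ->
  (forall x, p <= x <= p + 2 * e -> `|w x - y| <= eta) ->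
  `|Rintegral leb `]a, b[ (fun x => w x * kern e p x) - y| <= eta.
Proof.
move=> cw e0 ap pb wy.
have ck := @kern_continuous R e p; have ik := intg_continuous a b ck.
have iwk := intg_within (withinM cw ck).
have E : Rintegral leb `]a, b[ (fun x => w x * kern e p x) - y =
  Rintegral leb `]a, b[ (fun x => (w x - y) * kern e p x).
  transitivity (Rintegral leb `]a, b[ (fun x => w x * kern e p x) -
    Rintegral leb `]a, b[ (fun x => y * kern e p x)).
    by rewrite RintegralZl// Rint_kern// mulr1.
  rewrite -RintegralB//; last exact: (intgZ y ik).
  by apply: eq_Rintegral => x _; rewrite mulrBl.
rewrite E -[eta]mulr1 -(Rint_kern e0 ap pb) -RintegralZl//.
have ii : intg a b (fun x => (w x - y) * kern e p x).
  have := intgB iwk (intgZ y ik).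
  by congr (intg a b); apply/funext => x; rewrite mulrBl.
apply: (le_trans (le_normr_Rintegral _ ii)) => //.
apply: le_Rintegral => //; [exact: (integrable_norm ii)|exact: (intgZ eta ik)|].
move=> x _; rewrite normrM [`|kern _ _ _|]ger0_norm ?kern_ge0//.
have [px|px] := pselect (p <= x <= p + 2 * e).
  by apply: ler_wpM2r; [exact: kern_ge0|exact: wy].
rewrite [leRHS](_ : _ = eta * kern e p x)//.
by rewrite (kern_out e0 px) !mulr0.
Qed.

End WithinContinuous.

Lemma seq_cvg_unique {R : realType} (u : nat -> R) (l l' : R) :
  u @ \oo --> l -> u @ \oo --> l' -> l = l'.
Proof.
by move=> ul ul'; rewrite -(cvg_lim (@norm_hausdorff _ _) ul);
  exact: cvg_lim ul'.
Qed.

(** * Integration by parts with boundary terms for weak derivatives *)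

Section BoundaryTerms.
Context {R : realType}.
Implicit Types (a b c d e x : R) (f u g phi dphi : R -> R).
Notation leb := (@lebesgue_measure R).

(** C^1 cutoff: 1 on [c + 3e, d - 3e] and 0 outside [c + e, d - e]. *)
Definition cutoff c d e x : R :=
  ramp (e^-1 * (x - (c + e))) - ramp (e^-1 * (x - (d - 3 * e))).

Definition dcutoff c d e x : R := kern e (c + e) x - kern e (d - 3 * e) x.

Lemma is_derive_cutoff c d e x : is_derive x 1 (cutoff c d e) (dcutoff c d e x).
Proof. by apply: isderB; exact: is_derive_kern. Qed.

Lemma dcutoff_continuous c d e : continuous (dcutoff c d e).
Proof. by move=> x; apply: cvgB; exact: kern_continuous. Qed.

Lemma cutoff_continuous c d e : continuous (cutoff c d e).
Proof. exact: isder_continuous (is_derive_cutoff c d e). Qed.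

Lemma cutoff_out c d e x : 0 < e -> 6 * e <= d - c ->
  ~ (c + e <= x <= d - e) -> cutoff c d e x = 0.
Proof.
move=> e0 e6 H.
have [xc|xc] := leP x (c + e).
  by rewrite /cutoff !ramp_le0 ?subrr// mulr_ge0_le0 ?invr_ge0 ?(ltW e0)//; lra.
have xd : d - e < x by rewrite ltNge; apply/negP => K; apply: H; lra.
by rewrite /cutoff !ramp_ge2 ?subrr// ler_pdivlMl//; lra.
Qed.

Lemma cutoff_in c d e x : 0 < e ->
  c + 3 * e <= x <= d - 3 * e -> cutoff c d e x = 1.
Proof.
move=> e0 H; rewrite /cutoff ramp_ge2; last by rewrite ler_pdivlMl//; lra.
by rewrite ramp_le0 ?subr0// mulr_ge0_le0 ?invr_ge0 ?(ltW e0)//; lra.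
Qed.

Lemma cutoff_le1 c d e x : `|cutoff c d e x| <= 1.
Proof.
rewrite /cutoff.
have := ramp_itv (e^-1 * (x - (c + e))).
have := ramp_itv (e^-1 * (x - (d - 3 * e))).
by rewrite ler_norml; lra.
Qed.

(** Since the support lies strictly inside [c, d], a weak derivative on [a, b] can be tested on any
    subinterval, even one that touches the endpoints. *)
Lemma cutoff_test a b c d e phi dphi : 0 < e -> 6 * e <= d - c -> a <= c -> d <= b ->
  (forall x : R, is_derive x 1 phi (dphi x)) -> continuous dphi ->
  test_function a b (fun x => cutoff c d e x * phi x) /\
  forall x, derive1 (fun x => cutoff c d e x * phi x) x =
            dcutoff c d e x * phi x + cutoff c d e x * dphi x.
Proof.
move=> e0 e6 ac db dphiE cdphi.
have D x := isderM (is_derive_cutoff c d e x) (dphiE x).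
have E x : derive1 (fun x => cutoff c d e x * phi x) x =
    dcutoff c d e x * phi x + cutoff c d e x * dphi x.
  by rewrite derive1E (@derive_val _ _ _ _ _ _ _ (D x)).
split => //; split.
- by move=> x; exact: (@ex_derive _ _ _ _ _ _ _ (D x)).
- rewrite (funext E) => x; apply: cvgD; apply: cvgM.
  + exact: dcutoff_continuous.
  + exact: isder_continuous dphiE x.
  + exact: cutoff_continuous.
  + exact: cdphi.
- exists (c + e), (d - e); split; [lra|lra|move=> x H].
  by rewrite cutoff_out// mul0r.
Qed.

(** Dominated convergence: the cutoffs are bounded by 1 and tend pointwise to the indicator function
    of ]c, d[. *)
Lemma cutoff_cvg a b c d f (e_ : nat -> R) : a <= c -> d <= b -> intg a b f ->
  (forall n, 0 < e_ n) -> (forall n, 6 * e_ n <= d - c) -> e_ @ \oo --> (0 : R) ->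
  Rintegral leb `]a, b[ (fun x => f x * cutoff c d (e_ n) x) @[n --> \oo] -->
  Rintegral leb `]c, d[ f.
Proof.
move=> ac db fi e0 e6 e_cvg; have mf : measurable_fun `]a, b[%classic f.
  by move/integrableP : fi => [/measurable_EFinP].
have sub : `]c, d[%classic `<=` `]a, b[%classic.
  by move=> x /=; rewrite !in_itv /=; lra.
have -> : Rintegral leb `]c, d[ f = Rintegral leb `]a, b[ (f \_ `]c, d[).
  by rewrite -Rintegral_mkcondr setIC setIidl.
have mr : measurable_fun `]a, b[%classic (f \_ `]c, d[).
  by apply/measurable_restrict => //; apply: measurable_funS mf => // x [].
have pw' x : f x * cutoff c d (e_ n) x @[n --> \oo] --> (f \_ `]c, d[) x.
  apply: cvg_near_cst; rewrite /patch; case: ifPn => [|].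
    rewrite inE /= in_itv /= => /andP[cx xd].
    have m0 : 0 < Num.min (x - c) (d - x) / 3.
      by rewrite divr_gt0// lt_min !subr_gt0 cx.
    (* Once [e_ n] is less than a third of the distance from [x] to the ends, [x] lies where the
       cutoff equals 1. *)
    near=> n.
    have : e_ n < Num.min (x - c) (d - x) / 3 by near: n; exact: cvgr_lt e_cvg _ m0.
    rewrite ltr_pdivlMr// lt_min => /andP[H1 H2].
    by rewrite cutoff_in ?mulr1//; lra.
  move/negP => H; apply: nearW => n; rewrite cutoff_out ?mulr0//.
  move=> K; apply: H; rewrite inE /= in_itv /=; have := e0 n; lra.
have pw x : (f x * cutoff c d (e_ n) x)%:E @[n --> \oo] --> ((f \_ `]c, d[) x)%:E.
  by apply: cvg_EFin; [exact: nearW|exact: pw'].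
have mn n : measurable_fun `]a, b[%classic (EFin \o (fun x => f x * cutoff c d (e_ n) x)).
  apply/measurable_EFinP; apply: measurable_funM => //.
  by apply: measurable_funTS; apply: continuous_measurable_fun; exact: cutoff_continuous.
have mr' : measurable_fun `]a, b[%classic (EFin \o (f \_ `]c, d[)).
  exact/measurable_EFinP.
have dom n x : (`|(f x * cutoff c d (e_ n) x)%:E| <= (`|f x|)%:E)%E.
  by rewrite lee_fin normrM ler_piMr// cutoff_le1.
have [||||||H1 _ H3] := @dominated_convergence _ _ _ leb `]a, b[%classic _
  (fun n x => (f x * cutoff c d (e_ n) x)%:E) (EFin \o (f \_ `]c, d[))
  (fun x => (`|f x|)%:E) _ _ _ _ _ => //.
- by apply: aeW => x _; exact: pw.
- exact: (integrable_norm fi).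
- by apply: aeW => x n _; exact: dom.
apply: fine_cvg; rewrite fineK//; exact: integrable_fin_num.
Unshelve. all: by end_near. Qed.

(** Test with [cutoff * phi]. The derivative of the cutoff is a difference of two kernels of mass 1
    that concentrate at [c] and at [d]; by continuity of [u] they produce the boundary terms in the
    limit. *)
Lemma weak_integration_by_parts a b c d u g phi dphi :
  {within `[a, b], continuous u} -> intg a b g ->
  (forall chi, test_function a b chi ->
    Rintegral leb `]a, b[ (fun x => u x * derive1 chi x) =
    - Rintegral leb `]a, b[ (fun x => g x * chi x)) ->
  (forall x : R, is_derive x 1 phi (dphi x)) -> continuous dphi ->
  a <= c -> c < d -> d <= b ->
  Rintegral leb `]c, d[ (fun x => u x * dphi x) +
  Rintegral leb `]c, d[ (fun x => g x * phi x) = u d * phi d - u c * phi c.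
Proof.
move=> cu gi wd dphiE cdphi ac cd db.
have cphi : continuous phi by exact: isder_continuous dphiE.
have ab : a <= b by lra.
(* The factor 1/6 keeps the rising and the falling part of the cutoff from overlapping. *)
pose e_ n : R := (d - c) / 6 * n.+1%:R^-1.
have e0 n : 0 < e_ n by rewrite mulr_gt0 ?invr_gt0// divr_gt0 ?subr_gt0.
have e6 n : 6 * e_ n <= d - c.
  rewrite /e_ mulrA ler_pdivrMr// mulrC divfK// ler_peMr ?subr_ge0 ?(ltW cd)//.
  by rewrite ler1n.
have e_cvg : e_ @ \oo --> (0 : R).
  rewrite -(mulr0 ((d - c) / 6)); apply: cvgM; first exact: cvg_cst.
  exact: cvg_harmonic.
move: e_ e0 e6 e_cvg => e_ e0 e6 e_cvg.
have cw := withinM cu cphi.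
have i1 := intg_within (withinM cu cdphi).
have i2 : intg a b (fun x => g x * phi x).
  have [M HM] := @within_bounded _ a b phi ab (continuous_subspaceT cphi).
  have mphi : measurable_fun `]a, b[%classic phi.
    exact: measurable_funTS (continuous_measurable_fun cphi).
  have mg : measurable_fun `]a, b[%classic g.
    by move/integrableP : gi => [/measurable_EFinP].
  apply: (intg_le (measurable_funM mg mphi) _ (intgZ M gi)) => x xab.
  rewrite !normrM mulrC ler_wpM2r//; apply: le_trans (HM x _) (ler_norm _).
  lra.
have T1 := cutoff_cvg ac db i1 e0 e6 e_cvg.
have T2 := cutoff_cvg ac db i2 e0 e6 e_cvg.
pose B n := Rintegral leb `]a, b[ (fun x => u x * phi x * dcutoff c d (e_ n) x).
have T3 : B @ \oo --> u c * phi c - u d * phi d.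
  have BE n : B n =
      Rintegral leb `]a, b[ (fun x => u x * phi x * kern (e_ n) (c + e_ n) x) -
      Rintegral leb `]a, b[ (fun x => u x * phi x * kern (e_ n) (d - 3 * e_ n) x).
    rewrite /B -RintegralB//.
    - by apply: eq_Rintegral => x _; rewrite /dcutoff mulrBr.
    - exact: (intg_within (withinM cw (@kern_continuous _ _ _))).
    - exact: (intg_within (withinM cw (@kern_continuous _ _ _))).
  (* Used for [q = c] and [q = d]: the kernels live on [c + e, c + 3e] and [d - 3e, d - e], within
     [3e] of the endpoint. *)
  have K (q : R) (p_ : nat -> R) : a <= q <= b ->
      (forall n, a <= p_ n) -> (forall n, p_ n + 2 * e_ n <= b) ->
      (forall n x, p_ n <= x <= p_ n + 2 * e_ n -> `|x - q| <= 3 * e_ n) ->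
      Rintegral leb `]a, b[ (fun x => u x * phi x * kern (e_ n) (p_ n) x)
        @[n --> \oo] --> u q * phi q.
    move=> qab ap pb pq; apply/cvgrPdist_le => eta eta0.
    have [delta delta0 Hd] := within_eps cw qab eta0.
    have d3 : 0 < delta / 3 by rewrite divr_gt0.
    near=> n; rewrite distrC.
    have : e_ n < delta / 3 by near: n; exact: cvgr_lt e_cvg _ d3.
    rewrite ltr_pdivlMr// => He.
    apply: (approximate_identity cw (e0 n) (ap n) (pb n)) => x Hx.
    apply: Hd; first by have := ap n; have := pb n; lra.
    by apply: le_lt_trans (pq n x Hx) _; rewrite mulrC.
  rewrite (funext BE); apply: cvgB; apply: K.
  - lra.
  - by move=> n; have := e0 n; lra.
  - by move=> n; have := e0 n; have := e6 n; lra.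
  - by move=> n x; have := e0 n; rewrite ler_norml; lra.
  - lra.
  - by move=> n; have := e0 n; have := e6 n; lra.
  - by move=> n; have := e0 n; lra.
  - by move=> n x; have := e0 n; rewrite ler_norml; lra.
have E n : B n + Rintegral leb `]a, b[ (fun x => u x * dphi x * cutoff c d (e_ n) x) =
    - Rintegral leb `]a, b[ (fun x => g x * phi x * cutoff c d (e_ n) x).
  have [tst tstE] := cutoff_test (e0 n) (e6 n) ac db dphiE cdphi.
  have := wd _ tst; rewrite -RintegralD//.
  - have -> : Rintegral leb `]a, b[ (fun x => g x * (cutoff c d (e_ n) x * phi x)) =
      Rintegral leb `]a, b[ (fun x => g x * phi x * cutoff c d (e_ n) x).
      by apply: eq_Rintegral => x _; ring.
    move=> <-; apply: eq_Rintegral => x _; rewrite tstE; ring.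
  - exact: (intg_within (withinM cw (@dcutoff_continuous _ _ _))).
  - exact: (intg_within (withinM (withinM cu cdphi) (@cutoff_continuous _ _ _))).
have C1 : (fun n => - Rintegral leb `]a, b[ (fun x => g x * phi x * cutoff c d (e_ n) x))
  @ \oo --> u c * phi c - u d * phi d + Rintegral leb `]c, d[ (fun x => u x * dphi x).
  by rewrite -(funext E); exact: cvgD.
have C2 : (fun n => - Rintegral leb `]a, b[ (fun x => g x * phi x * cutoff c d (e_ n) x))
  @ \oo --> - Rintegral leb `]c, d[ (fun x => g x * phi x) by exact: cvgN.
have := seq_cvg_unique C1 C2; lra.
Unshelve. all: by end_near. Qed.

End BoundaryTerms.

(** * Lebesgue differentiation of primitives *)

Section Primitives.
Context {R : realType}.
Implicit Types (a b c d x y : R) (f g : R -> R).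
Notation leb := (@lebesgue_measure R).

(** [g] is extended by 0 to the whole line, where almost every point is a point of differentiability
    of the primitive from minus infinity. Near a point of ]a, b[ the two primitives agree. *)
Lemma ae_derive_primitive a b g : intg a b g ->
  {ae leb, forall x, a < x < b ->
    is_derive x 1 (fun y : R => Rintegral leb `]a, y[ g) (g x)}.
Proof.
move=> gi; pose f := g \_ `]a, b[%classic.
have fi : leb.-integrable setT (EFin \o f).
  rewrite /f -restrict_EFin; apply/integrable_restrict => //.
  by rewrite setTI.
have fi' y : leb.-integrable `]-oo, y] (EFin \o f) by apply: integrableS fi.
have lf : locally_integrable [set: R] f by exact: integrable_locally gi.
have := FTC1Ny fi' lf; apply: aeS => x [dF Fx] /andP[ax xb].
have D : is_derive x 1 (fun y : R => Rintegral leb [set` `]-oo, y]] f) (g x).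
  have -> : g x = f x by rewrite /f /patch mem_set// /= in_itv /= ax xb.
  by rewrite -Fx derive1E; apply: DeriveDef.
apply: near_eq_is_derive D.
near=> y.
have yb : y < b by near: y; exact: lt_nbhsl.
have ay : a < y by near: y; exact: lt_nbhsr.
rewrite Rintegral_mkcond [RHS]Rintegral_itv_bndo_bndc; last first.
  by apply: integrableS gi => //= z /=; rewrite !in_itv /= => /andP[-> /lt_trans ->].
rewrite [RHS]Rintegral_mkcond; apply: eq_Rintegral => z _.
rewrite /f /patch.
have -> : (z \in [set` `]-oo, y]]) = (z <= y).
  by apply/idP/idP; rewrite inE /= in_itv.
have -> : (z \in `]a, y]%classic) = (a < z <= y).
  by apply/idP/idP; rewrite inE /= in_itv.
have -> : (z \in `]a, b[%classic) = (a < z < b).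
  by apply/idP/idP; rewrite inE /= in_itv.
have [zy|] := leP z y; last by rewrite andbF.
by rewrite andbT (le_lt_trans zy yb) andbT.
Unshelve. all: by end_near. Qed.

Lemma ae_eq0_primitive a b g : intg a b g ->
  (forall d, a < d < b -> Rintegral leb `]a, d[ g = 0) ->
  {ae leb, forall x, a < x < b -> g x = 0}.
Proof.
move=> gi g0; have := ae_derive_primitive gi; apply: aeS => x D xab.
have D0 : is_derive x 1 (fun y : R => Rintegral leb `]a, y[ g) 0.
  have C : is_derive x 1 (fun=> 0 : R) (0 : R) by exact: is_derive_cst.
  apply: near_eq_is_derive C.
  near=> y; rewrite g0//; apply/andP; split.
    by near: y; apply: lt_nbhsr; case/andP: xab.
  by near: y; apply: lt_nbhsl; case/andP: xab.
by have := D xab; case: D0 => _ <- [_ <-].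
Unshelve. all: by end_near. Qed.

Lemma Rint_split a b c f : intg a b f -> a < c -> c < b ->
  Rintegral leb `]a, c[ f + Rintegral leb `]c, b[ f = Rintegral leb `]a, b[ f.
Proof.
move=> fi ac cb.
have i1 : intg a c f.
  by apply: integrableS fi => //= z /=; rewrite !in_itv /= => /andP[-> /lt_trans ->].
have := @Rintegral_itvB _ f (BRight a) (BLeft b) c fi; rewrite !bnd_simp => /(_ (ltW ac) cb).
by rewrite (Rintegral_itv_bndo_bndc i1) => <-; ring.
Qed.

End Primitives.

(** * Continuous functions with a weak derivative in L^2 *)

Section WeakDerivatives.
Context {R : realType}.
Variables (a b : R).
Hypothesis hab : a < b.
Implicit Types (u v g : R -> R[i]) (f phi dphi : R -> R) (c d x : R).
Notation leb := (@lebesgue_measure R).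

(** An H^1 function given by its continuous representative, so that [u a] and [u b] have a meaning.
    The derivative [g] is explicit, which avoids the choice made by [wderiv]. *)
Definition H1pair u g : Prop :=
  [/\ continuous_on_itv a b u, in_L2 a b g & weak_derivative a b u g].

Lemma cont_itv_cmeas u : continuous_on_itv a b u -> cmeas a b u.
Proof.
by move=> [/intg_within/integrableP[/measurable_EFinP m1 _]
           /intg_within/integrableP[/measurable_EFinP m2 _]].
Qed.

Lemma cont_itv_bounded u : continuous_on_itv a b u ->
  exists M, forall x, a <= x <= b -> cabs (u x) <= M.
Proof.
move=> [c1 c2]; have [M1 H1] := within_bounded (ltW hab) c1.
have [M2 H2] := within_bounded (ltW hab) c2.
exists (M1 + M2) => x xab; apply: le_trans (cabs_ReIm _) _.
by apply: lerD; [exact: H1|exact: H2].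
Qed.

Lemma cont_itv_in_L2 u : continuous_on_itv a b u -> in_L2 a b u.
Proof.
move=> cu; have [M HM] := cont_itv_bounded cu.
apply: (@in_L2_bounded _ _ _ _ M); first exact: cont_itv_cmeas.
by move=> x /andP[ax xb]; apply: HM; rewrite !ltW.
Qed.

Lemma ccont_cont_itv u : ccont u -> continuous_on_itv a b u.
Proof. by move=> [c1 c2]; split; exact: continuous_subspaceT. Qed.

Lemma cont_itvB u v : continuous_on_itv a b u -> continuous_on_itv a b v ->
  continuous_on_itv a b (fun x => u x - v x).
Proof.
move=> [u1 u2] [v1 v2]; split => x.
  rewrite (_ : (fun x => _) = (fun x => complex.Re (u x) - complex.Re (v x))); last first.
    by apply/funext => y; rewrite cReD cReN.
  by apply: cvgB; [exact: u1|exact: v1].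
rewrite (_ : (fun x => _) = (fun x => complex.Im (u x) - complex.Im (v x))); last first.
  by apply/funext => y; rewrite cImD cImN.
by apply: cvgB; [exact: u2|exact: v2].
Qed.

Lemma in_L2S c d u : a <= c -> d <= b -> in_L2 a b u ->
  in_L2 c d u /\ nrm c d u <= nrm a b u.
Proof.
move=> ac db /in_L2P[[m1 m2] iu].
have sub : `]c, d[%classic `<=` `]a, b[%classic.
  by move=> x /=; rewrite !in_itv /=; lra.
have iu' : intg c d (fun x => cabs (u x) ^+ 2) by apply: integrableS iu.
split.
  by apply/in_L2P; split => //; split; apply: measurable_funS sub _ => //.
apply: ler_wsqrtr; apply: fine_le; [exact: integrable_fin_num|exact: integrable_fin_num|].
apply: ge0_subset_integral => //.
  by move/integrableP : iu => [].
by move=> x _; rewrite lee_fin sqr_ge0.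
Qed.

Lemma weak_derivative_real u g : in_L2 a b g -> weak_derivative a b u g ->
  forall chi, test_function a b chi ->
  (Rintegral leb `]a, b[ (fun x => complex.Re (u x) * derive1 chi x) =
    - Rintegral leb `]a, b[ (fun x => complex.Re (g x) * chi x)) /\
  (Rintegral leb `]a, b[ (fun x => complex.Im (u x) * derive1 chi x) =
    - Rintegral leb `]a, b[ (fun x => complex.Im (g x) * chi x)).
Proof.
move=> gL2 wd chi /wd; rewrite /cintegral => -[] E1 E2; split.
- transitivity (Rintegral leb `]a, b[ (fun x => complex.Re (u x * (derive1 chi x)%:C))).
    by apply: eq_Rintegral => x _; rewrite cReM /= mulr0 subr0.
  rewrite E1; congr (- _).
  by apply: eq_Rintegral => x _; rewrite cReM /= mulr0 subr0.
- transitivity (Rintegral leb `]a, b[ (fun x => complex.Im (u x * (derive1 chi x)%:C))).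
    by apply: eq_Rintegral => x _; rewrite cImM /= mulr0 add0r.
  rewrite E2; congr (- _).
  by apply: eq_Rintegral => x _; rewrite cImM /= mulr0 add0r.
Qed.

Lemma H1pair_ibp_real u g phi dphi c d : H1pair u g ->
  (forall x, is_derive x 1 phi (dphi x)) -> continuous dphi ->
  a <= c -> c < d -> d <= b ->
  cintegral c d (fun x => u x * (dphi x)%:C) + cintegral c d (fun x => g x * (phi x)%:C) =
  u d * (phi d)%:C - u c * (phi c)%:C.
Proof.
move=> [[c1 c2] gL2 wd] dphiE cdphi ac cd db.
have [i1 i2] := cintg_in_L2 gL2.
have wr := weak_derivative_real gL2 wd.
have E1 := weak_integration_by_parts c1 i1 (fun chi t => (wr chi t).1) dphiE cdphi ac cd db.
have E2 := weak_integration_by_parts c2 i2 (fun chi t => (wr chi t).2) dphiE cdphi ac cd db.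
have K (v : R -> R[i]) f : cintegral c d (fun x => v x * (f x)%:C) =
    Rintegral leb `]c, d[ (fun x => complex.Re (v x) * f x) +i*
    Rintegral leb `]c, d[ (fun x => complex.Im (v x) * f x).
  by congr (_ +i* _); apply: eq_Rintegral => x _;
    rewrite cReImE /= mulr0 ?subr0 ?add0r.
rewrite !K; apply: complex_ext; rewrite !cReImE /= !mulr0 ?subr0 ?add0r ?E1 ?E2.
  by [].
by [].
Qed.

(** Integration by parts against the constant 1. *)
Lemma H1pair_FTC u g c d : H1pair u g -> a <= c -> c < d -> d <= b ->
  cintegral c d g = u d - u c.
Proof.
move=> ug ac cd db.
have := H1pair_ibp_real ug (fun x => isder_cst 1 x) (@cst_continuous _ _ 0) ac cd db.
rewrite !mulr1 => <-.
rewrite (@eq_cintegral _ _ _ (fun x => u x * 0%:C) (fun=> 0)); last first.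
  by move=> x _; rewrite mulr0.
rewrite cintegral_cst// mulr0 add0r; apply: eq_cintegral => x _.
by rewrite mulr1.
Qed.

Lemma H1pair_ibp u g (phi dphi : R -> R[i]) : H1pair u g ->
  (forall x, cder phi x (dphi x)) -> ccont dphi ->
  cintegral a b (fun x => u x * dphi x) + cintegral a b (fun x => g x * phi x) =
  u b * phi b - u a * phi a.
Proof.
move=> ug phiE [cd1 cd2]; have [cu gL2 wd] := ug.
have uL2 := cont_itv_in_L2 cu.
have [cp1 cp2] := cder_ccont phiE.
have E1 := H1pair_ibp_real ug (fun x => (phiE x).1) cd1 (lexx a) hab (lexx b).
have E2 := H1pair_ibp_real ug (fun x => (phiE x).2) cd2 (lexx a) hab (lexx b).
have K (v : R -> R[i]) (w : R -> R[i]) : in_L2 a b v ->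
  continuous (fun x => complex.Re (w x)) -> continuous (fun x => complex.Im (w x)) ->
  cintegral a b (fun x => v x * w x) =
  cintegral a b (fun x => v x * (complex.Re (w x))%:C) +
  'i%C * cintegral a b (fun x => v x * (complex.Im (w x))%:C).
  move=> vL2 cw1 cw2.
  have i1 := cintgM vL2 (ccont_in_L2 a b (ccont_real cw1)).
  have i2 := cintgM vL2 (ccont_in_L2 a b (ccont_real cw2)).
  rewrite -cintegralZ// -cintegralD//; last exact: cintgZ.
  by apply: eq_cintegral => x _; rewrite [in LHS](complexE (w x)); ring.
rewrite (K u dphi uL2 cd1 cd2) (K g phi gL2 cp1 cp2).
have -> : u b * phi b - u a * phi a =
  (u b * (complex.Re (phi b))%:C - u a * (complex.Re (phi a))%:C) +
  'i%C * (u b * (complex.Im (phi b))%:C - u a * (complex.Im (phi a))%:C).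
  by rewrite [in LHS](complexE (phi b)) [in LHS](complexE (phi a)); ring.
by rewrite -E1 -E2; ring.
Qed.

(** Integration by parts against the mode [-l], which is 1 at both ends: periodicity of [u] cancels
    the boundary terms. *)
Lemma H1pair_fourier u g l : H1pair u g -> u a = u b ->
  fourier_coef a b g l = 'i%C * (mu a b l)%:C * fourier_coef a b u l.
Proof.
move=> ug uab; have [cu gL2 wd] := ug.
have uL2 := cont_itv_in_L2 cu.
have cde : ccont (fun x => 'i%C * (mu a b (- l))%:C * em a b (- l) x).
  by apply: ccontM; [exact: ccont_cst|exact: em_ccont].
have := H1pair_ibp ug (em_cder a b (- l)) cde.
rewrite em_b// em_a uab subrr => /eqP; rewrite addrC addr_eq0 => /eqP E.
rewrite !fourier_coefE E [RHS]mulrCA; congr (_ * _).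
rewrite -(cintegralZ ('i%C * (mu a b l)%:C) (cintgM uL2 (em_in_L2 a b (- l)))).
rewrite -cintegralN; last exact: (cintgM uL2 (ccont_in_L2 a b cde)).
by apply: eq_cintegral => x _; rewrite muN rmorphN; ring.
Qed.

Lemma test_function_ccont chi : test_function a b chi ->
  ccont (fun x => (chi x)%:C) /\ ccont (fun x => (derive1 chi x)%:C).
Proof.
move=> [dchi cdchi _]; split; apply: ccont_real => //.
apply: (@isder_continuous _ _ (derive1 chi)) => x.
by rewrite derive1E; exact: derivableP.
Qed.

Lemma weak_derivativeB u v g h : in_L2 a b u -> in_L2 a b v -> in_L2 a b g -> in_L2 a b h ->
  weak_derivative a b u g -> weak_derivative a b v h ->
  weak_derivative a b (fun x => u x - v x) (fun x => g x - h x).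
Proof.
move=> uL2 vL2 gL2 hL2 wu wv chi tchi.
have [c1 c2] := test_function_ccont tchi.
have B w1 w2 w : in_L2 a b w1 -> in_L2 a b w2 -> ccont w ->
  cintegral a b (fun x => (w1 x - w2 x) * w x) =
  cintegral a b (fun x => w1 x * w x) - cintegral a b (fun x => w2 x * w x).
  move=> l1 l2 cw; have l3 := ccont_in_L2 a b cw.
  rewrite -cintegralB; [|exact: cintgM|exact: cintgM].
  by apply: eq_cintegral => x _; rewrite mulrBl.
by rewrite !B// wu// wv//; ring.
Qed.

Lemma ae_eq0_cprimitive g : cintg a b g ->
  (forall d, a < d < b -> cintegral a d g = 0) ->
  {ae leb, forall x, a < x < b -> g x = 0}.
Proof.
move=> [i1 i2] g0.
have H1 : {ae leb, forall x, a < x < b -> complex.Re (g x) = 0}.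
  by apply: (ae_eq0_primitive i1) => d /g0 /(congr1 (@complex.Re R)).
have H2 : {ae leb, forall x, a < x < b -> complex.Im (g x) = 0}.
  by apply: (ae_eq0_primitive i2) => d /g0 /(congr1 (@complex.Im R)).
apply: aeS (aeI H1 H2) => x [K1 K2] xab.
by apply: complex_ext; rewrite ?K1 ?K2.
Qed.

(** The difference is a weak derivative of 0, hence has zero primitive, and Lebesgue differentiation
    applies. *)
Lemma weak_derivative_unique u g1 g2 : in_L2 a b u -> in_L2 a b g1 -> in_L2 a b g2 ->
  weak_derivative a b u g1 -> weak_derivative a b u g2 ->
  {ae leb, forall x, a < x < b -> g1 x = g2 x}.
Proof.
move=> uL2 g1L2 g2L2 w1 w2.
have pair : H1pair (fun=> 0) (fun x => g1 x - g2 x).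
  split; first exact: ccont_cont_itv (ccont_cst 0).
    exact: in_L2B.
  have := weak_derivativeB uL2 uL2 g1L2 g2L2 w1 w2.
  by congr (weak_derivative a b); apply/funext => x; rewrite subrr.
have : {ae leb, forall x, a < x < b -> g1 x - g2 x = 0}.
  apply: ae_eq0_cprimitive; first exact: cintg_in_L2 (in_L2B g1L2 g2L2).
  by move=> d /andP[ad db]; rewrite (H1pair_FTC pair (lexx a) ad (ltW db)) subrr.
by apply: aeS => x H /H /eqP; rewrite subr_eq0 => /eqP.
Qed.

(** [u] is a primitive of [g], hence differentiable almost everywhere. The Lipschitz bound at one
    point is what the convergence of the Fourier series there requires. *)
Lemma H1pair_ae_lipschitz u g : H1pair u g ->
  {ae leb, forall x, a < x < b -> exists2 M : R, 0 <= M &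
    \forall y \near x, cabs (u y - u x) <= M * `|y - x|}.
Proof.
move=> ug; have [cu gL2 _] := ug; have [i1 i2] := cintg_in_L2 gL2.
have P (f : R -> R) (F : R -> R) : intg a b f ->
    (forall d, a < d < b -> Rintegral leb `]a, d[ f = F d - F a) ->
  {ae leb, forall x, a < x < b -> exists2 M : R, 0 <= M &
    \forall y \near x, `|F y - F x| <= M * `|y - x|}.
  move=> fi fF; apply: aeS (ae_derive_primitive fi) => x D xab.
  have D1 : is_derive x 1 F (f x).
    have := isderD (D xab) (isder_cst (F a) x); rewrite addr0.
    apply: near_eq_is_derive; near=> y; rewrite fF ?subrK//; apply/andP; split.
      by near: y; apply: lt_nbhsr; case/andP: xab.
    by near: y; apply: lt_nbhsl; case/andP: xab.
  exists (`|f x| + 1); first by rewrite addr_ge0.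
  have [dF Fx] := D1.
  have /cvgrPdist_lt /(_ 1 ltr01) : (fun h : R => h^-1 *: (F (h *: 1 + x) - F x)) @ 0^' --> f x.
    by rewrite -Fx; exact: dF.
  move/nbhs_ballP => [e /= e0 He]; apply/nbhs_ballP; exists e => // y /= xy.
  have [->|yx] := eqVneq y x; first by rewrite !subrr normr0 mulr0.
  have := He (y - x); rewrite /ball /= sub0r normrN => /(_ _ _).
  rewrite -ball_normE /= in xy; rewrite distrC in xy.
  move=> /(_ xy); rewrite subr_eq0 => /(_ yx).
  rewrite [_ *: 1]mulr1 subrK => K.
  have yx0 : 0 < `|y - x| by rewrite normr_gt0 subr_eq0.
  rewrite -ler_pdivrMr// -normfV -normrM mulrC.
  have := ler_normB (f x) (f x - (y - x)^-1 * (F y - F x)).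
  rewrite opprB addrC subrK; move: K; rewrite /GRing.scale /=; lra.
have H1 := P _ (fun x => complex.Re (u x)) i1.
have H2 := P _ (fun x => complex.Im (u x)) i2.
have F1 d : a < d < b -> cintegral a d g = u d - u a.
  by move=> /andP[ad db]; rewrite (H1pair_FTC ug (lexx a) ad (ltW db)).
have {}H1 := H1 (fun d dab => etrans (congr1 (@complex.Re R) (F1 d dab)) (etrans (cReD _ _) (congr1 _ (cReN _)))).
have {}H2 := H2 (fun d dab => etrans (congr1 (@complex.Im R) (F1 d dab)) (etrans (cImD _ _) (congr1 _ (cImN _)))).
apply: aeS (aeI H1 H2) => x [K1 K2] xab.
have [M1 M10 N1] := K1 xab; have [M2 M20 N2] := K2 xab.
exists (M1 + M2); first exact: addr_ge0.
near=> y.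
apply: le_trans (cabs_ReIm _) _; rewrite mulrDl !cReImE; apply: lerD.
  by near: y.
by near: y.
Unshelve. all: by end_near. Qed.

End WeakDerivatives.

(** * Convergence of Fourier series *)

Section TrigonometricInequalities.
Context {R : realType}.
Implicit Types (x y : R).

Lemma MVT0 (f df : R -> R) x : f 0 = 0 -> (forall y : R, is_derive y 1 f (df y)) ->
  exists2 xi : R, `|xi| <= `|x| & f x = df xi * x.
Proof.
move=> f0 fdf; have cf := isder_continuous fdf.
have [x0|x0|->] := ltgtP x 0.
- have [xi] := MVT x0 (fun y _ => fdf y) (continuous_subspaceT cf).
  rewrite in_itv /= => /andP[h1 h2] H; exists xi.
    by rewrite !ltr0_norm// lerN2 ltW.
  by move: H; rewrite f0; lra.
- have [xi] := MVT x0 (fun y _ => fdf y) (continuous_subspaceT cf).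
  rewrite in_itv /= => /andP[h1 h2] H; exists xi.
    by rewrite !gtr0_norm// ltW.
  by move: H; rewrite f0; lra.
- by exists 0 => //; rewrite f0 mulr0.
Qed.

Lemma sin_le_abs x : `|sin x| <= `|x|.
Proof.
have [xi _ ->] := MVT0 x (@sin0 R) (@is_derive_sin R).
by rewrite normrM ler_piMl// cos_max.
Qed.

Lemma cos_half x : 1 - cos x = 2 * sin (x / 2) ^+ 2.
Proof.
have -> : cos x = cos ((x / 2) *+ 2) by congr cos; rewrite mulr2n; lra.
by rewrite cos_mulr2n cos2sin2 mulr2n; lra.
Qed.

Lemma cos_ge_quadratic x : 1 - x ^+ 2 / 2 <= cos x.
Proof.
have := sin_le_abs (x / 2); rewrite -ler_sqr ?nnegrE// !real_normK ?num_real//.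
have := cos_half x; rewrite expr_div_n; lra.
Qed.

Lemma cos_sub1_le_abs x : `|cos x - 1| <= `|x|.
Proof.
have h1 := cos_ge_quadratic x; have h2 := cos_le1 x; have h3 := cos_geN1 x.
rewrite ler_norml; apply/andP; split; last by apply: (@le_trans _ _ 0); rewrite ?subr_le0.
have [x2|x2] := leP `|x| 2; last lra.
have : x ^+ 2 <= 2 * `|x|.
  by rewrite -[x ^+ 2]real_normK ?num_real// expr2 ler_wpM2r.
lra.
Qed.

Lemma sin_sub_le_sqr x : `|sin x - x| <= x ^+ 2.
Proof.
have D (y : R) : is_derive y 1 (fun z => sin z - z) (cos y - 1).
  by apply: isderB; exact: is_derive_id.
have f0 : sin 0 - 0 = 0 :> R by rewrite sin0 subr0.
have [xi xix ->] := MVT0 x f0 D.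
rewrite normrM -[x ^+ 2]real_normK ?num_real// expr2 ler_wpM2r//.
exact: le_trans (cos_sub1_le_abs xi) xix.
Qed.

(** A crude constant that needs only [pi / 2 <= 2]: halving the angle brings it into [0, 1], where
    the quadratic lower bound gives [cos >= 1/2]. *)
Lemma sin_ge_eighth x : 0 <= x <= pi / 2 -> x / 8 <= sin x.
Proof.
move=> /andP[x0 xpi].
have p2 : pi / 2 <= 2 :> R by have [/andP[]] := @pihalf_02_cos_pihalf R.
have [xi xix Hs] := MVT0 (x / 2) (@sin0 R) (@is_derive_sin R).
have x20 : 0 <= x / 2 by lra.
rewrite [leRHS](_ : _ = 2 * (sin (x / 2) * cos (x / 2))); last first.
  have -> : sin x = sin ((x / 2) *+ 2) by congr sin; rewrite mulr2n; lra.
  by rewrite sin_mulr2n mulr2n; lra.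
have q (y : R) : `|y| <= x / 2 -> 1 / 2 <= cos y.
  move=> yx; have := cos_ge_quadratic y.
  have : y ^+ 2 <= 1.
    rewrite -[y ^+ 2]real_normK ?num_real// -[leRHS](expr1n _ 2).
    by rewrite ler_sqr ?nnegrE//; lra.
  lra.
rewrite [leRHS]ger0_norm// in xix.
have c1 := q xi xix; have c2 := q (x / 2); rewrite ger0_norm// in c2.
have {}c2 := c2 (lexx _).
rewrite Hs; have : 1 / 4 <= cos xi * cos (x / 2) by nra.
have := x20; nra.
Qed.

(** The half angle and its complement are both in the range of [sin_ge_eighth]; each contributes a
    factor 1/16, and the double-angle formula a factor 2. *)
Lemma sin_ge_pi x : 0 <= x <= pi -> x * (pi - x) / 128 <= sin x.
Proof.
move=> /andP[x0 xpi].
have h1 : (x / 2) / 8 <= sin (x / 2) by apply: sin_ge_eighth; lra.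
have h2 : ((pi - x) / 2) / 8 <= cos (x / 2).
  have -> : cos (x / 2) = sin ((pi - x) / 2).
    by rewrite mulrBl -[in RHS]opprB sinN sinBpihalf opprK.
  by apply: sin_ge_eighth; lra.
rewrite [leRHS](_ : _ = 2 * (sin (x / 2) * cos (x / 2))); last first.
  have -> : sin x = sin ((x / 2) *+ 2) by congr sin; rewrite mulr2n; lra.
  by rewrite sin_mulr2n mulr2n; lra.
have := ler_pM _ _ h1 h2; move: (pi : R) xpi {h1 h2} => p xp /(_ _ _).
have a1 : 0 <= x / 2 / 8 by lra.
have a2 : 0 <= (p - x) / 2 / 8 by lra.
by move=> /(_ a1 a2); lra.
Qed.

Lemma sqr_cabs_expi_sub1 x : cabs (expi x - 1) ^+ 2 = (2 * sin (x / 2)) ^+ 2.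
Proof.
rewrite sqr_cabs !cReImE /= subr0.
have := cos_half x; have := cos2Dsin2 x; rewrite exprMn; lra.
Qed.

Lemma cabs_expi_sub1 x : cabs (expi x - 1) = 2 * `|sin (x / 2)|.
Proof.
apply/eqP; rewrite -(@eqrXn2 _ 2) ?mulr_ge0 ?cabs_ge0//.
by rewrite sqr_cabs_expi_sub1 !exprMn real_normK ?num_real.
Qed.

Lemma cabs_expi_sub1_le x : cabs (expi x - 1) <= `|x|.
Proof.
rewrite cabs_expi_sub1; have := sin_le_abs (x / 2).
by rewrite normrM [`|2^-1|]ger0_norm//; lra.
Qed.

Lemma cabs_expi_sub2_le x : cabs (expi x - 1 - 'i%C * x%:C) <= 2 * x ^+ 2.
Proof.
apply: le_trans (cabs_ReIm _) _; rewrite !cReImE /=.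
rewrite !mul0r !mul1r !subr0 add0r.
have h1 : `|cos x - 1| <= x ^+ 2.
  have := cos_ge_quadratic x; have := cos_le1 x; have := sqr_ge0 x.
  by rewrite ler_norml; lra.
have h2 := sin_sub_le_sqr x.
by move: h1 h2; rewrite ?subr0 ?add0r ?mul1r; lra.
Qed.

End TrigonometricInequalities.

(** * Pointwise convergence, Parseval's inequality and tails *)

Section FourierConvergence.
Context {R : realType}.
Variables (a b : R).
Hypothesis hab : a < b.
Implicit Types (u v g w : R -> R[i]) (x : R) (l : int) (M : nat).
Notation leb := (@lebesgue_measure R).
Notation in2 := (in_L2 a b).
Notation nrm := (nrm a b).
Notation mu := (mu a b).
Notation em := (em a b).
Notation fc := (fourier_coef a b).

Lemma sum_freq (V : zmodType) (F : int -> V) M :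
  \sum_(l < M.*2) F (freq l) = \sum_(0 <= i < M.*2) F (i%:Z - M%:Z).
Proof. by rewrite big_mkord; apply: eq_bigr => l _; rewrite /freq doubleK. Qed.

Lemma sum_freqS (V : zmodType) (F : int -> V) M :
  \sum_(l < M.+1.*2) F (freq l) =
  F (- M.+1%:Z) + \sum_(l < M.*2) F (freq l) + F M%:Z.
Proof.
rewrite !sum_freq doubleS big_nat_recl// big_nat_recr//= sub0r addrA.
congr (_ + _ + F _).
  by apply: eq_bigr => i _; congr F; lia.
by rewrite -addnn; lia.
Qed.

Lemma fourier_coef_shift g l : in2 g -> fc (fun x => g x * em 1 x) l = fc g (l - 1).
Proof.
move=> gL2; rewrite !fourier_coefE; congr (_ * _); apply: eq_cintegral => x _.
by rewrite opprB emD mulrA.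
Qed.

Definition energy u M : R := (b - a) * \sum_(l < M.*2) cabs (fc u (freq l)) ^+ 2.

Lemma energy_le u M : in2 u -> energy u M <= nrm u ^+ 2.
Proof. exact: bessel. Qed.

Lemma energyS u M : energy u M.+1 = energy u M +
  (b - a) * (cabs (fc u (- M.+1%:Z)) ^+ 2 + cabs (fc u M%:Z) ^+ 2).
Proof.
by rewrite /energy (sum_freqS (fun l => cabs (fc u l) ^+ 2)); ring.
Qed.

Lemma energy_mono u : {homo energy u : M M' / (M <= M')%N >-> M <= M'}.
Proof.
apply: homo_leq => [|M1 M2 M3|M]; [by []|exact: le_trans|].
by rewrite energyS lerDl mulr_ge0 ?subr_ge0 ?(ltW hab)// addr_ge0 ?sqr_ge0.
Qed.

(** [energy g] is nondecreasing and bounded by Bessel's inequality, so its increments tend to 0, and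
    these control the outermost coefficients. The indices are those left over by
    [telescoping_partial_sum]. *)
Lemma riemann_lebesgue g : in2 g ->
  (fun M => cabs (fc g (- M.+1%:Z)) + cabs (fc g (M%:Z - 1))) @ \oo --> (0 : R).
Proof.
move=> gL2; have ba0 : 0 < b - a by rewrite subr_gt0.
have cv : cvgn (energy g).
  apply: nondecreasing_is_cvgn; first exact: energy_mono.
  by exists (nrm g ^+ 2) => _ [M _ <-]; exact: energy_le.
have d0 : (fun M => energy g M.+1 - energy g M) @ \oo --> (0 : R).
  rewrite -(subrr (limn (energy g))); apply: cvgB => //.
  by rewrite cvg_shiftS.
have sq0 (x_ : nat -> R) : (forall n, 0 <= x_ n) ->
    (forall n, (b - a) * x_ n ^+ 2 <= energy g n.+1 - energy g n) -> x_ @ \oo --> (0 : R).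
  move=> x0 xd; apply/cvgrPdist_le => e e0.
  have e1 : 0 < (b - a) * e ^+ 2 by rewrite mulr_gt0// exprn_gt0.
  near=> n.
  rewrite sub0r normrN ger0_norm// -ler_sqr ?nnegrE ?(ltW e0)//.
  rewrite -(ler_pM2l ba0); apply: le_trans (xd n) _.
  by apply/ltW; near: n; exact: cvgr_lt d0 _ e1.
rewrite -[0]addr0; apply: cvgD.
  apply: sq0 => n; first exact: cabs_ge0.
  rewrite energyS mulrDr.
  have := mulr_ge0 (ltW ba0) (sqr_ge0 (cabs (fc g n%:Z))); lra.
rewrite -cvg_shiftS /=; apply: sq0 => n; first exact: cabs_ge0.
rewrite energyS mulrDr; have -> : n.+1%:Z - 1 = n%:Z by lia.
have := mulr_ge0 (ltW ba0) (sqr_ge0 (cabs (fc g (- n.+1%:Z)))); lra.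
Unshelve. all: by end_near. Qed.

(** Multiplication by [em 1] shifts coefficients by one, so that the term of index [l] is the
    difference of the values of [em l x0 * fc g l] at [l - 1] and [l]. *)
Lemma telescoping_partial_sum f g x0 M : in2 f -> in2 g ->
  (forall x, a < x < b -> f x = g x * (em 1 x * em (- 1) x0 - 1)) ->
  \sum_(l < M.*2) fc f (freq l) * em (freq l) x0 =
  em (- M.+1%:Z) x0 * fc g (- M.+1%:Z) - em (M%:Z - 1) x0 * fc g (M%:Z - 1).
Proof.
move=> fL2 gL2 fg.
have geL2 : in2 (fun x => g x * em 1 x).
  have [] // := in_L2_le_pt ler01 gL2 (cmeasM (in_L2_cmeas gL2) (in_L2_cmeas (em_in_L2 a b 1))).
  by move=> x _; rewrite cabsM cabs_em mulr1 mul1r.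
have E l : fc f l * em l x0 = em (l - 1) x0 * fc g (l - 1) - em l x0 * fc g l.
  rewrite (@eq_fourier_coef _ _ _ _ (fun x => em (- 1) x0 * (g x * em 1 x) - g x)); last first.
    by move=> x /fg ->; ring.
  rewrite fourier_coefB//; last exact: (in_L2Z _ geL2).1.
  rewrite fourier_coefZ// fourier_coef_shift// emD; ring.
elim: M => [|M IH].
  by rewrite big_ord0 (_ : 0%:Z - 1 = - 1%:Z) ?subrr.
rewrite (sum_freqS (fun l => fc f l * em l x0)) IH !E.
have -> : - M.+1%:Z - 1 = - M.+2%:Z by lia.
have -> : M.+1%:Z - 1 = M%:Z by lia.
have K (p q r s : R[i]) : p - q + (q - r) + (r - s) = p - s by ring.
exact: K.
Qed.

(** The modulus is [2 |sin y|] with [y = pi |x - x0| / (b - a)]. As both points are interior,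
    [|x - x0|] is at most [b - a - m], so [y] stays at distance [pi m / (b - a)] from the other zero
    [pi] of the sine. The constant 64 is half the 128 of [sin_ge_pi]. *)
Lemma cabs_chernoff_denominator x x0 : a < x < b -> a < x0 < b ->
  pi ^+ 2 * Num.min (x0 - a) (b - x0) / (64 * (b - a) ^+ 2) * `|x - x0| <=
  cabs (em 1 x * em (- 1) x0 - 1).
Proof.
move=> xab x0ab; set m := Num.min _ _.
have ba0 : 0 < b - a by rewrite subr_gt0.
have pi0 := @pi_gt0 R.
have -> : em 1 x * em (- 1) x0 = expi (mu 1 * (x - x0)).
  by rewrite !emE muN -expiD; congr expi; ring.
rewrite cabs_expi_sub1.
pose y := pi * `|x - x0| / (b - a).
have -> : `|sin (mu 1 * (x - x0) / 2)| = `|sin y|.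
  have -> : mu 1 * (x - x0) / 2 = pi * (x - x0) / (b - a).
    by rewrite /Defs.mu; move: (pi : R) => p; field; rewrite gt_eqF.
  rewrite /y; case: (ler0P (x - x0)) => _ //.
  by rewrite mulrN mulNr sinN normrN.
have mle : `|x - x0| <= (b - a) - m.
  have m1 : m <= x0 - a by rewrite /m ge_min lexx.
  have m2 : m <= b - x0 by rewrite /m ge_min lexx orbT.
  by rewrite ler_norml; lra.
have m0 : 0 <= m by rewrite /m le_min; lra.
have y0 : 0 <= y.
  by apply: divr_ge0; [apply: mulr_ge0; [exact: ltW|exact: normr_ge0]|exact: ltW].
have ym : y <= pi * ((b - a) - m) / (b - a).
  by rewrite ler_pM2r ?invr_gt0// ler_pM2l.
have piy : pi * m / (b - a) <= pi - y.
  apply: le_trans (_ : pi - pi * ((b - a) - m) / (b - a) <= _); last by rewrite lerB.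
  by rewrite le_eqVlt; apply/orP; left; apply/eqP; move: (pi : R) => p; field; rewrite gt_eqF.
have pim : 0 <= pi * m / (b - a).
  by apply: divr_ge0; [apply: mulr_ge0; [exact: ltW|]|exact: ltW].
have ypi : 0 <= y <= pi by rewrite y0 /=; lra.
have := sin_ge_pi ypi.
have := ler_norm (sin y).
have : y * (pi * m / (b - a)) <= y * (pi - y) by rewrite ler_wpM2l.
have -> : pi ^+ 2 * m / (64 * (b - a) ^+ 2) * `|x - x0| =
  y * (pi * m / (b - a)) / 64.
  by rewrite /y; move: (pi : R) => p; field; rewrite gt_eqF.
lra.
Qed.

Lemma measurable_inv : measurable_fun setT (fun y : R => (`|y|)^-1).
Proof.
rewrite (_ : (fun _ => _) = (fun y : R => powR y (-1)) \o (fun y => `|y|)).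
  by apply: measurableT_comp => //; exact: measurable_powR.
by apply/funext => y /=; rewrite powR_inv1.
Qed.

Lemma cmeasV u : cmeas a b u -> cmeas a b (fun x => (u x)^-1).
Proof.
move=> mu; have E x : (u x)^-1 = conjc (u x) * ((`|cabs (u x) ^+ 2|)^-1)%:C.
  have [->|u0] := eqVneq (u x) 0.
    by rewrite invr0 conjc_real mul0r.
  rewrite ger0_norm ?sqr_ge0// rmorphV ?unitfE ?expf_eq0 ?cabs_eq0//.
  apply: (mulfI u0); rewrite mulfV// mulrA mul_conj mulfV//.
  by rewrite -(rmorph0 (real_complex R)) (inj_eq (@complexI R)) expf_eq0 cabs_eq0.
rewrite (funext E); apply: cmeasM; first exact: cmeas_conj.
apply: cmeas_real; apply: (measurableT_comp measurable_inv).
exact: cmeas_sqr.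
Qed.

(** Chernoff's argument: dividing [u - u x0] by [em 1 x * em (-1) x0 - 1] turns
    the partial sums at [x0] into a telescoping sum. *)
Lemma fourier_cvg_pt u x0 (L : R) : continuous_on_itv a b u -> a < x0 < b -> 0 <= L ->
  (\forall y \near x0, cabs (u y - u x0) <= L * `|y - x0|) ->
  (fun M => cabs (trig_proj a b predT M.*2 u x0 - u x0)) @ \oo --> (0 : R).
Proof.
move=> cu x0ab L0 /nbhs_ballP[r /= r0 Hr].
have uL2 := cont_itv_in_L2 hab cu.
have [B HB] := cont_itv_bounded hab cu.
pose f x := u x - u x0; pose E x := em 1 x * em (- 1) x0 - 1; pose g x := f x / E x.
have fL2 : in2 f by apply: in_L2B => //; exact: in_L2_cst.
have cE : ccont E.
  apply: ccontD; last exact: ccont_cst.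
  by apply: ccontM; [exact: em_ccont|exact: ccont_cst].
set k := pi ^+ 2 * Num.min (x0 - a) (b - x0) / (64 * (b - a) ^+ 2).
have k0 : 0 < k.
  rewrite /k divr_gt0// ?mulr_gt0// ?exprn_gt0 ?pi_gt0 ?subr_gt0//.
  by rewrite lt_min; lra.
have Ek x : a < x < b -> k * `|x - x0| <= cabs (E x).
  by move=> xab; exact: cabs_chernoff_denominator.
have E0 x : a < x < b -> x != x0 -> E x != 0.
  move=> xab xx0; rewrite -cabs_eq0 gt_eqF// (lt_le_trans _ (Ek x xab))//.
  by rewrite mulr_gt0// normr_gt0 subr_eq0.
have fg x : a < x < b -> f x = g x * E x.
  move=> xab; have [->|xx0] := eqVneq x x0; first by rewrite /g /f subrr !mul0r.
  by rewrite /g divfK// E0.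
have B0 : 0 <= B by apply: le_trans (HB x0 _); [exact: cabs_ge0|lra].
(* Within [r] of [x0] the Lipschitz bound compensates the zero of the denominator; farther away the
   denominator is at least [k r]. At [x0] itself [g] is [0 / 0 = 0]. *)
have gb x : a < x < b -> cabs (g x) <= L / k + (B + B) / (k * r).
  move=> xab; have t1 : 0 <= L / k by rewrite divr_ge0// ltW.
  have t2 : 0 <= (B + B) / (k * r) by rewrite divr_ge0 ?addr_ge0// mulr_ge0// ltW.
  have [->|xx0] := eqVneq x x0.
    by rewrite /g /f subrr mul0r cabs0 addr_ge0.
  have xp : 0 < `|x - x0| by rewrite normr_gt0 subr_eq0.
  have kx : 0 < k * `|x - x0| by rewrite mulr_gt0.
  have Ep : 0 < cabs (E x) by rewrite (lt_le_trans kx)// Ek.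
  rewrite /g cabsM cabsV; have [xr|xr] := ltP `|x - x0| r.
    apply: (@le_trans _ _ (L / k)); last by rewrite lerDl.
    rewrite ler_pdivrMr//; apply: (@le_trans _ _ (L * `|x - x0|)).
      by apply: Hr; rewrite /ball /= distrC.
    rewrite -mulrA ler_wpM2l// ler_pdivlMl//; exact: Ek.
  apply: (@le_trans _ _ ((B + B) / (k * r))); last by rewrite lerDr.
  rewrite ler_pdivrMr//; apply: (@le_trans _ _ (B + B)).
    apply: le_trans (cabsB _ _) _; apply: lerD; apply: HB; lra.
  have kr : k * r <= cabs (E x) by apply: le_trans (Ek x xab); rewrite ler_pM2l.
  have kr0 : 0 < k * r by rewrite mulr_gt0.
  rewrite mulrAC ler_pdivlMr//.
  by rewrite ler_wpM2l// addr_ge0.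
have gL2 : in2 g.
  apply: in_L2_bounded gb; apply: cmeasM; first exact: in_L2_cmeas.
  by apply: cmeasV; exact: ccont_cmeas.
have key M : trig_proj a b predT M.+1.*2 u x0 - u x0 =
    em (- M.+2%:Z) x0 * fc g (- M.+2%:Z) - em (M.+1%:Z - 1) x0 * fc g (M.+1%:Z - 1).
  rewrite -(telescoping_partial_sum M.+1 fL2 gL2 fg) /trig_proj /tp.
  (* Subtracting the constant [u x0] alters only the coefficient of index 0, by exactly [u x0]. *)
  have cL2 : in2 (fun x => u x0 * em 0 x) by exact: (in_L2Z _ (em_in_L2 a b 0)).1.
  have F l : fc u l * em l x0 = fc f l * em l x0 + u x0 * (0 == l)%:R * em l x0.
    rewrite -mulrDl; congr (_ * _).
    rewrite -(fourier_coef_em hab) -(fourier_coefZ (u x0) l (em_in_L2 a b 0)).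
    rewrite -fourier_coefD//; apply: eq_fourier_coef => x _.
    by rewrite /f em0 mulr1 subrK.
  under eq_bigr do rewrite F; rewrite big_split /=.
  have -> : \sum_(l < M.+1.*2) u x0 * (0 == freq l)%:R * em (freq l) x0 = u x0.
    rewrite (sum_freq (fun l => u x0 * (0 == l)%:R * em l x0)).
    rewrite (big_cat_nat (n := M.+1)) //=; last by rewrite -addnn leq_addr.
    rewrite big_nat big1 ?add0r; last first.
      by move=> i /andP[_ iM]; case: eqP => [|_]; [lia|rewrite mulr0 mul0r].
    rewrite big_ltn; last by rewrite -addnn; lia.
    rewrite subrr eqxx mulr1 em0 mulr1 big_nat big1 ?addr0//.
    by move=> i /andP[iM _]; case: eqP => [|_]; [lia|rewrite mulr0 mul0r].
  by rewrite addrK.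
(* The partial sum for [M = 0] is empty and lacks the mode 0, hence the shift. *)
rewrite -cvg_shiftS /=.
have RL := riemann_lebesgue gL2; rewrite -cvg_shiftS /= in RL.
apply: (squeeze_cvgr _ (cvg_cst 0) RL).
apply: nearW => M; rewrite cabs_ge0 /= key.
by apply: le_trans (cabsB _ _) _; rewrite !cabsM !cabs_em !mul1r.
Qed.

Lemma measurable_limn_einf (f : nat -> R -> \bar R) :
  (forall n, measurable_fun `]a, b[%classic (f n)) ->
  measurable_fun `]a, b[%classic (fun x => limn_einf (f ^~ x)).
Proof.
move=> mf; rewrite /limn_einf; apply: measurableT_comp => //.
by apply: measurable_fun_limn_esup => n; exact: measurableT_comp.
Qed.

(** Fatou's lemma for the squared partial sums: their integrals are the energies, and almost
    everywhere they converge to [|u|^2], since [u] is Lipschitz at almost every point. *)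
Lemma parseval_le u g (B : R) : H1pair a b u g -> (forall M, energy u M <= B) ->
  nrm u ^+ 2 <= B.
Proof.
move=> ug uB; have [cu gL2 _] := ug; have uL2 := cont_itv_in_L2 hab cu.
have /in_L2P[_ iu] := uL2.
pose S M := trig_proj a b predT M.*2 u.
have SL2 M : in2 (S M) by exact: tp_in_L2.
have nS M : nrm (S M) ^+ 2 = energy u M by rewrite /S /trig_proj sqr_nrm_tp.
pose F n (x : R) : \bar R := (cabs (S n x) ^+ 2)%:E.
have mF n : measurable_fun `]a, b[%classic (F n).
  by apply/measurable_EFinP; apply: cmeas_sqr; exact: in_L2_cmeas.
have IF n : (\int[leb]_(x in `]a, b[) F n x = (energy u n)%:E)%E.
  rewrite -nS sqr_nrm /Rintegral fineK//; apply: integrable_fin_num => //.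
  by have /in_L2P[] := SL2 n.
have step1 : (\int[leb]_(x in `]a, b[) (cabs (u x) ^+ 2)%:E <=
    \int[leb]_(x in `]a, b[) limn_einf (F ^~ x))%E.
  apply: ae_ge0_le_integral => //.
  - by move=> x _; rewrite lee_fin sqr_ge0.
  - by apply/measurable_EFinP; apply: cmeas_sqr; exact: in_L2_cmeas.
  - by move=> x _; rewrite limn_einf_lim; apply: lime_ge;
      [exact: is_cvg_einfs|apply: nearW => n; apply: le_ereal_inf_tmp => _ [k _ <-];
      rewrite lee_fin sqr_ge0].
  - exact: measurable_limn_einf.
  suff AE : {ae leb, forall x, a < x < b ->
      ((cabs (u x) ^+ 2)%:E <= limn_einf (F ^~ x))%E}.
    by apply: (aeS _ AE) => x H; rewrite /= in_itv.
  have := H1pair_ae_lipschitz ug; apply: aeS => x H xab.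
  have [L L0 Lip] := H xab; have cv := fourier_cvg_pt cu xab L0 Lip.
  have cv1 : (fun n => cabs (S n x)) @ \oo --> cabs (u x).
    apply/cvgrPdist_le => e e0; near=> n.
    have : cabs (S n x - u x) < e by near: n; exact: cvgr_lt cv _ e0.
    have := cabsD (S n x - u x) (u x); rewrite subrK.
    have := cabsD (u x - S n x) (S n x); rewrite subrK (cabsBC (u x)).
    by rewrite ler_norml; lra.
  have cv2 : (F ^~ x) @ \oo --> (cabs (u x) ^+ 2)%:E.
    apply: cvg_EFin; first exact: nearW.
    rewrite expr2; rewrite (_ : _ \o _ = (fun n => cabs (S n x) * cabs (S n x))).
      exact: cvgM.
    by apply/funext => n.
  by rewrite (cvg_limn_einf_sup cv2).1.
have step2 : (\int[leb]_(x in `]a, b[) limn_einf (F ^~ x) <=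
    limn_einf (fun n => \int[leb]_(x in `]a, b[) F n x))%E.
  by apply: fatou => // n x _; rewrite lee_fin sqr_ge0.
have step3 : (limn_einf (fun n => \int[leb]_(x in `]a, b[) F n x) <= B%:E)%E.
  rewrite limn_einf_lim; apply: lime_le; first exact: is_cvg_einfs.
  apply: nearW => n; apply: le_trans (_ : (energy u n)%:E <= _)%E; last by rewrite lee_fin.
  by rewrite -IF; apply: ereal_inf_lbound; exists n => /=.
rewrite sqr_nrm -lee_fin /Rintegral fineK; last exact: integrable_fin_num.
exact: le_trans step1 (le_trans step2 step3).
Unshelve. all: by end_near. Qed.

(** The right side does not mention [N], so low-frequency sums over two index sets can be
    identified. The inequality is strict because [N/2] is not among the frequencies. *)
Lemma sum_freq_cut (F : int -> R) N K : ~~ odd N -> (K < N./2)%N ->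
  \sum_(l < N | (absz (freq l) <= K)%N) F (freq l) =
  \sum_(0 <= i < K.*2.+1) F (i%:Z - K%:Z).
Proof.
move=> eN KN; have NE : N = (N./2).*2 by rewrite -[LHS]odd_double_half (negbTE eN).
move: NE KN; move: (N./2) => H -> {eN N} KH.
rewrite big_mkcond (sum_freq (fun l => if (absz l <= K)%N then F l else 0)).
rewrite (big_cat_nat (n := (H - K)%N)) //=; last by rewrite -addnn; lia.
rewrite big_nat big1 ?add0r; last first.
  by move=> i /andP[_ iM]; case: ifP => //; lia.
rewrite (big_cat_nat (n := (H - K + K.*2.+1)%N)) //=; [|lia|rewrite -!addnn; lia].
rewrite [X in _ + X]big_nat [X in _ + X]big1 ?addr0; last first.
  by move=> i /andP[iM _]; case: ifP => //; rewrite -addnn in iM; lia.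
rewrite -{1}[(H - K)%N]add0n [(H - K + _)%N]addnC big_addn addnK.
rewrite big_nat [RHS]big_nat; apply: eq_bigr => i /andP[_ iK].
have -> : (i + (H - K))%N%:Z - H%:Z = i%:Z - K%:Z by lia.
by case: ifP => //; rewrite -addnn in iK; lia.
Qed.

Lemma mu_monotone l k : (absz l <= absz k)%N -> `|mu l| <= `|mu k|.
Proof.
move=> lk; rewrite /Defs.mu !normrM; apply: ler_wpM2r => //.
by apply: ler_wpM2l => //; rewrite -!intr_norm ler_int; lia.
Qed.

(** [w] plays the part of the derivative of order [k]. The modes cut off have [|l| > K], where a
    coefficient of [u] is at most [mu_(K+1)^(-k)] times that of [w]; Parseval's inequality is used
    for [u] and Bessel's for [w]. *)
Lemma trig_proj_error u g w (k K N : nat) : H1pair a b u g -> in2 w ->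
  (forall l, fc w l = ('i%C * (mu l)%:C) ^+ k * fc u l) ->
  ~~ odd N -> (K < N./2)%N ->
  nrm (fun x => u x - trig_proj a b (fun l => (absz l <= K)%N) N u x) <=
  (mu K.+1%:Z) ^- k * nrm w.
Proof.
move=> ug wL2 fw eN KN; have [cu _ _] := ug; have uL2 := cont_itv_in_L2 hab cu.
have ba0 : 0 < b - a by rewrite subr_gt0.
have mK0 : 0 < mu K.+1%:Z.
  by rewrite /Defs.mu divr_gt0// !mulr_gt0 ?pi_gt0// ltr0n.
have mKk : 0 < mu K.+1%:Z ^+ k by rewrite exprn_gt0.
rewrite -ler_sqr ?nnegrE ?mulr_ge0 ?nrm_ge0 ?invr_ge0 ?(ltW mKk)//.
rewrite sqr_nrm_sub_trig_proj// lerBlDr.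
apply: (parseval_le ug) => M.
(* Enlarging [M] makes the partial sum contain the whole low-frequency block, which then cancels. *)
have mono : energy u M <= energy u (maxn M K.+1) by apply: energy_mono; exact: leq_maxl.
apply: le_trans mono _; move: (maxn M _) (leq_maxr M K.+1) => {}M MK.
rewrite /energy (bigID (fun l : 'I_(M.*2) => (absz (freq l) <= K)%N)) /= mulrDr.
rewrite (sum_freq_cut (fun l => cabs (fc u l) ^+ 2) (N := M.*2)) ?odd_double ?doubleK//.
rewrite -(sum_freq_cut (fun l => cabs (fc u l) ^+ 2) eN KN) addrC lerD2r.
rewrite exprMn exprVn ler_pdivlMl ?exprn_gt0//.
apply: le_trans (bessel hab M.*2 wL2); rewrite mulrCA ler_pM2l// mulr_sumr.
rewrite big_mkcond; apply: ler_sum => l _; case: ifP => [|_]; last by rewrite sqr_ge0.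
rewrite -ltnNge => Kl; rewrite fw cabsM [leRHS]exprMn.
apply: (ler_wpM2r (sqr_ge0 (cabs (fc u (freq l))))).
have -> : cabs (('i%C * (mu (freq l))%:C) ^+ k) = `|mu (freq l)| ^+ k.
  elim: (k) => [|j IH]; first by rewrite !expr0 cabs1.
  by rewrite !exprS cabsM IH cabsM cabs_i mul1r cabs_real.
rewrite -!exprM; apply: lerXn2r; rewrite ?nnegrE ?(ltW mK0)//.
by rewrite -[leLHS]gtr0_norm//; apply: mu_monotone.
Qed.

End FourierConvergence.

(** * Sampling and interpolation on the grid *)

Section PointwiseBounds.
Context {R : realType}.
Variables (a b : R).
Hypothesis hab : a < b.
Implicit Types (u g : R -> R[i]) (c d x : R).
Notation H1pair := (H1pair a b).

Lemma nrm_cst c d (z : R[i]) : c < d -> nrm c d (fun=> z) = Num.sqrt (d - c) * cabs z.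
Proof.
move=> cd; rewrite /nrm Rintegral_cst//.
have E := lebesgue_measure_itv `]c, d[%R.
rewrite [X in fine X]E /= lte_fin cd /=.
by rewrite sqrtrM ?sqr_ge0// sqrtr_sqr ger0_norm ?cabs_ge0// mulrC.
Qed.

Lemma sqr_add_le (A B : R) : (A + B) ^+ 2 <= 2 * A ^+ 2 + 2 * B ^+ 2.
Proof. by have := sqr_ge0 (A - B); lra. Qed.

(** Integration by parts against the affine weight of slope [k] that vanishes at [phi0]: only the
    value of [u] at the opposite endpoint survives. *)
Lemma H1pair_endpoint u g c d phi0 (k := (d - c)^-1) : H1pair u g ->
  a <= c -> c < d -> d <= b -> phi0 = c \/ phi0 = d ->
  (d - c) * cabs (u d * (k * (d - phi0))%:C - u c * (k * (c - phi0))%:C) ^+ 2 <=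
  2 * nrm c d u ^+ 2 + 2 * (d - c) ^+ 2 * nrm c d g ^+ 2.
Proof.
move=> ug ac cd db hphi; have [cu gL2 _] := ug.
have uL2 := cont_itv_in_L2 hab cu.
have dc0 : 0 < d - c by rewrite subr_gt0.
have [uL2' _] := in_L2S ac db uL2; have [gL2' _] := in_L2S ac db gL2.
have D x : is_derive x 1 (fun y : R => k * (y - phi0)) k by exact: isder_affine.
have ck := @cst_continuous R R k.
rewrite -(H1pair_ibp_real ug D ck ac cd db).
set I1 := cintegral _ _ _; set I2 := cintegral _ _ _.
have h1 : cabs I1 <= nrm c d u * (Num.sqrt (d - c) * k).
  apply: le_trans (cauchy_schwarz uL2' (in_L2_cst c d k%:C)) _.
  by rewrite nrm_cst// cabs_real ger0_norm// invr_ge0 ltW.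
have p1 x : c < x < d -> cabs (k * (x - phi0))%:C <= 1 * cabs (1 : R[i]).
  move=> xcd; rewrite cabs1 mul1r cabs_real normrM [`|k|]ger0_norm ?invr_ge0 ?(ltW dc0)//.
  rewrite /k ler_pdivrMl// mulr1 ler_norml; case: hphi => ->; lra.
have mp : cmeas c d (fun x => (k * (x - phi0))%:C).
  apply: ccont_cmeas; apply: ccont_real; exact: isder_continuous D.
have [pL2 pn] := in_L2_le_pt ler01 (in_L2_cst c d 1) mp p1.
have h2 : cabs I2 <= nrm c d g * Num.sqrt (d - c).
  apply: le_trans (cauchy_schwarz gL2' pL2) _.
  apply: ler_wpM2l; first exact: nrm_ge0.
  by apply: le_trans pn _; rewrite mul1r nrm_cst// cabs1 mulr1.
have s2 : Num.sqrt (d - c) ^+ 2 = d - c by rewrite sqr_sqrtr// ltW.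
apply: (@le_trans _ _ ((d - c) * (cabs I1 + cabs I2) ^+ 2)).
  rewrite ler_pM2l// ler_sqr ?nnegrE ?addr_ge0 ?cabs_ge0//; exact: cabsD.
apply: (@le_trans _ _ ((d - c) *
   (nrm c d u * (Num.sqrt (d - c) * k) + nrm c d g * Num.sqrt (d - c)) ^+ 2)).
  rewrite ler_pM2l// ler_sqr ?nnegrE ?addr_ge0 ?cabs_ge0 ?lerD//.
  by rewrite mulr_ge0 ?nrm_ge0// mulr_ge0 ?sqrtr_ge0// invr_ge0 ltW.
  by rewrite mulr_ge0 ?nrm_ge0// sqrtr_ge0.
have {h1 h2} := sqr_add_le (nrm c d u * (Num.sqrt (d - c) * k))
  (nrm c d g * Num.sqrt (d - c)).
rewrite !exprMn s2 => H.
have := ler_wpM2l (ltW dc0) H; congr (_ <= _).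
rewrite /k; field; by rewrite gt_eqF.
Qed.

Lemma H1pair_right_endpoint u g c d : H1pair u g -> a <= c -> c < d -> d <= b ->
  (d - c) * cabs (u d) ^+ 2 <=
  2 * nrm c d u ^+ 2 + 2 * (d - c) ^+ 2 * nrm c d g ^+ 2.
Proof.
move=> ug ac cd db; have := H1pair_endpoint ug ac cd db (or_introl (erefl c)).
by rewrite subrr mulr0 mulVf ?subr_eq0 ?gt_eqF// mulr1 mulr0 subr0.
Qed.

Lemma H1pair_left_endpoint u g c d : H1pair u g -> a <= c -> c < d -> d <= b ->
  (d - c) * cabs (u c) ^+ 2 <=
  2 * nrm c d u ^+ 2 + 2 * (d - c) ^+ 2 * nrm c d g ^+ 2.
Proof.
move=> ug ac cd db; have := H1pair_endpoint ug ac cd db (or_intror (erefl d)).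
rewrite subrr mulr0 mulr0 sub0r cabsN.
rewrite (_ : (d - c)^-1 * (c - d) = - 1); last by field; rewrite subr_eq0 gt_eqF.
by rewrite cabsM cabs_real normrN1 mulr1.
Qed.

(** [x] is an endpoint of a subinterval at least half as long as [a, b]. *)
Lemma sobolev u g x : H1pair u g -> a <= x <= b ->
  (b - a) * cabs (u x) ^+ 2 <=
  4 * nrm a b u ^+ 2 + 4 * (b - a) ^+ 2 * nrm a b g ^+ 2.
Proof.
move=> ug xab; have [cu gL2 _] := ug; have uL2 := cont_itv_in_L2 hab cu.
have hab' := hab.
have K c d : a <= c -> d <= b -> c < d -> b - a <= 2 * (d - c) ->
    (d - c) * cabs (u x) ^+ 2 <= 2 * nrm c d u ^+ 2 + 2 * (d - c) ^+ 2 * nrm c d g ^+ 2 ->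
  (b - a) * cabs (u x) ^+ 2 <= 4 * nrm a b u ^+ 2 + 4 * (b - a) ^+ 2 * nrm a b g ^+ 2.
  move=> ac db cd L H.
  have [_ n1] := in_L2S ac db uL2; have [_ n2] := in_L2S ac db gL2.
  have := sqr_ge0 (cabs (u x)) => X0.
  apply: (@le_trans _ _ (2 * ((d - c) * cabs (u x) ^+ 2))).
    by rewrite mulrA ler_wpM2r.
  have m1 : nrm c d u ^+ 2 <= nrm a b u ^+ 2 by rewrite ler_sqr ?nnegrE ?nrm_ge0.
  have m2 : nrm c d g ^+ 2 <= nrm a b g ^+ 2 by rewrite ler_sqr ?nnegrE ?nrm_ge0.
  have m3 : (d - c) ^+ 2 <= (b - a) ^+ 2.
    by rewrite ler_sqr ?nnegrE; clear - hab ac db cd hab'; lra.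
  have m4 := ler_pM (sqr_ge0 (d - c)) (sqr_ge0 (nrm c d g)) m3 m2.
  by clear - hab m1 m4 H; lra.
have [xm|xm] := leP x ((a + b) / 2).
  apply: (K x b); [lra|lra|lra|lra|].
  by apply: H1pair_left_endpoint => //; lra.
apply: (K a x); [lra|lra|lra|lra|].
by apply: H1pair_right_endpoint => //; lra.
Qed.

Section Grid.
Variable N : nat.
Hypothesis N0 : (0 < N)%N.
Notation h := (mesh a b N).
Notation grid := (grid a b N).

Lemma mesh_gt0 : 0 < h.
Proof. by rewrite divr_gt0 ?subr_gt0// ltr0n. Qed.

Lemma meshN : N%:R * h = b - a.
Proof. by rewrite mulrC divfK// pnatr_eq0 -lt0n. Qed.

Lemma grid_itv j : (j <= N)%N -> a <= grid j <= b.
Proof.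
move=> jN; have h0 := mesh_gt0; apply/andP; split.
  by rewrite lerDl mulr_ge0// ltW.
rewrite -lerBrDl -meshN; apply: ler_wpM2r; first exact: ltW.
by rewrite ler_nat.
Qed.

Lemma grid0 : grid 0 = a.
Proof. by rewrite /Defs.grid mul0r addr0. Qed.

Lemma gridN : grid N = b.
Proof. by rewrite /Defs.grid meshN addrC subrK. Qed.

Lemma gridS j : grid j.+1 = grid j + h.
Proof. by rewrite /Defs.grid -natr1 mulrDl mul1r addrA. Qed.

Lemma sum_cells u k : in_L2 a b u -> (k <= N)%N ->
  \sum_(j < k) nrm (grid j) (grid j.+1) u ^+ 2 = nrm a (grid k) u ^+ 2.
Proof.
move=> uL2; have h0 := mesh_gt0; elim: k => [|k IH] kN.
  rewrite big_ord0 grid0 sqr_nrm set_itvoo0//.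
  by rewrite Rintegral_set0.
rewrite big_ord_recr /= IH ?(ltnW kN)// !sqr_nrm.
have [/andP[ak _] /andP[_ kb]] := (grid_itv (ltnW kN), grid_itv kN).
case: k {IH} kN ak kb => [|k] kN ak kb.
  by rewrite grid0 set_itvoo0// Rintegral_set0 add0r.
rewrite -(@Rint_split _ a (grid k.+2) (grid k.+1))//.
- by have /in_L2P[] := (in_L2S (lexx a) kb uL2).1.
- by rewrite ltrDl mulr_gt0.
- by rewrite [ltRHS]gridS ltrDl.
Qed.

(** Each node is the left endpoint of its cell; the bounds on the cells add up. The derivative
    carries a factor [h], which makes up for its lower order of approximation. *)
Lemma grid_sampling u g : H1pair u g ->
  h * \sum_(j < N) cabs (u (grid j)) ^+ 2 <=
  2 * nrm a b u ^+ 2 + 2 * h ^+ 2 * nrm a b g ^+ 2.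
Proof.
move=> ug; have [cu gL2 _] := ug; have uL2 := cont_itv_in_L2 hab cu.
have h0 := mesh_gt0.
have [Eu Eg] := (sum_cells uL2 (leqnn N), sum_cells gL2 (leqnn N)).
rewrite gridN in Eu Eg; rewrite -Eu -Eg.
rewrite !mulr_sumr -big_split; apply: ler_sum => j _ /=.
have [/andP[ak _] /andP[_ kb]] := (grid_itv (ltnW (ltn_ord j)), grid_itv (ltn_ord j)).
have kk : grid j < grid j.+1 by rewrite gridS ltrDl.
have := H1pair_left_endpoint ug ak kk kb.
by rewrite (_ : grid j.+1 - grid j = h)// gridS addrC addKr.
Qed.

End Grid.
End PointwiseBounds.

(** * The discrete Fourier transform and interpolation *)

Section DiscreteFourier.
Context {R : realType}.
Variables (a b : R) (N : nat).
Hypotheses (hab : a < b) (N0 : (0 < N)%N).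
Notation h := (mesh a b N).
Notation grid := (grid a b N).
Notation mu := (mu a b).
Notation em := (em a b).
Notation dfc := (discrete_fourier_coef a b).
Implicit Types (v w : 'I_N.+1 -> R[i]).

Lemma mu_mesh l : mu l * h = 2 * pi * l%:~R / N%:R.
Proof.
rewrite /Defs.mu /mesh; move: (pi : R) => p; field.
by rewrite pnatr_eq0 -lt0n N0 subr_eq0 gt_eqF.
Qed.

Lemma em_grid l j : em l (grid j) = expi (j%:R * (2 * pi * l%:~R / N%:R)).
Proof. by rewrite !emE -mu_mesh /Defs.grid; congr expi; ring. Qed.

Lemma roots_of_unity_sum (k : int) : k != 0 -> (absz k < N)%N ->
  \sum_(j < N) expi (j%:R * (2 * pi * k%:~R / N%:R)) = 0 :> R[i].
Proof.
move=> k0 kN; set t : R := _ / _.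
have NR : N%:R != 0 :> R by rewrite pnatr_eq0 -lt0n.
have z1 : expi t != 1.
  rewrite -subr_eq0 -cabs_eq0 cabs_expi_sub1 mulf_eq0 pnatr_eq0 /= normr_eq0.
  have pi0 := @pi_gt0 R.
  (* Up to sign the half angle lies in ]0, pi[, so its sine is not 0 and the ratio of the geometric
     sum is not 1. *)
  have -> : t / 2 = Num.sg k%:~R * (pi * (absz k)%:R / N%:R).
    rewrite /t natr_absz; have : (k%:~R : R) = Num.sg k%:~R * `|k%:~R| by rewrite -numEsg.
    rewrite intr_norm => {1}->; move: (pi : R) => p; field.
    by [].
  rewrite sin_sg mulf_eq0 sgr_eq0 intr_eq0 (negbTE k0) /= gt_eqF//.
  have k1 : 0 < (absz k)%:R :> R by rewrite ltr0n absz_gt0.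
  apply: sin_gt0_pi; rewrite divr_gt0 ?mulr_gt0 ?ltr0n ?absz_gt0//=.
  by rewrite ltr_pdivrMr ?ltr0n// ltr_pM2l// ltr_nat.
have zN : expi t ^+ N = 1.
  rewrite -expiMn (_ : t *+ N = 2 * pi * k%:~R) ?expi_2pi_int//.
  by rewrite -(mulr_natr t) /t divfK.
have E j : expi (j%:R * t) = expi t ^+ j :> R[i] by rewrite -expiMn mulr_natl.
under eq_bigr do rewrite E.
have := subrX1 (expi t) N; rewrite zN subrr => /esym/eqP.
by rewrite mulf_eq0 subr_eq0 (negbTE z1) /= => /eqP.
Qed.

Lemma sum_grid (F : nat -> R[i]) : \sum_(j < N.+1 | (j < N)%N) F j = \sum_(j < N) F j.
Proof. rewrite big_mkcond big_ord_recr /= ltnn addr0; apply: eq_bigr => j _.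
by rewrite ltn_ord.
Qed.

Lemma freq_sub_lt (l k : 'I_N) : (absz (freq l - freq k) < N)%N.
Proof. by have := ltn_ord l; have := ltn_ord k; rewrite /freq; lia. Qed.

Lemma em_grid_orthogonal (l k : 'I_N) :
  \sum_(j < N) em (freq l) (grid j) * em (- freq k) (grid j) = (N%:R * (l == k)%:R)%:C.
Proof.
under eq_bigr do rewrite -emD em_grid.
have [->|lk] := eqVneq l k.
  rewrite subrr mulr1; under eq_bigr do rewrite mulr0 mul0r mulr0 expi0.
  by rewrite sumr_const card_ord rmorph_nat.
rewrite mulr0 roots_of_unity_sum ?freq_sub_lt//.
by rewrite subr_eq0 (inj_eq (@freq_inj N)).
Qed.

(** Orthogonality in the dual variable, needed for the discrete Parseval identity. That the
    frequencies start at [-N/2] only costs a phase independent of [l]. *)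
Lemma em_freq_orthogonal (j k : 'I_N) :
  \sum_(l < N) em (freq l) (grid j) * conjc (em (freq l) (grid k)) =
  (N%:R * (j == k)%:R)%:C.
Proof.
pose m : int := j%:Z - k%:Z.
have E (l : 'I_N) : em (freq l) (grid j) * conjc (em (freq l) (grid k)) =
    expi (- (N./2)%:R * (2 * pi * m%:~R / N%:R)) * expi (l%:R * (2 * pi * m%:~R / N%:R)).
  rewrite !em_grid -expiN -!expiD; congr expi.
  rewrite /freq /m !rmorphB /= -!pmulrn; move: (pi : R) => p; ring.
under eq_bigr do rewrite E; rewrite -mulr_sumr.
have [jk|jk] := eqVneq j k.
  rewrite mulr1 /m jk subrr; under eq_bigr do rewrite mulr0 mul0r mulr0 expi0.
  by rewrite mulr0 mul0r mulr0 expi0 mul1r sumr_const card_ord rmorph_nat.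
rewrite mulr0 roots_of_unity_sum ?mulr0//.
  by rewrite subr_eq0; apply: contra_neq jk => -[] /val_inj.
by rewrite /m; have := ltn_ord j; have := ltn_ord k; lia.
Qed.

Lemma interpolationE v : interpolation a b v = tp a b (fun l : 'I_N => dfc v (freq l)).
Proof. by []. Qed.

Lemma dfcE v l : dfc v l =
  (N%:R^-1)%:C * \sum_(j < N.+1 | (j < N)%N) v j * em (- l) (grid j).
Proof.
rewrite /discrete_fourier_coef; congr (_ * _); apply: eq_bigr => j _.
by rewrite !emE muN mulNr.
Qed.

Lemma dfcB v w l : dfc (fun j => v j - w j) l = dfc v l - dfc w l.
Proof.
rewrite !dfcE -mulrBr -sumrB; congr (_ * _); apply: eq_bigr => j _.
by rewrite mulrBl.
Qed.

Lemma dfcD v w l : dfc (fun j => v j + w j) l = dfc v l + dfc w l.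
Proof.
rewrite !dfcE -mulrDr -big_split; congr (_ * _); apply: eq_bigr => j _.
by rewrite mulrDl.
Qed.

Lemma dfcZ (c : R[i]) v l : dfc (fun j => c * v j) l = c * dfc v l.
Proof.
rewrite !dfcE [RHS]mulrCA; congr (_ * _); rewrite mulr_sumr; apply: eq_bigr => j _.
by rewrite mulrA.
Qed.

Lemma eq_dfc v w l : (forall j : 'I_N.+1, (j < N)%N -> v j = w j) -> dfc v l = dfc w l.
Proof.
by move=> vw; rewrite !dfcE; congr (_ * _); apply: eq_bigr => j /vw ->.
Qed.

Lemma interpolationB v w x : interpolation a b (fun j => v j - w j) x =
  interpolation a b v x - interpolation a b w x.
Proof.
by rewrite !interpolationE tpB; apply: eq_bigr => l _; rewrite dfcB.
Qed.

Lemma interpolationD v w x : interpolation a b (fun j => v j + w j) x =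
  interpolation a b v x + interpolation a b w x.
Proof.
by rewrite !interpolationE tpD; apply: eq_bigr => l _; rewrite dfcD.
Qed.

Lemma interpolationZ (c : R[i]) v x :
  interpolation a b (fun j => c * v j) x = c * interpolation a b v x.
Proof.
by rewrite !interpolationE tpZ; apply: eq_bigr => l _; rewrite dfcZ.
Qed.

Lemma eq_interpolation v w x : (forall j : 'I_N.+1, (j < N)%N -> v j = w j) ->
  interpolation a b v x = interpolation a b w x.
Proof.
move=> vw; rewrite !interpolationE; apply: eq_bigr => l _.
by rewrite (eq_dfc _ vw).
Qed.

Let NC : (N%:R^-1)%:C * (N%:R)%:C = 1 :> R[i].
Proof. by rewrite -rmorphM mulVf ?rmorph1// pnatr_eq0 -lt0n. Qed.

Lemma dfc_em (l k : 'I_N) : dfc (fun j : 'I_N.+1 => em (freq l) (grid j)) (freq k) = (l == k)%:R.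
Proof.
rewrite dfcE (sum_grid (fun j => em (freq l) (grid j) * em (- freq k) (grid j))).
rewrite em_grid_orthogonal rmorphM mulrA NC mul1r.
by rewrite rmorph_nat.
Qed.

Lemma dfc_sum I (r : seq I) (P : pred I) (F : I -> 'I_N.+1 -> R[i]) l :
  dfc (fun j => \sum_(i <- r | P i) F i j) l = \sum_(i <- r | P i) dfc (F i) l.
Proof.
rewrite dfcE; under eq_bigr do rewrite mulr_suml.
rewrite exchange_big /= mulr_sumr; apply: eq_bigr => i _.
by rewrite dfcE.
Qed.

Lemma dfc_tp (d : 'I_N -> R[i]) (k : 'I_N) :
  dfc (fun j : 'I_N.+1 => tp a b d (grid j)) (freq k) = d k.
Proof.
rewrite dfc_sum (bigD1 k)//= dfcZ dfc_em eqxx mulr1 big1 ?addr0// => l lk.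
by rewrite dfcZ dfc_em (negbTE lk) mulr0.
Qed.

Lemma interpolation_tp (d : 'I_N -> R[i]) x :
  interpolation a b (fun j : 'I_N.+1 => tp a b d (grid j)) x = tp a b d x.
Proof. by rewrite interpolationE; apply: eq_bigr => l _; rewrite dfc_tp. Qed.

Lemma discrete_parseval v :
  \sum_(l < N) cabs (dfc v (freq l)) ^+ 2 =
  N%:R^-1 * \sum_(j < N.+1 | (j < N)%N) cabs (v j) ^+ 2.
Proof.
have NR : N%:R != 0 :> R by rewrite pnatr_eq0 -lt0n.
(* A version of [v] on the natural numbers, so that [sum_grid] can drop the repeated node [N]. *)
pose v' (j : nat) : R[i] := v (inord j).
have v'E (j : 'I_N.+1) : v j = v' j by rewrite /v' inord_val.
have dE l : dfc v l = (N%:R^-1)%:C * \sum_(j < N) v' j * em (- l) (grid j).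
  rewrite dfcE -(sum_grid (fun j => v' j * em (- l) (grid j))).
  by congr (_ * _); apply: eq_bigr => j _; rewrite v'E.
have SE : \sum_(j < N.+1 | (j < N)%N) (cabs (v j) ^+ 2)%:C =
    \sum_(j < N) (cabs (v' j) ^+ 2)%:C.
  rewrite -(sum_grid (fun j => (cabs (v' j) ^+ 2)%:C)).
  by apply: eq_bigr => j _; rewrite v'E.
apply: complexI; rewrite rmorphM !rmorph_sum /= SE.
transitivity (\sum_(l < N) (N%:R^-1)%:C ^+ 2 * \sum_(j < N) \sum_(k < N)
   v' j * conjc (v' k) * (em (freq l) (grid k) * conjc (em (freq l) (grid j)))).
  apply: eq_bigr => l _; rewrite -mul_conj dE conjcM conjc_real conjc_sum.
  rewrite mulrACA -expr2; congr (_ * _); rewrite mulr_suml; apply: eq_bigr => j _.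
  rewrite mulr_sumr; apply: eq_bigr => k _.
  by rewrite conjcM !emN conjcK; ring.
rewrite -mulr_sumr exchange_big expr2 -mulrA; congr (_ * _) => /=.
rewrite mulr_sumr; apply: eq_bigr => j _; rewrite exchange_big /=.
under eq_bigr do rewrite -mulr_sumr em_freq_orthogonal.
rewrite (bigD1 j)//= eqxx mulr1 big1 ?addr0; last first.
  by move=> k kj; rewrite (negbTE kj) mulr0 rmorph0 mulr0.
by rewrite mulrCA NC mulr1 mul_conj.
Qed.

Lemma sqr_nrm_interpolation v : nrm a b (interpolation a b v) ^+ 2 =
  h * \sum_(j < N.+1 | (j < N)%N) cabs (v j) ^+ 2.
Proof. by rewrite interpolationE sqr_nrm_tp// discrete_parseval mulrA. Qed.

(** By the discrete Parseval identity, the L^2 norm of an interpolant depends only on the moduli at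
    the nodes; nonlinear estimates can therefore be made node by node. *)
Lemma nrm_interpolation_le v w (c : R) : 0 <= c ->
  (forall j : 'I_N.+1, (j < N)%N -> cabs (v j) <= c * cabs (w j)) ->
  nrm a b (interpolation a b v) <= c * nrm a b (interpolation a b w).
Proof.
move=> c0 vw; rewrite -ler_sqr ?nnegrE ?mulr_ge0 ?nrm_ge0// exprMn.
rewrite !sqr_nrm_interpolation mulrCA ler_pM2l ?mesh_gt0// mulr_sumr.
apply: ler_sum => j /vw vwj; rewrite -exprMn ler_sqr ?nnegrE ?cabs_ge0//.
by rewrite mulr_ge0 ?cabs_ge0.
Qed.

Lemma cabs_grid_le v (j : 'I_N.+1) : (j < N)%N ->
  h * cabs (v j) ^+ 2 <= nrm a b (interpolation a b v) ^+ 2.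
Proof.
move=> jN; rewrite sqr_nrm_interpolation ler_pM2l ?mesh_gt0//.
by rewrite (bigD1 j)//= lerDl sumr_ge0// => k _; rewrite sqr_ge0.
Qed.

End DiscreteFourier.

(** * Regularity in time *)

Section TimeRegularity.
Context {R : realType}.
Variables (a b T : R).
Hypotheses (hab : a < b) (hT : 0 < T).
Implicit Types (u w g : R -> R[i]) (v dv : R -> R -> R[i]) (s t r e : R).
Notation leb := (@lebesgue_measure R).
Notation in2 := (in_L2 a b).
Notation nrm := (nrm a b).

Lemma cvg0_ereal_lt (I : Type) (F : set_system I) (FF : Filter F) (f : I -> \bar R) e :
  f @ F --> 0%E -> 0 < e -> \forall i \near F, (f i < e%:E)%E.
Proof.
move=> fF e0; have : nbhs (0%E : \bar R) [set y | (y < e%:E)%E].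
  by have := lt_nbhsl e0; apply: filterS => x /=; rewrite lte_fin.
by move/fF.
Qed.

Lemma near_within_itv (P : R -> Prop) t :
  (\forall s \near within `[0, T] (nbhs t), P s) ->
  exists2 d : R, 0 < d & forall s, 0 <= s <= T -> `|s - t| < d -> P s.
Proof.
rewrite /prop_near1 /within /= => /nbhs_ballP[d /= d0 H]; exists d => // s sT st.
have := H s; rewrite in_itv /=; apply => //.
by rewrite /ball /= distrC.
Qed.

Lemma near_within_dnbhs (P : R -> Prop) t :
  (\forall s \near within `[0, T] t^', P s) ->
  exists2 d : R, 0 < d & forall s, 0 <= s <= T -> s != t -> `|s - t| < d -> P s.
Proof.
rewrite /prop_near1 /within /= => /nbhs_ballP[d /= d0 H]; exists d => // s sT st sd.
have := H s; rewrite in_itv /=; apply => //.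
by rewrite /ball /= distrC.
Qed.

(** Compactness of [0, T] as a near-covering property, with the bound [M] as the parameter that
    tends to infinity. *)
Lemma compact_uniform_bound (Q : R -> R -> Prop) :
  (forall t M M', M <= M' -> Q t M -> Q t M') ->
  (forall t, 0 <= t <= T -> exists M, exists2 d : R, 0 < d &
    forall s, 0 <= s <= T -> `|s - t| < d -> Q s M) ->
  exists M, forall t, 0 <= t <= T -> Q t M.
Proof.
move=> Qmono loc.
have cpt := @segment_compact R 0 T.
have /near_covering_withinP := (compact_near_coveringP _).1 cpt.
move=> /(_ R +oo%R (fun M s => Q s M) _) cov.
have : \forall M \near +oo%R, `[0, T]%classic `<=` (fun s => Q s M).
  apply: cov => t /=; rewrite in_itv /= => tT.
  have [M [d d0 H]] := loc t tT.
  exists (ball t d, [set M' | M <= M']) => /=.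
    by split; [exact: nbhsx_ballx|apply: nbhs_pinfty_ge; exact: num_real].
  move=> [s M'] /= [sd MM']; rewrite in_itv /= => sT.
  apply: Qmono MM' _; apply: H => //.
  by move: sd; rewrite /ball /= distrC.
move=> [M0 [_ H]]; exists (M0 + 1) => t tT; apply: (H (M0 + 1)).
  by rewrite ltrDl.
by rewrite /= in_itv.
Qed.

Lemma C0_time_L2_bounded v : C0_time in2 (L2_norm a b) T v ->
  exists M, forall t, 0 <= t <= T -> nrm (v t) <= M.
Proof.
move=> [vL2 vc]; apply: (compact_uniform_bound (Q := fun t M => nrm (v t) <= M)).
  by move=> t M M' MM' H; exact: le_trans H MM'.
move=> t tT; have [d d0 H] := near_within_itv (cvg0_ereal_lt _ (vc t tT) ltr01).
exists (nrm (v t) + 1), d => // s sT st; have := H s sT st.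
have [sL2 tL2] := (vL2 s sT, vL2 t tT).
rewrite L2_nrm; last exact: in_L2B.
rewrite lte_fin => /ltW lt1.
have := ler_nrmD (in_L2B sL2 tL2) tL2.
rewrite (_ : (fun x => _) = v s); last by apply/funext => x; rewrite subrK.
lra.
Qed.

Lemma Lp_infty_ae_le (M : R) u : 0 <= M -> (Lp_norm a b +oo%E u <= M%:E)%E ->
  {ae leb, forall x, a < x < b -> cabs (u x) <= M}.
Proof.
move=> M0; rewrite /Lp_norm unlock; case: ifPn => [_ /ess_supP|].
  apply: aeS => x; rewrite /= /patch => + xab.
  rewrite mem_set /=; last by rewrite in_itv.
  by rewrite lee_fin ger0_norm// cabs_ge0.
(* The other branch of the supremum norm assumes a null total measure, which the positive length of
   ]a, b[ excludes. *)
rewrite lt_def measure_ge0 andbT negbK => /eqP m0.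
have := lebesgue_measure_itv `]a, b[%R.
rewrite /= lte_fin hab => E.
have : (leb `]a, b[%classic <= leb setT)%E by apply: le_measure; rewrite ?inE.
rewrite m0 E -EFinD lee_fin => H; exfalso; move: H hab; lra.
Qed.

Lemma C0_time_Linfty_bounded (V : R -> R -> R) :
  C0_time (in_Lp a b +oo%E) (Lp_norm a b +oo%E) T (fun t x => (V t x)%:C) ->
  exists2 M, 0 <= M &
    forall t, 0 <= t <= T -> {ae leb, forall x, a < x < b -> `|V t x| <= M}.
Proof.
move=> [vL vc].
have [M HM] : exists M, forall t, 0 <= t <= T ->
    {ae leb, forall x, a < x < b -> `|V t x| <= M}.
  apply: (compact_uniform_bound
    (Q := fun t M => {ae leb, forall x, a < x < b -> `|V t x| <= M})).
    by move=> t M M' MM'; apply: aeS => x H /H K; exact: le_trans K MM'.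
  move=> t tT; have [d d0 H] := near_within_itv (cvg0_ereal_lt _ (vc t tT) ltr01).
  have [_ _ Vt] := vL t tT.
  pose M := fine (Lp_norm a b +oo%E (fun x => (V t x)%:C)).
  have M0 : 0 <= M by apply: fine_ge0; exact: Lnorm_ge0.
  have Vt' : {ae leb, forall x, a < x < b -> cabs (V t x)%:C <= M}.
    apply: Lp_infty_ae_le => //; rewrite /M fineK// ge0_fin_numE//.
    exact: Lnorm_ge0.
  exists (M + 1), d => // s sT st.
  have /Lp_infty_ae_le := ltW (H s sT st); move=> /(_ ler01) H1.
  apply: aeS (aeI Vt' H1) => x [K1 K2] xab.
  have := K1 xab; have := K2 xab; rewrite -rmorphB !cabs_real.
  have := ler_normD (V s x - V t x) (V t x); rewrite subrK; lra.
exists `|M| => // t tT; apply: aeS (HM t tT) => x H /H K.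
exact: le_trans K (ler_norm _).
Qed.

Lemma is_derive_eps (f : R -> R) t l :
  (forall e, 0 < e -> exists2 d : R, 0 < d & forall s, s != t -> `|s - t| < d ->
    `|(f s - f t) / (s - t) - l| <= e) -> is_derive t 1 f l.
Proof.
move=> H; have cv : (fun h : R => h^-1 *: (f (h *: 1 + t) - f t)) @ 0^' --> l.
  apply/cvgrPdist_le => e e0; have [d d0 Hd] := H e e0.
  apply/nbhs_ballP; exists d => // h; rewrite /ball /= sub0r normrN => hd h0.
  have := Hd (h + t); rewrite addrK => /(_ _ hd).
  rewrite -subr_eq0 addrK => /(_ h0).
  by rewrite distrC [_ *: 1]mulr1 [_ *: (_ - _)]mulrC.
by apply: DeriveDef; [apply/cvg_ex; exists l|exact: cvg_lim cv].
Qed.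

(** Pairing with a fixed [w], without conjugation, hence complex linear in [u]; it turns L^2-valued
    functions of time into scalar ones. *)
Definition ell w u : R[i] := cintegral a b (fun x => u x * w x).

Lemma ellB w u u' : in2 w -> in2 u -> in2 u' ->
  ell w (fun x => u x - u' x) = ell w u - ell w u'.
Proof.
move=> wL2 uL2 uL2'; rewrite /ell -cintegralB; [|exact: cintgM|exact: cintgM].
by apply: eq_cintegral => x _; rewrite mulrBl.
Qed.

Lemma ellZ c w u : in2 w -> in2 u -> ell w (fun x => c * u x) = c * ell w u.
Proof.
move=> wL2 uL2; rewrite /ell -cintegralZ; last exact: cintgM.
by apply: eq_cintegral => x _; rewrite mulrA.
Qed.

Lemma ell_le w u : in2 w -> in2 u -> cabs (ell w u) <= nrm u * nrm w.
Proof. by move=> wL2 uL2; exact: cauchy_schwarz. Qed.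

Lemma div_realE (z : R[i]) (r : R) : z / r%:C =
  (complex.Re z / r) +i* (complex.Im z / r).
Proof.
by rewrite -fmorphV; apply: complex_ext; rewrite !cReImE /= mulr0 ?subr0 ?add0r.
Qed.

Lemma ell_cder v w g t (d0 : R) : in2 w -> in2 g -> 0 < d0 ->
  (forall s, `|s - t| < d0 -> in2 (v s)) ->
  (forall e, 0 < e -> exists2 d : R, 0 < d & forall s, s != t -> `|s - t| < d ->
    (L2_norm a b (fun x => ((v s x - v t x) / (s - t)%:C - g x)%R) < e%:E)%E) ->
  cder (fun s => ell w (v s)) t (ell w g).
Proof.
move=> wL2 gL2 d00 vL2 H.
have tL2 : in2 (v t) by apply: vL2; rewrite subrr normr0.
(* The 1 permits division even when [w] is null. *)
have nw : 0 < nrm w + 1 by have := nrm_ge0 a b w; lra.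
have K e : 0 < e -> exists2 d : R, 0 < d & forall s, s != t -> `|s - t| < d ->
    cabs ((ell w (v s) - ell w (v t)) / (s - t)%:C - ell w g) <= e.
  move=> e0; have [d dd0 Hd] := H _ (divr_gt0 e0 nw).
  exists (Num.min d d0) => [|s st]; first by rewrite lt_min dd0.
  rewrite lt_min => /andP[sd sd0]; have sL2 := vL2 s sd0.
  have := Hd s st sd.
  pose q x := (s - t)%:C^-1 * (v s x - v t x).
  have qL2 : in2 q by exact: (in_L2Z _ (in_L2B sL2 tL2)).1.
  rewrite (_ : (fun x => _) = (fun x => q x - g x)); last first.
    by apply/funext => x; rewrite /q mulrC.
  rewrite L2_nrm; last exact: in_L2B.
  rewrite lte_fin => /ltW nq.
  have -> : (ell w (v s) - ell w (v t)) / (s - t)%:C - ell w g =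
      ell w (fun x => q x - g x).
    by rewrite ellB// /q ellZ// ?ellB//; [rewrite mulrC|exact: in_L2B].
  apply: le_trans (ell_le wL2 (in_L2B qL2 gL2)) _.
  apply: (@le_trans _ _ (e / (nrm w + 1) * (nrm w + 1))); last by rewrite divfK// gt_eqF.
  by apply: ler_pM => //; rewrite ?nrm_ge0// lerDl.
split; apply: is_derive_eps => e e0; have [d dd0 Hd] := K e e0;
  exists d => // s st sd; apply: le_trans (Hd s st sd).
  by apply: le_trans (ler_Re_cabs _); rewrite div_realE !cReImE.
by apply: le_trans (ler_Im_cabs _); rewrite div_realE !cReImE.
Qed.

(** With [z = v t - v s], the pairing of [v] with the conjugate of [z] is a scalar function whose
    increment is [|z|^2]. The mean value theorem bounds it by [L |z| (t - s)], and one factor [|z|]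
    is cancelled. *)
Lemma C1_time_lipschitz v : C1_time in2 (L2_norm a b) T v ->
  exists2 L, 0 <= L & forall s t, 0 <= s <= T -> 0 <= t <= T ->
    nrm (fun x => v s x - v t x) <= L * `|s - t|.
Proof.
move=> [[vL2 vc] [dv [[dvL2 dvc] vdv]]].
have [L HL] := C0_time_L2_bounded (conj dvL2 dvc).
have L0 : 0 <= L by apply: le_trans (HL 0 _); [exact: nrm_ge0|rewrite lexx ltW].
exists L => //.
suff main s t : 0 <= s -> s < t -> t <= T -> nrm (fun x => v t x - v s x) <= L * (t - s).
  move=> s t /andP[s0 sT] /andP[t0 tT]; have [st|ts|->] := ltgtP s t.
  - by rewrite nrmBC distrC gtr0_norm ?subr_gt0//; exact: main.
  - by rewrite gtr0_norm ?subr_gt0//; exact: main.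
  - rewrite subrr normr0 mulr0 (_ : (fun x => _) = fun=> 0).
      by rewrite nrm_cst// cabs0 mulr0.
    by apply/funext => x; rewrite subrr.
move=> s0 st tT.
have sT' : 0 <= s <= T by rewrite s0 (le_trans (ltW st)).
have tT' : 0 <= t <= T by rewrite tT (le_trans s0)// ltW.
have [sL2 tL2] := (vL2 s sT', vL2 t tT').
set z := (fun x => v t x - v s x); have zL2 : in2 z by exact: in_L2B.
have wL2 := in_L2_conj zL2; set w := (fun x => conjc (z x)) in wL2.
pose f r := complex.Re (ell w (v r)).
have D r : r \in `]s, t[%R -> is_derive r 1 f (complex.Re (ell w (dv r))).
  rewrite in_itv /= => /andP[sr rt].
  have rT : 0 <= r <= T by lra.
  pose d0 := Num.min (r - s) (t - r).
  have d00 : 0 < d0 by rewrite /d0 lt_min !subr_gt0 sr.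
  have near_in q : `|q - r| < d0 -> 0 <= q <= T.
    by rewrite /d0 lt_min !ltr_norml; lra.
  have [] // := @ell_cder v w (dv r) r d0 wL2 (dvL2 r rT) d00 (fun q H => vL2 q (near_in q H)).
  move=> e e0; have [d dd0 Hd] := near_within_dnbhs (cvg0_ereal_lt _ (vdv r rT) e0).
  exists (Num.min d d0) => [|q qr]; first by rewrite lt_min dd0.
  by rewrite lt_min => /andP[qd qd0]; apply: Hd => //; exact: near_in.
have C : {within `[s, t], continuous f}.
  apply/subspace_continuousP => r /=; rewrite in_itv /= => rst.
  have rT : 0 <= r <= T by lra.
  apply/cvgrPdist_le => e e0.
  have nw : 0 < nrm w + 1 by have := nrm_ge0 a b w; lra.
  have [d dd0 Hd] := near_within_itv (cvg0_ereal_lt _ (vc r rT) (divr_gt0 e0 nw)).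
  rewrite /prop_near1 /within /=; apply/nbhs_ballP; exists d => // q.
  rewrite /ball /= distrC => qd; rewrite in_itv /= => qst.
  have qT : 0 <= q <= T by lra.
  have := Hd q qT qd; have [qL2 rL2] := (vL2 q qT, vL2 r rT).
  rewrite L2_nrm; last exact: in_L2B.
  rewrite lte_fin => /ltW nq; rewrite distrC /f -cReN -cReD -ellB//.
  apply: le_trans (ler_Re_cabs _) _; apply: le_trans (ell_le wL2 (in_L2B qL2 rL2)) _.
  apply: (@le_trans _ _ (e / (nrm w + 1) * (nrm w + 1))); last by rewrite divfK// gt_eqF.
  by apply: ler_pM => //; rewrite ?nrm_ge0// lerDl.
have [c cst] := MVT st D C.
rewrite in_itv /= in cst.
have cT : 0 <= c <= T by lra.
have -> : f t - f s = nrm z ^+ 2.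
  rewrite /f -cReN -cReD -ellB// /ell.
  by rewrite (cintegral_mul_conj zL2).
have nwz : nrm w = nrm z by exact: nrm_conj.
have bd : complex.Re (ell w (dv c)) <= L * nrm z.
  apply: le_trans (ler_norm _) _; apply: le_trans (ler_Re_cabs _) _.
  apply: le_trans (ell_le wL2 (dvL2 c cT)) _; rewrite nwz.
  by apply: ler_wpM2r; [exact: nrm_ge0|exact: HL].
move=> E; have [z0|z0] := eqVneq (nrm z) 0.
  by rewrite z0 mulr_ge0// subr_ge0 ltW.
have zp : 0 < nrm z by rewrite lt_def z0 nrm_ge0.
rewrite -(ler_pM2l zp) -expr2 E.
have ts0 : 0 <= t - s by rewrite subr_ge0 ltW.
apply: le_trans (ler_wpM2r ts0 bd) _.
by rewrite mulrCA mulrA.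
Qed.

End TimeRegularity.

(** * Sobolev norms and periodic Sobolev functions *)

Section SobolevNorm.
Context {R : realType}.
Variables (a b : R).
Hypotheses (hab : a < b).
Implicit Types (u v g : R -> R[i]).
Notation leb := (@lebesgue_measure R).
Notation in2 := (in_L2 a b).
Notation nrm := (nrm a b).
Notation wd := (weak_derivative a b).
Notation wderiv := (wderiv a b).
Notation wderivn := (wderivn a b).

Lemma wderivP u : (exists g, in2 g /\ wd u g) -> in2 (wderiv u) /\ wd u (wderiv u).
Proof. by move=> H; exact: (xgetPex (fun=> 0 : R[i]) H). Qed.

Lemma in_H_wderivn m u k : in_H a b m u -> (k <= m)%N -> in2 (wderivn k u).
Proof.
move=> [uL2 uH]; case: k => [|k] km; first by [].
by have [] := wderivP (uH k km).
Qed.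

Lemma in_H_weak_derivative m u k : in_H a b m u -> (k < m)%N ->
  wd (wderivn k u) (wderivn k.+1 u).
Proof. by move=> [uL2 uH] km; have [] := wderivP (uH k km). Qed.

Lemma H_normE m u : in_H a b m u ->
  H_norm a b m u = (Num.sqrt (\sum_(k < m.+1) nrm (wderivn k u) ^+ 2))%:E.
Proof.
move=> uH; rewrite /H_norm asboolT//.
have -> : (\sum_(k < m.+1) (L2_norm a b (wderivn k u)) `^ 2)%E =
    (\sum_(k < m.+1) nrm (wderivn k u) ^+ 2)%:E.
  rewrite -sumEFin; apply: eq_bigr => k _.
  rewrite L2_nrm; last by apply: in_H_wderivn uH _; rewrite -ltnS.
  by rewrite poweR_EFin powR_mulrn// nrm_ge0.
by rewrite poweR_EFin powR12_sqrt// sumr_ge0// => k _; rewrite sqr_ge0.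
Qed.

Lemma H_norm_lty m u : (H_norm a b m u < +oo)%E -> in_H a b m u.
Proof. by rewrite /H_norm; case: asboolP => // _; rewrite ltxx. Qed.

Lemma weak_derivative_ae u v g : in2 u -> in2 v -> 
  {ae leb, forall x, a < x < b -> u x = v x} -> wd u g -> wd v g.
Proof.
move=> uL2 vL2 uv ug chi tchi; rewrite -ug//.
have [_ c2] := test_function_ccont tchi.
apply: ae_eq_cintegral.
- by apply: cmeasM; [exact: in_L2_cmeas|exact: ccont_cmeas].
- by apply: cmeasM; [exact: in_L2_cmeas|exact: ccont_cmeas].
- by apply: (aeS _ uv) => x H /H ->.
Qed.

(** [wderiv] selects an arbitrary representative, so additivity holds only almost everywhere and
    follows from uniqueness, order by order. *)
Lemma wderivnB m u v k : in_H a b m u -> in_H a b m v ->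
  in_H a b m (fun x => u x - v x) -> (k <= m)%N ->
  {ae leb, forall x, a < x < b ->
    wderivn k (fun x => u x - v x) x = wderivn k u x - wderivn k v x}.
Proof.
move=> uH vH uvH; elim: k => [|k IH] km; first exact: aeW.
have {}IH := IH (ltnW km).
have [Lu Lv] := (in_H_wderivn uH (ltnW km), in_H_wderivn vH (ltnW km)).
have [Lu' Lv'] := (in_H_wderivn uH km, in_H_wderivn vH km).
have [L L'] := (in_H_wderivn uvH (ltnW km), in_H_wderivn uvH km).
have W := weak_derivative_ae L (in_L2B Lu Lv) IH (in_H_weak_derivative uvH km).
have W' := weak_derivativeB Lu Lv Lu' Lv' (in_H_weak_derivative uH km)
  (in_H_weak_derivative vH km).
exact: (weak_derivative_unique (in_L2B Lu Lv) L' (in_L2B Lu' Lv') W W').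
Qed.

Lemma in_Hper_in_H m u : in_Hper a b m u -> in_H a b m u.
Proof. by case. Qed.

Lemma C0_time_H_bounded m T (psi : R -> R -> R[i]) : 0 < T ->
  C0_time (in_Hper a b m) (H_norm a b m) T psi ->
  exists M, forall t, 0 <= t <= T -> forall k, (k <= m)%N -> nrm (wderivn k (psi t)) <= M.
Proof.
move=> hT [pH pc].
apply: (compact_uniform_bound
  (Q := fun t M => forall k, (k <= m)%N -> nrm (wderivn k (psi t)) <= M)).
  by move=> t M M' MM' H k km; exact: le_trans (H k km) MM'.
move=> t tT; have [d d0 H] := near_within_itv (cvg0_ereal_lt _ (pc t tT) ltr01).
have tH := in_Hper_in_H (pH t tT).
exists (\sum_(k < m.+1) nrm (wderivn k (psi t)) + 1), d => // s sT st k km.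
have sH := in_Hper_in_H (pH s sT).
have lt1 := H s sT st.
(* Outside H^m the norm is set to infinity, so a norm below 1 already gives membership. *)
have dH : in_H a b m (fun x => psi s x - psi t x).
  by apply: H_norm_lty; apply: lt_trans lt1 _; rewrite ltry.
have n1 : nrm (wderivn k (fun x => psi s x - psi t x)) <= 1.
  move: lt1; rewrite H_normE// lte_fin => /ltW.
  apply: le_trans; rewrite -[leLHS]ger0_norm ?nrm_ge0// -sqrtr_sqr; apply: ler_wsqrtr.
  rewrite (bigD1 (Ordinal (km : (k < m.+1)%N)))//= lerDl.
  by apply: sumr_ge0 => i _; rewrite sqr_ge0.
have [Ls Lt] := (in_H_wderivn sH km, in_H_wderivn tH km).
have Ld := in_H_wderivn dH km.
have [_ E] := in_L2_ae Ld (in_L2_cmeas (in_L2B Ls Lt))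
  (aeS (fun x (H : a < x < b -> _) xab => esym (H xab)) (wderivnB sH tH dH km)).
have := ler_nrmD (in_L2B Ls Lt) Lt; rewrite E.
rewrite (_ : (fun x => _) = wderivn k (psi s)); last first.
  by apply/funext => x; rewrite subrK.
have : nrm (wderivn k (psi t)) <= \sum_(k < m.+1) nrm (wderivn k (psi t)).
  rewrite (bigD1 (Ordinal (km : (k < m.+1)%N)))//= lerDl.
  by apply: sumr_ge0 => i _; exact: nrm_ge0.
lra.
Qed.

Lemma in_Hper_pair m u k : in_Hper a b m u -> (k < m)%N ->
  exists g, [/\ H1pair a b g (wderivn k.+1 u), g a = g b &
    {ae leb, forall x, a < x < b -> wderivn k u x = g x}].
Proof.
move=> [uH uc up] km; have [g [[gc gae] gab]] := up k km.
have L := in_H_wderivn uH (ltnW km); have L' := in_H_wderivn uH km.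
have gL2 := cont_itv_in_L2 hab gc.
exists g; split => //; split => //.
exact: weak_derivative_ae L gL2 gae (in_H_weak_derivative uH km).
Qed.

Lemma in_Hper_pair0 m u : in_Hper a b m u -> (0 < m)%N ->
  H1pair a b u (wderivn 1 u) /\ u a = u b.
Proof.
move=> uP m0; have [uH uc up] := uP; have {}uc := uc m0.
have pu : H1pair a b u (wderivn 1 u).
  split => //; [exact: in_H_wderivn uH m0|exact: (in_H_weak_derivative uH m0)].
split => //; have [g [pg gab _]] := in_Hper_pair uP m0.
(* The boundary condition is stated for some continuous representative [g]; [u] and [g] have the
   same increment, as they share a weak derivative. *)
apply/eqP; rewrite -subr_eq0 -opprB -(H1pair_FTC pu (lexx a) hab (lexx b)).
by rewrite (H1pair_FTC pg (lexx a) hab (lexx b)) gab subrr oppr0.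
Qed.

(** Passing from order [k] to [k + 1] uses the periodicity of order [k], which the definition of the
    space provides for [k < m]. *)
Lemma fourier_coef_wderivn m u k l : in_Hper a b m u -> (k <= m)%N ->
  fourier_coef a b (wderivn k u) l =
  ('i%C * (mu a b l)%:C) ^+ k * fourier_coef a b u l.
Proof.
move=> uP; elim: k => [|k IH] km; first by rewrite expr0 mul1r.
have [g [pg gab gae]] := in_Hper_pair uP km.
have [gc _ _] := pg; have L := in_H_wderivn (in_Hper_in_H uP) (ltnW km).
rewrite (H1pair_fourier hab l pg gab).
rewrite -(ae_eq_fourier_coef l (in_L2_cmeas L) (cont_itv_cmeas gc) gae).
by rewrite IH ?(ltnW km)// exprS mulrA.
Qed.

End SobolevNorm.

(** * One step of the scheme *)

Section Corrector.
Context {R : realType}.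
Implicit Types (t s tau nu : R).

(** Symbol of the first-order corrector: with [theta = tau * mu^2], adding
    [tau * corrector theta * g] to the exact solution turns one exact step with
    frozen source [g] into one step of the scheme. At [theta = 0] the junk value
    [0] of the quotient is the right one. *)
Definition corrector (theta : R) : R[i] :=
  (1 - expi (- theta) - 'i%C * theta%:C * expi (- theta)) /
  (theta%:C * (1 - expi (- theta))).

(** Primitive in [s] of ['i * expi (nu * s)] vanishing at [0]. *)
Definition duhamel nu s : R[i] :=
  if nu == 0 then 'i%C * s%:C else (expi (nu * s) - 1) * (nu^-1)%:C.

Lemma duhamel0 nu : duhamel nu 0 = 0.
Proof.
rewrite /duhamel; case: ifP => _; first by rewrite rmorph0 mulr0.
by rewrite mulr0 expi0 subrr mul0r.
Qed.

Lemma cder_expi1 nu s : cder (fun y => expi (nu * y)) s ('i%C * nu%:C * expi (nu * s)).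
Proof.
have := cder_expi nu 0 s; rewrite subr0.
by congr cder; apply/funext => y; rewrite subr0.
Qed.

Lemma cder_duhamel nu s : cder (duhamel nu) s ('i%C * expi (nu * s)).
Proof.
rewrite /duhamel; have [->|nu0] := eqVneq nu 0.
  rewrite mul0r expi0; apply: cderZ; exact: (cder_real (@is_derive_id _ _ s 1)).
have H := cderM (cderD (cder_expi1 nu s) (cder_cst (- 1) s)) (cder_cst (nu^-1)%:C s).
move: H; rewrite addr0 mulr0 addr0; congr cder.
by rewrite mulrAC -(mulrA 'i%C) -rmorphM mulfV// rmorph1 mulr1.
Qed.

Lemma sub_expi_neq0 (theta : R) : 0 < theta <= pi ->
  theta / 8 <= cabs (1 - expi (- theta)).
Proof.
move=> /andP[t0 tpi]; rewrite cabsBC cabs_expi_sub1.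
rewrite mulNr sinN normrN.
have h := @sin_ge_eighth R (theta / 2).
have {}h : theta / 2 / 8 <= sin (theta / 2) by apply: h; lra.
have := ler_norm (sin (theta / 2)); lra.
Qed.

(** The numerator is at most [2 theta^2], being a second-order Taylor remainder up to a phase; the
    denominator is at least [theta^2 / 8]. *)
Lemma cabs_corrector (theta : R) : 0 <= theta <= pi -> cabs (corrector theta) <= 16.
Proof.
move=> /andP[t0 tpi]; rewrite /corrector.
have [->|tn0] := eqVneq theta 0; first by rewrite rmorph0 mul0r invr0 mulr0 cabs0.
have tp : 0 < theta by rewrite lt_def tn0.
have den : theta / 8 <= cabs (1 - expi (- theta)) by apply: sub_expi_neq0; rewrite tp.
have num : cabs (1 - expi (- theta) - 'i%C * theta%:C * expi (- theta)) <= 2 * theta ^+ 2.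
  rewrite (_ : _ - _ = expi (- theta) * (expi theta - 1 - 'i%C * theta%:C)).
    by rewrite cabsM cabs_expi mul1r cabs_expi_sub2_le.
  by rewrite !mulrBr expiNM mulr1; ring.
rewrite cabsM cabsV cabsM cabs_real ger0_norm//.
have d0 : 0 < theta * cabs (1 - expi (- theta)).
  by rewrite mulr_gt0// (lt_le_trans _ den)// divr_gt0.
rewrite ler_pdivrMr//; apply: le_trans num _.
have := ler_wpM2l t0 den; rewrite expr2; lra.
Qed.

(** On the right is the defect of the rectangle rule in Duhamel's formula. The factor
    [1 - exp(-i tau nu)] on the left is that of a coboundary: added before and after the exact
    propagation, the corrector absorbs the defect. *)
Lemma corrector_identity tau nu : 0 < tau -> 0 <= nu -> tau * nu <= pi ->
  tau%:C * corrector (tau * nu) * (1 - expi (- (tau * nu))) =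
  expi (- (tau * nu)) * duhamel nu tau - 'i%C * tau%:C * expi (- (tau * nu)).
Proof.
move=> tau0 nu0 tnu; rewrite /corrector /duhamel; have [->|nun0] := eqVneq nu 0.
  by rewrite mulr0 oppr0 expi0 subrr mulr0 mulr1 mul1r subrr.
have nup : 0 < nu by rewrite lt_def nun0.
have tp : 0 < tau * nu by rewrite mulr_gt0.
have e0 : 1 - expi (- (tau * nu)) != 0 :> R[i].
  rewrite -cabs_eq0 gt_eqF// (lt_le_trans _ (@sub_expi_neq0 (tau * nu) _))//.
    by rewrite divr_gt0.
  by rewrite tp.
have tc0 : (tau * nu)%:C != 0 :> R[i] by rewrite eq_complex /= gt_eqF.
have E : expi (- (tau * nu)) * ((expi (nu * tau) - 1) * (nu^-1)%:C) =
    (1 - expi (- (tau * nu))) * (nu^-1)%:C.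
  by rewrite mulrA mulrBr [nu * tau]mulrC expiNM mulr1.
rewrite E; move: (expi _) e0 => e e0.
have nC : nu%:C != 0 :> R[i] by rewrite eq_complex /= gt_eqF.
have tC : tau%:C != 0 :> R[i] by rewrite eq_complex /= gt_eqF.
rewrite fmorphV rmorphM /= in tc0 *; move: (nu%:C) (tau%:C) nC tC => x y xn yn.
by field; rewrite xn yn e0.
Qed.

End Corrector.

(** * Pointwise estimates of the cubic term and of the nonlinear phase *)

Section Nonlinearity.
Context {R : realType}.
Implicit Types (z w v : R[i]).

Definition cubic z : R[i] := (cabs z ^+ 2)%:C * z.

Lemma cubicE z : cubic z = z * z * conjc z.
Proof. by rewrite /cubic -mul_conj; ring. Qed.

Lemma cabs_sqr_sub (B : R) z w : cabs z <= B -> cabs w <= B ->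
  `|cabs z ^+ 2 - cabs w ^+ 2| <= 2 * B * cabs (z - w).
Proof.
move=> zB wB; rewrite subr_sqr normrM mulrC.
have h1 : `|cabs z - cabs w| <= cabs (z - w).
  have := cabsD (z - w) w; rewrite subrK; have := cabsD (w - z) z; rewrite subrK cabsBC.
  by rewrite ler_norml; lra.
have h2 : `|cabs z + cabs w| <= 2 * B by rewrite ger0_norm ?addr_ge0 ?cabs_ge0//; lra.
by apply: ler_pM.
Qed.

Lemma cubic_lipschitz (B : R) z w : cabs z <= B -> cabs w <= B ->
  cabs (cubic z - cubic w) <= 3 * B ^+ 2 * cabs (z - w).
Proof.
move=> zB wB; have B0 : 0 <= B by apply: le_trans zB; exact: cabs_ge0.
rewrite (_ : _ - _ = (cabs z ^+ 2)%:C * (z - w) + (cabs z ^+ 2 - cabs w ^+ 2)%:C * w); last first.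
  by rewrite /cubic rmorphB /=; ring.
apply: le_trans (cabsD _ _) _; rewrite !cabsM !cabs_real ger0_norm ?sqr_ge0//.
have h1 : cabs z ^+ 2 <= B ^+ 2 by rewrite ler_sqr ?nnegrE ?cabs_ge0.
have h2 := cabs_sqr_sub zB wB.
have h3 := ler_pM (normr_ge0 _) (cabs_ge0 w) h2 wB.
have h4 := ler_wpM2r (cabs_ge0 (z - w)) h1.
lra.
Qed.

Lemma cabs_cubic_le (B : R) z : cabs z <= B -> cabs (cubic z) <= B ^+ 2 * cabs z.
Proof.
move=> zB; rewrite cabsM cabs_real ger0_norm ?sqr_ge0//.
apply: ler_wpM2r; first exact: cabs_ge0.
have B0 : 0 <= B by apply: le_trans zB; exact: cabs_ge0.
by rewrite ler_sqr ?nnegrE ?cabs_ge0.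
Qed.

Definition nlphase (tau beta : R) v : R[i] :=
  v * expi (- (tau * nonlinearity beta (cabs v ^+ 2))).

Lemma nlphase_sub (tau beta B : R) v : 0 <= tau -> cabs v <= B ->
  cabs (nlphase tau beta v - v) <= tau * `|beta| * B ^+ 2 * cabs v.
Proof.
move=> tau0 vB; rewrite /nlphase (_ : _ - v =
  (expi (- (tau * nonlinearity beta (cabs v ^+ 2))) - 1) * v); last by ring.
rewrite cabsM.
apply: ler_wpM2r; first exact: cabs_ge0.
apply: le_trans (cabs_expi_sub1_le _) _; rewrite normrN /nonlinearity.
rewrite normrM normrM (ger0_norm tau0) (ger0_norm (sqr_ge0 (cabs v))) mulrA.
apply: ler_wpM2l; first by rewrite mulr_ge0.
have B0 : 0 <= B by apply: le_trans vB; exact: cabs_ge0.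
by rewrite ler_sqr ?nnegrE ?cabs_ge0.
Qed.

(** The order [tau^2] is that of an admissible local error. The cruder [nlphase_sub] suffices where
    the potential already supplies a factor [tau]. *)
Lemma nlphase_taylor (tau beta B : R) v : 0 <= tau -> cabs v <= B ->
  cabs (nlphase tau beta v - (v - 'i%C * (tau * beta)%:C * cubic v)) <=
  2 * tau ^+ 2 * beta ^+ 2 * B ^+ 4 * cabs v.
Proof.
move=> tau0 vB; have B0 : 0 <= B by apply: le_trans vB; exact: cabs_ge0.
set y := - (tau * nonlinearity beta (cabs v ^+ 2)).
have -> : nlphase tau beta v - (v - 'i%C * (tau * beta)%:C * cubic v) =
    (expi y - 1 - 'i%C * y%:C) * v.
  rewrite /nlphase -/y /cubic.
  have -> : y%:C = - ((tau * beta)%:C * (cabs v ^+ 2)%:C) :> R[i].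
    by rewrite -rmorphM -rmorphN /y /nonlinearity mulrA.
  by ring.
rewrite cabsM; apply: ler_wpM2r; first exact: cabs_ge0.
apply: le_trans (cabs_expi_sub2_le _) _.
rewrite (_ : y ^+ 2 = (tau * beta) ^+ 2 * cabs v ^+ 4); last first.
  by rewrite /y /nonlinearity; ring.
rewrite (_ : 2 * tau ^+ 2 * _ * _ = 2 * ((tau * beta) ^+ 2 * B ^+ 4)); last by ring.
rewrite ler_pM2l// ler_wpM2l ?sqr_ge0//.
by apply: lerXn2r; rewrite ?nnegrE ?cabs_ge0.
Qed.

Lemma nlphase_lipschitz (tau beta B : R) v w : 0 <= tau -> cabs v <= B -> cabs w <= B ->
  cabs (nlphase tau beta v - nlphase tau beta w) <=
  (1 + 2 * tau * `|beta| * B ^+ 2) * cabs (v - w).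
Proof.
move=> tau0 vB wB; have B0 : 0 <= B by apply: le_trans vB; exact: cabs_ge0.
rewrite /nlphase; set y := - (tau * nonlinearity beta (cabs v ^+ 2)).
set y' := - (tau * nonlinearity beta (cabs w ^+ 2)).
(* The first term is an isometry, so the Lipschitz constant is [1 + O(tau)] and its powers stay
   bounded. *)
rewrite (_ : _ - _ = (v - w) * expi y + w * (expi y' * (expi (y - y') - 1))); last first.
  have H : expi y' * expi (y - y') = expi y by rewrite -expiD addrC subrK.
  by rewrite [expi y' * _]mulrBr H; ring.
apply: le_trans (cabsD _ _) _; rewrite !cabsM !cabs_expi mulr1 mul1r mulrDl mul1r lerD2l.
have h1 := cabs_sqr_sub vB wB.
have h2 : cabs (expi (y - y') - 1) <= tau * `|beta| * (2 * B * cabs (v - w)).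
  apply: le_trans (cabs_expi_sub1_le _) _.
  rewrite (_ : y - y' = - (tau * beta * (cabs v ^+ 2 - cabs w ^+ 2))); last first.
    by rewrite /y /y' /nonlinearity; ring.
  by rewrite normrN !normrM (ger0_norm tau0) ler_wpM2l// mulr_ge0.
have := ler_pM (cabs_ge0 w) (cabs_ge0 _) wB h2; lra.
Qed.

End Nonlinearity.

(** * Functions reproduced exactly by interpolation *)

Section LowFrequency.
Context {R : realType}.
Variables (a b : R) (N : nat).
Hypotheses (hab : a < b) (N0 : (0 < N)%N) (eN : ~~ odd N).
Notation grid := (grid a b N).

Definition interpolated (f : R -> R[i]) : Prop :=
  forall x, interpolation a b (fun j : 'I_N.+1 => f (grid j)) x = f x.

Lemma interpolated_em (k : int) : (absz k < N./2)%N -> interpolated (em a b k).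
Proof.
move=> kN x.
have NE : N = (N./2 + N./2)%N by rewrite addnn -[LHS]odd_double_half (negbTE eN).
have lN : (absz (k + N./2%:Z)%R < N)%N by lia.
pose l : 'I_N := Ordinal lN.
have lE : freq l = k by rewrite /freq /=; lia.
have E y : em a b k y = tp a b (fun i : 'I_N => (i == l)%:R) y.
  rewrite /tp (bigD1 l)//= eqxx mul1r lE big1 ?addr0// => i il.
  by rewrite (negbTE il) mul0r.
rewrite E -(interpolation_tp hab N0); apply: eq_interpolation => j _.
exact: E.
Qed.

Lemma interpolatedZ c f : interpolated f -> interpolated (fun x => c * f x).
Proof. by move=> fX x; rewrite interpolationZ fX. Qed.

Lemma interpolated_sum I (r : seq I) (F : I -> R -> R[i]) :
  (forall i, interpolated (F i)) -> interpolated (fun x => \sum_(i <- r) F i x).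
Proof.
move=> FX x; elim: r => [|i r IH].
  rewrite big_nil (@eq_interpolation _ _ _ _ _ (fun j => 0 * 0)).
    by rewrite interpolationZ mul0r.
  by move=> j _; rewrite big_nil mulr0.
rewrite big_cons -IH -FX -interpolationD; apply: eq_interpolation => j _.
by rewrite big_cons.
Qed.

(** No aliasing: the cubic term of frequencies at most [K] has frequencies at
    most [3 K]. *)
Lemma interpolated_cubic (d : 'I_N -> R[i]) (K : nat) : (3 * K < N./2)%N ->
  (forall l, ~~ (absz (freq l) <= K)%N -> d l = 0) ->
  interpolated (fun x => cubic (tp a b d x)).
Proof.
move=> KN dK.
have E x : cubic (tp a b d x) = \sum_(l1 < N) \sum_(l2 < N) \sum_(l3 < N)
    (d l1 * d l2 * conjc (d l3)) * em a b (freq l1 + freq l2 - freq l3) x.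
  rewrite cubicE /tp conjc_sum mulr_suml mulr_suml; apply: eq_bigr => l1 _.
  rewrite [X in X * _]mulr_sumr mulr_suml; apply: eq_bigr => l2 _.
  rewrite mulr_sumr; apply: eq_bigr => l3 _.
  rewrite (emD a b (freq l1 + freq l2)) (emD a b (freq l1)) emN conjcM; ring.
rewrite (funext E).
apply: interpolated_sum => l1; apply: interpolated_sum => l2; apply: interpolated_sum => l3.
have [h1|h1] := boolP (absz (freq l1) <= K)%N; last first.
  by move=> x; rewrite (dK _ h1) interpolationZ !mul0r.
have [h2|h2] := boolP (absz (freq l2) <= K)%N; last first.
  by move=> x; rewrite (dK _ h2) interpolationZ mulr0 !mul0r.
have [h3|h3] := boolP (absz (freq l3) <= K)%N; last first.
  by move=> x; rewrite (dK _ h3) conjc_real interpolationZ mulr0 !mul0r.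
apply: interpolatedZ; apply: interpolated_em; lia.
Qed.

End LowFrequency.

(** * Duhamel's formula with a frozen source *)

Section LocalError.
Context {R : realType}.
Variables (a b : R).
Hypothesis hab : a < b.
Notation in2 := (in_L2 a b).
Notation nrm := (nrm a b).
Notation tp := (tp a b).
Notation mu := (mu a b).
Notation fc := (fourier_coef a b).
Implicit Types (s t r tau L : R).

Lemma lipschitz_cont_itv (f : R -> R[i]) tau L : 0 <= L ->
  (forall s r, 0 <= s <= tau -> 0 <= r <= tau -> cabs (f s - f r) <= L * `|s - r|) ->
  continuous_on_itv 0 tau f.
Proof.
move=> L0 H.
have K (p : R[i] -> R) : (forall z w, `|p z - p w| <= cabs (z - w)) ->
    {within `[0, tau], continuous (fun s => p (f s))}.
  move=> pL; apply/subspace_continuousP => r /=; rewrite in_itv /= => rT.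
  apply/cvgrPdist_le => e e0.
  rewrite /prop_near1 /within /=; apply/nbhs_ballP; exists (e / (L + 1)) => /=.
    by rewrite divr_gt0// ltr_pwDr.
  move=> s; rewrite /ball /= => rs; rewrite in_itv /= => sT.
  apply: le_trans (pL _ _) _; apply: le_trans (H r s rT sT) _.
  move: rs; rewrite ltr_pdivlMr ?ltr_pwDr// => /ltW; apply: le_trans.
  by rewrite mulrC ler_wpM2l// lerDl.
split; apply: K => z w; first by rewrite -cReN -cReD; exact: ler_Re_cabs.
by rewrite -cImN -cImD; exact: ler_Im_cabs.
Qed.

Lemma cont_itvD (c d : R) (u v : R -> R[i]) : continuous_on_itv c d u ->
  continuous_on_itv c d v -> continuous_on_itv c d (fun x => u x + v x).
Proof.
move=> [u1 u2] [v1 v2]; split => x.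
  rewrite (funext (fun x => cReD (u x) (v x))); apply: cvgD; [exact: u1|exact: v1].
rewrite (funext (fun x => cImD (u x) (v x))); apply: cvgD; [exact: u2|exact: v2].
Qed.

Lemma cont_itvM (c d : R) (u v : R -> R[i]) : continuous_on_itv c d u ->
  continuous_on_itv c d v -> continuous_on_itv c d (fun x => u x * v x).
Proof.
move=> [u1 u2] [v1 v2]; split => x.
  rewrite (funext (fun x => cReM (u x) (v x))).
  apply: cvgB; apply: cvgM; [exact: u1|exact: v1|exact: u2|exact: v2].
rewrite (funext (fun x => cImM (u x) (v x))).
apply: cvgD; apply: cvgM; [exact: u1|exact: v2|exact: u2|exact: v1].
Qed.

Lemma cont_itv_sum (c d : R) I (r : seq I) (F : I -> R -> R[i]) :
  (forall i, continuous_on_itv c d (F i)) ->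
  continuous_on_itv c d (fun x => \sum_(i <- r) F i x).
Proof.
move=> FC; elim: r => [|i r IH].
  rewrite (_ : (fun _ => _) = fun=> 0); first exact: ccont_cont_itv (ccont_cst 0).
  by apply/funext => x; rewrite big_nil.
rewrite (_ : (fun _ => _) = fun x => F i x + \sum_(j <- r) F j x).
  exact: cont_itvD.
by apply/funext => x; rewrite big_cons.
Qed.

Lemma inner_le u v : in2 u -> in2 v -> cabs (inner a b u v) <= nrm u * nrm v.
Proof.
by move=> uL2 vL2; rewrite -[X in _ * X](nrm_conj a b v); apply: cauchy_schwarz => //;
  exact: in_L2_conj.
Qed.

(** Mean value inequality in L^2 norm for curves of trigonometric polynomials: the increment [z] is
    paired with itself, and the scalar mean value theorem applies to the real part. *)
Lemma vector_MVT N (F dF : R -> 'I_N -> R[i]) tau B : 0 < tau ->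
  (forall l s, 0 < s < tau -> cder (fun s => F s l) s (dF s l)) ->
  (forall l, continuous_on_itv 0 tau (fun s => F s l)) ->
  (forall s, 0 < s < tau -> nrm (tp (dF s)) <= B) ->
  nrm (tp (fun l => F tau l - F 0 l)) <= B * tau.
Proof.
move=> tau0 FdF Fc dFB; set z := (fun l => F tau l - F 0 l).
have ba0 : 0 < b - a by rewrite subr_gt0.
pose phi s := \sum_(l < N) conjc (z l) * F s l.
pose dphi s := \sum_(l < N) conjc (z l) * dF s l.
have D s : s \in `]0, tau[%R ->
    is_derive s 1 (fun s => complex.Re (phi s)) (complex.Re (dphi s)).
  rewrite in_itv /= => st.
  have [] // : cder phi s (dphi s) by apply: cder_sum => l; apply: cderZ; exact: FdF.
have C : {within `[0, tau], continuous (fun s => complex.Re (phi s))}.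
  have [] // : continuous_on_itv 0 tau phi.
  apply: cont_itv_sum => l; apply: cont_itvM => //.
  exact: ccont_cont_itv (ccont_cst _).
have [xi] := MVT tau0 D C; rewrite in_itv /= subr0 => xit E.
have E1 : (b - a) * (complex.Re (phi tau) - complex.Re (phi 0)) = nrm (tp z) ^+ 2.
  rewrite sqr_nrm_tp// -cReN -cReD; congr (_ * _).
  have -> : phi tau - phi 0 = \sum_(l < N) (cabs (z l) ^+ 2)%:C.
    by rewrite /phi -sumrB; apply: eq_bigr => l _; rewrite -mulrBr mulrC -mul_conj.
  by rewrite -rmorph_sum.
have E2 : (b - a)%:C * dphi xi = inner a b (tp (dF xi)) (tp z).
  rewrite inner_tp//; last exact: tp_in_L2.
  by congr (_ * _); apply: eq_bigr => l _; rewrite fourier_coef_tp// mulrC.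
have bd : (b - a) * complex.Re (dphi xi) <= B * nrm (tp z).
  have -> : (b - a) * complex.Re (dphi xi) = complex.Re ((b - a)%:C * dphi xi).
    by rewrite cReM /= mul0r subr0.
  rewrite E2; apply: le_trans (ler_norm _) _; apply: le_trans (ler_Re_cabs _) _.
  apply: le_trans (inner_le (tp_in_L2 _ _ _) (tp_in_L2 _ _ _)) _.
  by apply: ler_wpM2r; [exact: nrm_ge0|exact: dFB].
have [z0|z0] := eqVneq (nrm (tp z)) 0.
  rewrite z0 mulr_ge0 ?(ltW tau0)//.
  by apply: le_trans (dFB xi xit); exact: nrm_ge0.
have zp : 0 < nrm (tp z) by rewrite lt_def z0 nrm_ge0.
rewrite -(ler_pM2l zp) -expr2 -E1 E mulrA.
apply: le_trans (ler_wpM2r (ltW tau0) bd) _.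
by rewrite mulrAC mulrC.
Qed.

Lemma fourier_coef_sub_le u v l : in2 u -> in2 v ->
  cabs (fc u l - fc v l) <= Num.sqrt (b - a) / (b - a) * nrm (fun x => u x - v x).
Proof.
move=> uL2 vL2; have ba0 : 0 < b - a by rewrite subr_gt0.
rewrite -fourier_coefB// fourier_coefE cabsM cabs_real ger0_norm ?invr_ge0 ?(ltW ba0)//.
rewrite [leRHS]mulrC [_ / _]mulrC mulrCA; apply: ler_wpM2l; first by rewrite invr_ge0 ltW.
apply: le_trans (cauchy_schwarz (in_L2B uL2 vL2) (em_in_L2 a b (- l))) _.
apply: ler_wpM2l; first exact: nrm_ge0.
rewrite (_ : nrm (em a b (- l)) = nrm (fun=> 1)); first by rewrite nrm_cst// cabs1 mulr1.
by congr Num.sqrt; apply: eq_Rintegral => x _; rewrite cabs_em cabs1.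
Qed.

Lemma cder_shift (f : R -> R[i]) t s z : cder f (t + s) z -> cder (fun y => f (t + y)) s z.
Proof.
rewrite (_ : (fun y => f (t + y)) = (fun y => f (y - - t))); last first.
  by apply/funext => y; rewrite opprK addrC.
rewrite (_ : t + s = s - - t); last by rewrite opprK addrC.
move=> [d1 d2]; split.
  exact: (is_derive_shift d1).
exact: (is_derive_shift d2).
Qed.

(** Variation of constants for all modes together: the bound is in L^2 and free of [mu], since only
    increments of the source remain. *)
Lemma frozen_source_error (psi g : R -> R -> R[i]) (T Lp Lg t tau : R) N :
  0 <= Lp -> 0 <= Lg ->
  (forall s, 0 <= s <= T -> in2 (psi s)) -> (forall s, 0 <= s <= T -> in2 (g s)) ->
  (forall s r, 0 <= s <= T -> 0 <= r <= T -> nrm (fun x => psi s x - psi r x) <= Lp * `|s - r|) ->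
  (forall s r, 0 <= s <= T -> 0 <= r <= T -> nrm (fun x => g s x - g r x) <= Lg * `|s - r|) ->
  (forall s l, 0 < s < T -> cder (fun r => fc (psi r) l) s
     (- 'i%C * ((mu l ^+ 2)%:C * fc (psi s) l + fc (g s) l))) ->
  0 <= t -> 0 < tau -> t + tau <= T ->
  nrm (tp (fun l : 'I_N => let th := tau * mu (freq l) ^+ 2 in
    fc (psi (t + tau)) (freq l) - expi (- th) * fc (psi t) (freq l) +
    expi (- th) * duhamel (mu (freq l) ^+ 2) tau * fc (g t) (freq l))) <= Lg * tau ^+ 2.
Proof.
move=> Lp0 Lg0 pL2 gL2 pLip gLip ode t0 tau0 tT.
pose nu (l : 'I_N) := mu (freq l) ^+ 2.
pose F s (l : 'I_N) := expi (nu l * s) * fc (psi (t + s)) (freq l) +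
  duhamel (nu l) s * fc (g t) (freq l).
pose dF s (l : 'I_N) := - 'i%C * expi (nu l * s) *
  (fc (g (t + s)) (freq l) - fc (g t) (freq l)).
have tin s : 0 <= s <= tau -> 0 <= t + s <= T by lra.
have tT' : 0 <= t <= T by lra.
have FdF l s : 0 < s < tau -> cder (fun s => F s l) s (dF s l).
  move=> st.
  have sh : cder (fun y => fc (psi (t + y)) (freq l)) s
      (- 'i%C * ((nu l)%:C * fc (psi (t + s)) (freq l) + fc (g (t + s)) (freq l))).
    exact: cder_shift (ode (t + s) (freq l) ltac:(lra)).
  have := cderD (cderM (cder_expi1 (nu l) s) sh)
    (cderM (cder_duhamel (nu l) s) (cder_cst (fc (g t) (freq l)) s)).
  by congr cder; rewrite /dF; ring.
have Fc l : continuous_on_itv 0 tau (fun s => F s l).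
  apply: cont_itvD; apply: cont_itvM.
  - exact: ccont_cont_itv (cder_ccont (cder_expi1 (nu l))).
  (* The equation of a mode holds only at times strictly between 0 and T; continuity at the ends
     comes from the Lipschitz bound. *)
  - apply: (@lipschitz_cont_itv _ _ (Num.sqrt (b - a) / (b - a) * Lp)).
      by rewrite mulr_ge0// divr_ge0 ?sqrtr_ge0// subr_ge0 ltW.
    move=> s r st rt; apply: le_trans (fourier_coef_sub_le _ (pL2 _ (tin s st)) (pL2 _ (tin r rt))) _.
    rewrite -[leRHS]mulrA; apply: ler_wpM2l.
      by rewrite divr_ge0 ?sqrtr_ge0// subr_ge0 ltW.
    apply: le_trans (pLip _ _ (tin s st) (tin r rt)) _.
    by rewrite (_ : t + s - (t + r) = s - r)//; ring.
  - exact: ccont_cont_itv (cder_ccont (cder_duhamel (nu l))).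
  - exact: ccont_cont_itv (ccont_cst _).
have dFB s : 0 < s < tau -> nrm (tp (dF s)) <= Lg * tau.
  move=> st; have sT : 0 <= t + s <= T by lra.
  have dL2 := in_L2B (gL2 _ sT) (gL2 _ tT').
  have := @nrm_trig_proj_le R a b hab N _ (dF s) 1 ler01 dL2; rewrite mul1r => H.
  apply: le_trans (H _) _.
    move=> l; rewrite /dF fourier_coefB//; [|exact: gL2|exact: gL2].
    by rewrite !cabsM cabsN cabs_i cabs_expi !mul1r.
  apply: le_trans (gLip _ _ sT tT') _; rewrite addrAC subrr add0r.
  by apply: ler_wpM2l => //; rewrite ger0_norm; lra.
have := vector_MVT tau0 FdF Fc dFB; rewrite -mulrA -expr2; apply: le_trans.
rewrite -[leRHS]mul1r.
have := @nrm_trig_proj_le R a b hab N (tp (fun l => F tau l - F 0 l))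
  _ 1 ler01 (tp_in_L2 _ _ _); apply => l.
rewrite fourier_coef_tp// mul1r.
(* Undoing the integrating factor at time [tau] does not change moduli. *)
rewrite -[leRHS]mul1r -(cabs_expi (- (tau * nu l))) -cabsM le_eqVlt; apply/orP; left.
apply/eqP; congr cabs.
rewrite /F duhamel0 mul0r addr0 mulr0 expi0 mul1r addr0 mulrBr mulrDr.
rewrite [nu l * tau]mulrC [expi _ * (expi _ * _)]mulrA expiNM mul1r /nu.
ring.
Qed.

End LocalError.

(** * The source term and the Fourier modes of the exact solution *)

Section SolutionRegularity.
Context {R : realType}.
Variables (a b : R).
Hypothesis hab : a < b.
Notation leb := (@lebesgue_measure R).
Notation in2 := (in_L2 a b).
Notation nrm := (nrm a b).
Notation mu := (mu a b).
Notation fc := (fourier_coef a b).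
Notation wderivn := (wderivn a b).
Implicit Types (u g w : R -> R[i]) (s t : R).

Definition sobolev_const : R := Num.sqrt ((4 + 4 * (b - a) ^+ 2) / (b - a)).

Lemma sobolev_const_ge0 : 0 <= sobolev_const.
Proof. exact: sqrtr_ge0. Qed.

Lemma cabs_le_sobolev u g x : H1pair a b u g -> a <= x <= b ->
  cabs (u x) <= sobolev_const * (nrm u + nrm g).
Proof.
move=> ug xab; have ba0 : 0 < b - a by rewrite subr_gt0.
have := sobolev hab ug xab; have := nrm_ge0 a b u; have := nrm_ge0 a b g.
move: (nrm u) (nrm g) => A B A0 B0 H.
have c0 : 0 <= (4 + 4 * (b - a) ^+ 2) / (b - a).
  by apply: divr_ge0; [apply: addr_ge0 => //; rewrite pmulr_rge0// sqr_ge0|exact: ltW].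
rewrite -ler_sqr ?nnegrE ?cabs_ge0 ?mulr_ge0 ?sqrtr_ge0 ?addr_ge0//.
rewrite exprMn sqr_sqrtr// mulrAC ler_pdivlMr// mulrC; apply: le_trans H _.
have := mulr_ge0 (sqr_ge0 (b - a)) A0; have := mulr_ge0 A0 B0.
have := mulr_ge0 (sqr_ge0 (b - a)) (sqr_ge0 A).
have := mulr_ge0 (sqr_ge0 (b - a)) (mulr_ge0 A0 B0).
have := sqr_ge0 B.
move: ((b - a) ^+ 2) => L; nra.
Qed.

Lemma cmeas_cubic u : cmeas a b u -> cmeas a b (fun x => cubic (u x)).
Proof.
move=> um; apply: (cmeas_ext (fun x => cubicE (u x))).
by apply: cmeasM; [exact: cmeasM|exact: cmeas_conj].
Qed.

Lemma nrm_cubic_sub_le u v (B : R) : in2 u -> in2 v -> 0 <= B ->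
  (forall x, a < x < b -> cabs (u x) <= B) -> (forall x, a < x < b -> cabs (v x) <= B) ->
  in2 (fun x => cubic (u x) - cubic (v x)) /\
  nrm (fun x => cubic (u x) - cubic (v x)) <= 3 * B ^+ 2 * nrm (fun x => u x - v x).
Proof.
move=> uL2 vL2 B0 uB vB; apply: in_L2_le_pt.
- by rewrite mulr_ge0 ?sqr_ge0.
- exact: in_L2B.
- by apply: cmeasB; apply: cmeas_cubic; exact: in_L2_cmeas.
- by move=> x xab; apply: cubic_lipschitz; [exact: uB|exact: vB].
Qed.

Lemma nrm_cubic_le u (B : R) : in2 u -> 0 <= B ->
  (forall x, a < x < b -> cabs (u x) <= B) ->
  in2 (fun x => cubic (u x)) /\ nrm (fun x => cubic (u x)) <= B ^+ 2 * nrm u.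
Proof.
move=> uL2 B0 uB; apply: in_L2_le_pt => //.
- by rewrite sqr_ge0.
- by apply: cmeas_cubic; exact: in_L2_cmeas.
- by move=> x xab; apply: cabs_cubic_le; exact: uB.
Qed.

Lemma nrm_potential_le (W : R -> R) u (M : R) : 0 <= M ->
  measurable_fun `]a, b[ W -> {ae leb, forall x, a < x < b -> `|W x| <= M} -> in2 u ->
  in2 (fun x => (W x)%:C * u x) /\ nrm (fun x => (W x)%:C * u x) <= M * nrm u.
Proof.
move=> M0 Wm WM uL2; apply: in_L2_le => //.
  by apply: cmeasM; [exact: cmeas_real|exact: in_L2_cmeas].
by apply: aeS WM => x H /H K; rewrite cabsM cabs_real ler_wpM2r ?cabs_ge0.
Qed.

Definition source (beta : R) (W : R -> R) u x : R[i] :=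
  (W x)%:C * u x + beta%:C * cubic (u x).

(** Time increments of the potential and of the solution are small only in L^2; the product is split
    so that each increment is multiplied by a factor bounded in the supremum norm. *)
Lemma source_lipschitz (beta : R) (W W' : R -> R) u v (MV MS : R) : 0 <= MV -> 0 <= MS ->
  measurable_fun `]a, b[ W -> {ae leb, forall x, a < x < b -> `|W x| <= MV} ->
  in2 (fun x => (W' x)%:C) -> in2 (fun x => (W x)%:C) ->
  in2 u -> in2 v ->
  (forall x, a < x < b -> cabs (u x) <= MS) -> (forall x, a < x < b -> cabs (v x) <= MS) ->
  nrm (fun x => source beta W u x - source beta W' v x) <=
  (MV + 3 * `|beta| * MS ^+ 2) * nrm (fun x => u x - v x) +
  MS * nrm (fun x => (W x)%:C - (W' x)%:C).
Proof.
move=> MV0 MS0 Wm WM W'L2 WL2 uL2 vL2 uS vS.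
have uvL2 := in_L2B uL2 vL2.
have [l1 n1] := nrm_potential_le MV0 Wm WM uvL2.
have [l2 n2] : in2 (fun x => ((W x)%:C - (W' x)%:C) * v x) /\
    nrm (fun x => ((W x)%:C - (W' x)%:C) * v x) <= MS * nrm (fun x => (W x)%:C - (W' x)%:C).
  apply: in_L2_le_pt => //; first exact: in_L2B.
    by apply: cmeasM; apply: in_L2_cmeas => //; exact: in_L2B.
  by move=> x xab; rewrite cabsM mulrC ler_wpM2r ?cabs_ge0 ?vS.
have [l3 n3] := nrm_cubic_sub_le uL2 vL2 MS0 uS vS.
have [l4 n4] := in_L2Z beta%:C l3.
have l12 := in_L2D l1 l2.
have n5 := ler_nrmD l12 l4; have n6 := ler_nrmD l1 l2.
rewrite cabs_real in n4.
have n7 := ler_wpM2l (normr_ge0 beta) n3.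
rewrite (_ : (fun x => source _ _ _ _ - _) = (fun x => (W x)%:C * (u x - v x) +
  ((W x)%:C - (W' x)%:C) * v x + beta%:C * (cubic (u x) - cubic (v x)))); last first.
  by apply/funext => x; rewrite /source; ring.
by clear - hab n1 n2 n4 n5 n6 n7; lra.
Qed.

Lemma source_in_L2 (beta : R) (W : R -> R) u (MV MS : R) : 0 <= MV -> 0 <= MS ->
  measurable_fun `]a, b[ W -> {ae leb, forall x, a < x < b -> `|W x| <= MV} ->
  in2 u -> (forall x, a < x < b -> cabs (u x) <= MS) ->
  in2 (source beta W u) /\ nrm (source beta W u) <= (MV + `|beta| * MS ^+ 2) * nrm u.
Proof.
move=> MV0 MS0 Wm WM uL2 uS.
have [l1 n1] := nrm_potential_le MV0 Wm WM uL2.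
have [l3 n3] := nrm_cubic_le uL2 MS0 uS.
have [l4 n4] := in_L2Z beta%:C l3.
split; first exact: in_L2D.
have n5 := ler_nrmD l1 l4; rewrite cabs_real in n4.
have n6 := ler_wpM2l (normr_ge0 beta) n3.
by rewrite /source; clear - hab n1 n4 n5 n6; lra.
Qed.

Lemma fourier_coef_ell u l : fc u l = ((b - a)^-1)%:C * ell a b (em a b (- l)) u.
Proof. exact: fourier_coefE. Qed.

(** Pairing with a mode is L^2-continuous, so it commutes with the time derivative; periodicity
    turns the second weak derivative into multiplication by [- mu l ^+ 2]. *)
Lemma GPE_fourier_ode (beta T : R) (Tmax : \bar R) (V : R -> R -> R) psi0
    (psi : R -> R -> R[i]) m s l :
  (2 <= m)%N -> (T%:E < Tmax)%E -> GPE_solution a b beta V psi0 Tmax psi ->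
  (forall t, 0 <= t <= T -> in_Hper a b m (psi t)) ->
  0 < s < T -> in2 (source beta (V s) (psi s)) ->
  cder (fun r => fc (psi r) l) s
    (- 'i%C * ((mu l ^+ 2)%:C * fc (psi s) l + fc (source beta (V s) (psi s)) l)).
Proof.
move=> m2 TT [_ _ _ eqn] pH sT gL2.
have s0 : 0 < s by lra.
have sTm : (s%:E < Tmax)%E by apply: lt_trans TT; rewrite lte_fin; lra.
have [dpsi [dL2 dlim dae]] := eqn s s0 sTm.
have pL2 r : 0 <= r <= T -> in2 (psi r) by move=> rT; have [[]] := pH r rT.
have D : cder (fun r => ell a b (em a b (- l)) (psi r)) s (ell a b (em a b (- l)) dpsi).
  apply: (@ell_cder R a b psi (em a b (- l)) dpsi s (Num.min s (T - s))) => //.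
  - exact: em_in_L2.
  - by rewrite lt_min s0 subr_gt0; lra.
  - by move=> r; rewrite lt_min !ltr_norml => H; apply: pL2; lra.
  move=> e e0; have : \forall r \near s^', (L2_norm a b
      (fun x => ((psi r x - psi s x) / (r - s)%:C - dpsi x)%R) < e%:E)%E.
    exact: (cvg0_ereal_lt _ dlim e0).
  rewrite /prop_near1 /dnbhs /within /= => /nbhs_ballP[d /= d0 H].
  exists d => // r rs rd; apply: H => //.
  by rewrite /ball /= distrC.
have := cderZ ((b - a)^-1)%:C D.
rewrite -fourier_coef_ell (_ : (fun y => _) = (fun r => fc (psi r) l)); last first.
  by apply/funext => r; rewrite fourier_coef_ell.
congr cder.
have sT' : 0 <= s <= T by lra.
have w2L2 := in_H_wderivn (in_Hper_in_H (pH s sT')) m2.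
have [N2 _] := in_L2Z (-1) w2L2.
have E : {ae leb, forall x, a < x < b ->
    dpsi x = - 'i%C * (-1 * wderivn 2 (psi s) x + source beta (V s) (psi s) x)}.
  apply: aeS dae => x H xab; have {}H := H xab.
  have -> : dpsi x = - 'i%C * ('i%C * dpsi x).
    by rewrite mulrA mulNr -expr2 sqr_i opprK mul1r.
  by rewrite H /source /cubic rmorphM /=; congr (_ * _); ring.
have S := in_L2D N2 gL2; have [S' _] := in_L2Z (- 'i%C) S.
rewrite (ae_eq_fourier_coef l (in_L2_cmeas dL2) (in_L2_cmeas S') E).
rewrite fourier_coefZ// fourier_coefD// fourier_coefZ//.
rewrite (fourier_coef_wderivn hab l (pH s sT') m2) exprMn sqr_i -rmorphXn /=.
by congr (_ * _); ring.
Qed.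

End SolutionRegularity.

Section Cutoff.
Variable N : nat.
Hypotheses (N0 : (0 < N)%N) (eN : ~~ odd N).

(** Products of three modes below this frequency are not aliased, and its
    inverse is still [O(h)]. *)
Definition cutoff_freq : nat := (N./2).-1 %/ 3.

Lemma half_gt0 : (0 < N./2)%N.
Proof.
have NE : N = (N./2 + N./2)%N by rewrite addnn -[LHS]odd_double_half (negbTE eN).
by lia.
Qed.

Lemma cutoff_freq3 : (3 * cutoff_freq < N./2)%N.
Proof. by have := half_gt0; rewrite /cutoff_freq; lia. Qed.

Lemma cutoff_freq_lt : (cutoff_freq < N./2)%N.
Proof. by have := cutoff_freq3; lia. Qed.

End Cutoff.

(** * Low-frequency projection of a periodic Sobolev function *)

Section LowFrequencyProjection.
Context {R : realType}.
Variables (a b : R) (N : nat).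
Hypotheses (hab : a < b) (N0 : (0 < N)%N) (eN : ~~ odd N).
Notation in2 := (in_L2 a b).
Notation nrm := (nrm a b).
Notation tp := (tp a b).
Notation mu := (mu a b).
Notation fc := (fourier_coef a b).
Notation wderivn := (wderivn a b).
Notation interp := (interpolation a b).
Notation grid := (grid a b N).
Notation h := (mesh a b N).

Lemma mu_freq_le (l : 'I_N) : `|mu (freq l)| <= pi / h.
Proof.
have ba0 : 0 < b - a by rewrite subr_gt0.
have h0 := mesh_gt0 hab N0.
have fl : `|(freq l)%:~R| <= N%:R / 2 :> R.
  have NE : N = (N./2 + N./2)%N by rewrite addnn -[LHS]odd_double_half (negbTE eN).
  have lN := ltn_ord l.
  rewrite -intr_norm ler_pdivlMr// (_ : 2 = 2%:~R)// -intrM (_ : N%:R = N%:Z%:~R)// ler_int.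
  by rewrite /freq; lia.
have p0 := pi_ge0 R.
have i0 : 0 <= (b - a)^-1 by rewrite invr_ge0 ltW.
rewrite /Defs.mu !normrM (ger0_norm p0) (ger0_norm (ler0n R 2)) (ger0_norm i0).
rewrite /mesh invf_div mulrA; apply: ler_wpM2r => //.
by have := ler_wpM2l p0 fl; move: (pi : R) => p; lra.
Qed.

(** The largest frequency is [pi / h], and [(h^2 / pi) (pi / h)^2 = pi]. *)
Lemma phase_bound (tau : R) (l : 'I_N) : 0 < tau <= h ^+ 2 / pi ->
  0 <= tau * mu (freq l) ^+ 2 <= pi.
Proof.
move=> /andP[t0 th]; have h0 := mesh_gt0 hab N0; have p0 := pi_gt0 R.
rewrite mulr_ge0 ?sqr_ge0 ?(ltW t0)//=.
have hp : 0 <= pi / h by rewrite divr_ge0 ?pi_ge0// ltW.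
have := mu_freq_le l; rewrite -ler_sqr ?nnegrE ?normr_ge0// real_normK ?num_real// => H.
apply: (@le_trans _ _ (h ^+ 2 / pi * (pi / h) ^+ 2)).
  by apply: ler_pM => //; rewrite ?sqr_ge0 ?(ltW t0).
rewrite le_eqVlt; apply/orP; left; apply/eqP.
move: (pi : R) (h : R) h0 p0 => p y y0 p0; field; lra.
Qed.

Notation K := (cutoff_freq N).

(** From [K + 1 >= N / 6] and [pi >= 2] one gets [2 N / 3] over [b - a], more than the [N / 2]
    required. *)
Lemma mu_cutoff_ge : (2 * h)^-1 <= mu K.+1%:Z.
Proof.
have ba0 : 0 < b - a by rewrite subr_gt0.
have h0 := mesh_gt0 hab N0.
have NE : N = (N./2 + N./2)%N by rewrite addnn -[LHS]odd_double_half (negbTE eN).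
have KN : N%:R <= 6 * K.+1%:R :> R.
  by rewrite -natrM ler_nat; have := half_gt0 N0 eN; rewrite /cutoff_freq; lia.
rewrite /Defs.mu /mesh invfM invf_div mulrA.
apply: ler_wpM2r; first by rewrite invr_ge0 ltW.
have p2 := pi_ge2 R.
apply: (@le_trans _ _ (2 * 2 * (N%:R / 6))).
  by have : 0 <= N%:R :> R by []; lra.
apply: ler_pM.
- by rewrite mulr_ge0.
- by rewrite divr_ge0.
- by move: (pi : R) p2 => p; lra.
by rewrite (_ : K.+1%:Z%:~R = K.+1%:R)//; lra.
Qed.

Lemma expr_mu_cutoff k : (mu K.+1%:Z) ^- k <= (2 * h) ^+ k.
Proof.
have h0 := mesh_gt0 hab N0.
have i0 : 0 < (2 * h)^-1 by rewrite invr_gt0 mulr_gt0.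
rewrite -[2 * h]invrK exprVn; rewrite lef_pV2 ?posrE ?exprn_gt0//; last first.
  exact: lt_le_trans mu_cutoff_ge.
apply: lerXn2r mu_cutoff_ge; rewrite nnegrE; first exact: ltW.
exact: le_trans (ltW i0) mu_cutoff_ge.
Qed.

Definition low_coef (u : R -> R[i]) (l : 'I_N) : R[i] :=
  if (absz (freq l) <= K)%N then fc u (freq l) else 0.
Notation P u := (tp (low_coef u)).
Definition low_proj' (u : R -> R[i]) : R -> R[i] :=
  tp (fun l : 'I_N => 'i%C * (mu (freq l))%:C * low_coef u l).

Lemma H1pair_tp (d : 'I_N -> R[i]) :
  H1pair a b (tp d) (tp (fun l => 'i%C * (mu (freq l))%:C * d l)).
Proof.
split; [exact: ccont_cont_itv (tp_ccont a b d)|exact: tp_in_L2|].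
by apply: cder_weak_derivative => // [x|]; [exact: tp_cder|exact: tp_ccont].
Qed.

Lemma nrm_low_proj_le u : in2 u -> nrm (P u) <= nrm u.
Proof.
move=> uL2; rewrite -[leRHS]mul1r; apply: nrm_trig_proj_le => // l.
by rewrite mul1r /low_coef; case: ifP => _ //; rewrite cabs0 cabs_ge0.
Qed.

Section PeriodicSobolev.
Variables (m : nat) (u : R -> R[i]) (M : R).
Hypotheses (m2 : (2 <= m)%N) (uP : in_Hper a b m u).
Hypothesis uM : forall k, (k <= m)%N -> nrm (wderivn k u) <= M.

Lemma sobolev_bound_ge0 : 0 <= M.
Proof. exact: le_trans (nrm_ge0 _ _ _) (uM (leq0n m)). Qed.

Lemma low_proj_error : nrm (fun x => u x - P u x) <= (2 * h) ^+ m * M.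
Proof.
have [ug _] := in_Hper_pair0 hab uP (ltnW m2).
have H := trig_proj_error hab ug (in_H_wderivn (in_Hper_in_H uP) (leqnn m))
  (fun l => fourier_coef_wderivn hab l uP (leqnn m)) eN (cutoff_freq_lt N0 eN).
apply: le_trans H _; apply: ler_pM; rewrite ?nrm_ge0 ?expr_mu_cutoff ?uM//.
have h0 := mesh_gt0 hab N0.
rewrite invr_ge0 exprn_ge0// (le_trans _ mu_cutoff_ge)// invr_ge0 mulr_ge0// ltW//.
Qed.

(** Projection commutes with differentiation, so this is the tail bound for the first derivative,
    with one power of [h] less. It is applied to the continuous representative [g], as
    [trig_proj_error] requires an [H1pair]. *)
Lemma low_proj'_error :
  nrm (fun x => wderivn 1 u x - low_proj' u x) <= (2 * h) ^+ m.-1 * M /\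
  nrm (low_proj' u) <= M.
Proof.
have m1 : (1 < m)%N by [].
have [g [gg gab gae]] := in_Hper_pair hab uP m1.
have [gc _ _] := gg; have gL2 := cont_itv_in_L2 hab gc.
have L1 := in_H_wderivn (in_Hper_in_H uP) (ltnW m1).
have gfc l : fc g l = 'i%C * (mu l)%:C * fc u l.
  rewrite -(ae_eq_fourier_coef l (in_L2_cmeas L1) (cont_itv_cmeas gc) gae).
  by rewrite (fourier_coef_wderivn hab l uP (ltnW m1)) expr1.
have PE : low_proj' u = P g.
  congr tp; apply/funext => l; rewrite /low_coef gfc.
  by case: ifP => // _; rewrite mulr0.
have wfc l : fc (wderivn m u) l = ('i%C * (mu l)%:C) ^+ m.-1 * fc g l.
  rewrite gfc mulrA -exprSr prednK ?(ltnW m1)//.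
  exact: (fourier_coef_wderivn hab l uP (leqnn m)).
have H := trig_proj_error hab gg (in_H_wderivn (in_Hper_in_H uP) (leqnn m))
  wfc eN (cutoff_freq_lt N0 eN).
have h0 := mesh_gt0 hab N0.
have [gL gn] := in_L2_ae L1 (cont_itv_cmeas gc) (aeS (fun x (E : a < x < b -> _) xab => esym (E xab)) gae).
split; last by rewrite PE; apply: le_trans (nrm_low_proj_le gL2) _; rewrite gn; exact: uM (ltnW m1).
rewrite PE.
have PL2 : in2 (P g) := tp_in_L2 a b _.
have [_ ->] := in_L2_ae (in_L2B gL2 PL2) (in_L2_cmeas (in_L2B L1 PL2))
  (aeS (fun x (E : a < x < b -> _) xab => congr1 (fun y => y - P g x) (E xab)) gae).
apply: le_trans H _; apply: ler_pM; rewrite ?nrm_ge0 ?expr_mu_cutoff ?uM//.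
by rewrite invr_ge0 exprn_ge0// (le_trans _ mu_cutoff_ge)// invr_ge0 mulr_ge0// ltW.
Qed.

Lemma cabs_Hper_le x : a <= x <= b -> cabs (u x) <= 2 * sobolev_const a b * M.
Proof.
move=> xab; have [ug _] := in_Hper_pair0 hab uP (ltnW m2).
apply: le_trans (cabs_le_sobolev hab ug xab) _.
have /= h1 := uM (leq0n m); have /= h2 := uM (ltnW m2).
rewrite [2 * _]mulrC -mulrA; apply: ler_wpM2l; first exact: sobolev_const_ge0.
by rewrite mulr_natl mulr2n lerD.
Qed.

Lemma cabs_low_proj_le x : a <= x <= b -> cabs (P u x) <= 2 * sobolev_const a b * M.
Proof.
move=> xab; apply: le_trans (cabs_le_sobolev hab (H1pair_tp (low_coef u)) xab) _.
have [[uL2 _] _ _] := uP.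
have h1 := le_trans (nrm_low_proj_le uL2) (uM (leq0n m)).
have [_ h2] := low_proj'_error.
rewrite [2 * _]mulrC -mulrA; apply: ler_wpM2l; first exact: sobolev_const_ge0.
by rewrite mulr_natl mulr2n lerD.
Qed.

(** The error is sampled on the grid with the help of its derivative, whose missing power of [h] is
    returned by [grid_sampling]. The factor 2 comes from [2 Q^2 + 2 Q^2 = (2 Q)^2]. *)
Lemma interpolation_low_proj_error :
  nrm (interp (fun j : 'I_N.+1 => u (grid j) - P u (grid j))) <= 2 * ((2 * h) ^+ m * M).
Proof.
have [ug _] := in_Hper_pair0 hab uP (ltnW m2).
have pg := H1pair_tp (low_coef u).
have [uc L1 w1] := ug; have [pc L2 w2] := pg.
have uL2 := cont_itv_in_L2 hab uc; have pL2 := cont_itv_in_L2 hab pc.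
have rg : H1pair a b (fun x => u x - P u x) (fun x => wderivn 1 u x - low_proj' u x).
  split; [exact: cont_itvB|exact: in_L2B|exact: weak_derivativeB].
have := grid_sampling hab N0 rg.
have e0 := low_proj_error; have [e1 _] := low_proj'_error.
have h0 := mesh_gt0 hab N0.
have M0 := sobolev_bound_ge0.
move=> H; rewrite -ler_sqr ?nnegrE ?nrm_ge0//; last first.
  by rewrite !mulr_ge0// exprn_ge0// mulr_ge0// ltW.
rewrite sqr_nrm_interpolation// (_ : \sum_(j < N.+1 | _) _ =
  \sum_(j < N) cabs (u (grid j) - P u (grid j)) ^+ 2); last first.
  have := @sum_grid R N (fun j => (cabs (u (grid j) - P u (grid j)) ^+ 2)%:C).
  by rewrite -!rmorph_sum /= => /(congr1 (@complex.Re R)).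
apply: le_trans H _.
move: e0 e1; set A := nrm _; set B := nrm _ => e0 e1.
have A0 : 0 <= A by exact: nrm_ge0.
have B0 : 0 <= B by exact: nrm_ge0.
have eB : h * B <= (2 * h) ^+ m * M.
  have E : (2 * h) ^+ m = 2 * h * (2 * h) ^+ m.-1 by rewrite -exprS prednK// ltnW.
  have := ler_wpM2l (ltW h0) e1; rewrite E.
  have : 0 <= h * ((2 * h) ^+ m.-1 * M).
    have h20 : 0 <= 2 * h by rewrite mulr_ge0// ltW.
    by apply: mulr_ge0; [exact: ltW|apply: mulr_ge0 => //; exact: exprn_ge0].
  by lra.
move: e0 eB; set Q := _ * M => e0 eB.
have q1 : A ^+ 2 <= Q ^+ 2 by apply: lerXn2r => //; rewrite nnegrE// (le_trans A0).
have q2 : (h * B) ^+ 2 <= Q ^+ 2.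
  have hB0 : 0 <= h * B by apply: mulr_ge0 => //; exact: ltW.
  by apply: lerXn2r => //; rewrite nnegrE// (le_trans hB0).
rewrite -[X in _ + X]mulrA -exprMn exprMn; lra.
Qed.

End PeriodicSobolev.

End LowFrequencyProjection.

(** * Stability and consistency of one step *)

Section OneStep.
Context {R : realType}.
Variables (a b beta : R) (N m : nat) (tau : R).
Notation leb := (@lebesgue_measure R).
Hypotheses (hab : a < b) (N0 : (0 < N)%N) (eN : ~~ odd N) (m2 : (2 <= m)%N).
Notation in2 := (in_L2 a b).
Notation nrm := (nrm a b).
Notation tp := (tp a b).
Notation mu := (mu a b).
Notation fc := (fourier_coef a b).
Notation wderivn := (wderivn a b).
Notation interp := (interpolation a b).
Notation h := (mesh a b N).
Notation grid := (grid a b N).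
Notation P u := (tp (@low_coef R a b N u)).
Hypotheses (h1 : h <= 1) (htau : 0 < tau <= h ^+ 2 / pi).
Local Notation eps := (tau + h ^+ m).
Local Notation theta l := (tau * mu (freq l) ^+ 2).

Lemma tau_gt0 : 0 < tau. Proof. by case/andP: htau. Qed.

Lemma tau_le_sqr_mesh : tau <= h ^+ 2.
Proof.
have /andP[_ H] := htau; apply: le_trans H _.
rewrite ler_pdivrMr ?pi_gt0// ler_peMr ?sqr_ge0//.
by apply: le_trans (pi_ge2 R); rewrite ler1n.
Qed.

Lemma tau_le1 : tau <= 1.
Proof.
have h0 := mesh_gt0 hab N0.
by apply: le_trans tau_le_sqr_mesh _; rewrite exprn_ile1// ltW.
Qed.

Lemma eps_ge0 : 0 <= eps.
Proof.
have h0 := mesh_gt0 hab N0; have t0 := tau_gt0.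
by apply: addr_ge0; [exact: ltW|apply: exprn_ge0; exact: ltW].
Qed.

Lemma eps_le_sqr_mesh : eps <= 2 * h ^+ 2.
Proof.
have h0 := mesh_gt0 hab N0.
have := tau_le_sqr_mesh.
have : h ^+ m <= h ^+ 2 by apply: ler_wiXn2l => //; rewrite ltW.
lra.
Qed.

(** The factor [h^(-1/2)] lost when passing from L^2 to grid values is harmless
    because [eps = O(h^2)]. *)
Lemma cabs_grid_eps_le (v : 'I_N.+1 -> R[i]) (C : R) (j : 'I_N.+1) : 0 <= C ->
  nrm (interp v) <= C * eps -> (j < N)%N -> cabs (v j) <= 2 * C * h.
Proof.
move=> C0 nv jN; have h0 := mesh_gt0 hab N0; have H := cabs_grid_le hab N0 v jN.
have e0 := eps_ge0; have := eps_le_sqr_mesh; move: (eps) e0 nv => e e0 nv ee.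
have n1 : nrm (interp v) <= 2 * C * h ^+ 2.
  by apply: le_trans nv _; rewrite [2 * C]mulrC -mulrA ler_wpM2l.
have C20 : 0 <= 2 * C by rewrite mulr_ge0.
have Ch0 : 0 <= 2 * C * h by apply: mulr_ge0 => //; exact: ltW.
rewrite -ler_sqr ?nnegrE ?cabs_ge0//.
rewrite -(ler_pM2l h0); apply: le_trans H _.
apply: (@le_trans _ _ ((2 * C * h ^+ 2) ^+ 2)).
  apply: lerXn2r => //; rewrite nnegrE ?nrm_ge0//.
  exact: le_trans (nrm_ge0 _ _ _) n1.
rewrite (_ : (2 * C * h ^+ 2) ^+ 2 = h * (2 * C * h) ^+ 2 * h); last by ring.
by apply: ler_piMr => //; apply: mulr_ge0; [exact: ltW|exact: sqr_ge0].
Qed.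

(** Projection onto [X_N] is a contraction and the free propagator is an isometry, so both disappear
    from the estimates of a step. *)
Lemma nrm_phase_le (s : 'I_N -> R) u v : in2 u -> in2 v ->
  nrm (tp (fun l => expi (s l) * (fc u (freq l) - fc v (freq l)))) <=
  nrm (fun x => u x - v x).
Proof.
move=> uL2 vL2; rewrite -[leRHS]mul1r; apply: nrm_trig_proj_le => //.
  exact: in_L2B.
by move=> l; rewrite fourier_coefB// cabsM cabs_expi.
Qed.

Definition half_step (W : R -> R) (v : 'I_N.+1 -> R[i]) (x : R) : R[i] :=
  (1 - 'i%C * (tau * W x)%:C) * interp (fun j => nlphase tau beta (v j)) x.

Lemma interpolation_step (V : R -> R -> R) n (v : 'I_N.+1 -> R[i]) x :
  interp (LTSeFP_step a b beta V tau n v) x =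
  tp (fun l : 'I_N => expi (- theta l) * fc (half_step (V (n%:R * tau)) v) (freq l)) x.
Proof. by rewrite -(interpolation_tp hab N0). Qed.

Lemma interpolation_in_L2 (v : 'I_N.+1 -> R[i]) : in2 (interp v).
Proof. by rewrite interpolationE; exact: tp_in_L2. Qed.

Section Potential.
Variables (W : R -> R) (MV : R).
Hypotheses (MV0 : 0 <= MV) (Wm : measurable_fun `]a, b[ W).
Hypothesis WM : {ae leb, forall x, a < x < b -> `|W x| <= MV}.

Lemma nrm_potential_factor_le u : in2 u ->
  in2 (fun x => (1 - 'i%C * (tau * W x)%:C) * u x) /\
  nrm (fun x => (1 - 'i%C * (tau * W x)%:C) * u x) <= (1 + tau * MV) * nrm u.
Proof.
move=> uL2; have t0 := tau_gt0.
have [l1 n1] := nrm_potential_le MV0 Wm WM uL2.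
have [l2 n2] := in_L2Z (- ('i%C * tau%:C)) l1.
rewrite (_ : (fun x => _) = (fun x => u x + - ('i%C * tau%:C) * ((W x)%:C * u x))).
  split; first exact: in_L2D.
  apply: le_trans (ler_nrmD uL2 l2) _; rewrite mulrDl mul1r lerD2l.
  apply: le_trans n2 _; rewrite cabsN cabsM cabs_i mul1r cabs_real gtr0_norm//.
  by rewrite -mulrA ler_wpM2l// ltW.
by apply/funext => x; rewrite rmorphM /=; ring.
Qed.

Lemma half_step_in_L2 v : in2 (half_step W v).
Proof. by have [] := nrm_potential_factor_le (interpolation_in_L2 (fun j => nlphase tau beta (v j))). Qed.

Lemma step_stability (B : R) (v v' : 'I_N.+1 -> R[i]) : 
  (forall j : 'I_N.+1, (j < N)%N -> cabs (v j) <= B) ->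
  (forall j : 'I_N.+1, (j < N)%N -> cabs (v' j) <= B) ->
  nrm (tp (fun l : 'I_N => expi (- theta l) *
    (fc (half_step W v) (freq l) - fc (half_step W v') (freq l)))) <=
  (1 + tau * (MV + 2 * `|beta| * B ^+ 2 * (1 + MV))) *
    nrm (interp (fun j => v j - v' j)).
Proof.
move=> vB v'B; have t0 := tau_gt0; have t1 := tau_le1.
apply: le_trans (nrm_phase_le _ (half_step_in_L2 v) (half_step_in_L2 v')) _.
have [_] := nrm_potential_factor_le (in_L2B
  (interpolation_in_L2 (fun j => nlphase tau beta (v j)))
  (interpolation_in_L2 (fun j => nlphase tau beta (v' j)))).
rewrite /half_step => H.
under eq_fun do rewrite -mulrBr.
apply: le_trans H _.
pose c := 2 * `|beta| * B ^+ 2.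
have c0 : 0 <= c by apply: mulr_ge0; [apply: mulr_ge0|exact: sqr_ge0].
have n1 : nrm (fun x => interp (fun j => nlphase tau beta (v j)) x -
    interp (fun j => nlphase tau beta (v' j)) x) <=
    (1 + tau * c) * nrm (interp (fun j => v j - v' j)).
  rewrite -(funext (fun x => interpolationB a b _ _ x)).
  apply: (nrm_interpolation_le hab N0).
    by rewrite addr_ge0// mulr_ge0// ltW.
  move=> j jN; have := nlphase_lipschitz beta (ltW t0) (vB j jN) (v'B j jN).
  by rewrite /c !mulrA [2 * tau]mulrC.
have tM0 : 0 <= tau * MV by rewrite mulr_ge0// ltW.
apply: le_trans (ler_wpM2l _ n1) _; first by rewrite addr_ge0.
rewrite mulrA; apply: ler_wpM2r; first exact: nrm_ge0.
rewrite -/c.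
(* Multiplying the factors of potential and nonlinearity leaves a term in [tau^2], absorbed by
   [tau <= 1]. *)
have : tau * (tau * (MV * c)) <= tau * (MV * c).
  apply: ler_piMl => //; apply: mulr_ge0; [exact: ltW|exact: mulr_ge0].
lra.
Qed.

Section Consistency.
Variables (u : R -> R[i]) (M : R).
Hypotheses (uP : in_Hper a b m u).
Hypothesis uM : forall k, (k <= m)%N -> nrm (wderivn k u) <= M.
Notation G := (source beta W u).

Definition sup_bound : R := 2 * sobolev_const a b * M.
Definition source_bound : R := (MV + `|beta| * sup_bound ^+ 2) * M.
(** Room for two truncation errors of size [2^m M h^m] and for the corrector, whose symbol is at
    most 16. *)
Definition corrector_error : R := 2 * 2 ^+ m * M + 16 * source_bound.
(** The second term bounds, for [h <= 1], the grid values of the corrected solution minus the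
    low-frequency projection. *)
Definition grid_bound : R := sup_bound + 2 * corrector_error.

(** The coefficients of the polynomial [W(t)] of the overview. *)
Definition corrected_coef (l : 'I_N) : R[i] :=
  fc u (freq l) + tau%:C * corrector (theta l) * fc G (freq l).
Notation U := (tp corrected_coef).

Let uL2 : in2 u. Proof. by case: uP => -[]. Qed.
Let M0 : 0 <= M. Proof. exact: le_trans (nrm_ge0 _ _ _) (uM (leq0n m)). Qed.

Lemma sup_bound_ge0 : 0 <= sup_bound.
Proof. by rewrite !mulr_ge0// sobolev_const_ge0. Qed.

Lemma source_estimate : in2 G /\ nrm G <= source_bound.
Proof.
have uS x : a < x < b -> cabs (u x) <= sup_bound.
  by move=> /andP[ax xb]; apply: (cabs_Hper_le hab m2 uP uM); rewrite !ltW.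
have [l n] := source_in_L2 beta MV0 sup_bound_ge0 Wm WM uL2 uS.
split=> //; apply: le_trans n _.
apply: ler_wpM2l; last exact: uM (leq0n m).
by rewrite addr_ge0// mulr_ge0// sqr_ge0.
Qed.

Lemma source_bound_ge0 : 0 <= source_bound.
Proof. by have [_] := source_estimate; apply: le_trans; exact: nrm_ge0. Qed.

Lemma corrector_error_ge0 : 0 <= corrector_error.
Proof.
have := source_bound_ge0 => g0.
by rewrite addr_ge0// mulr_ge0// mulr_ge0// exprn_ge0.
Qed.

Lemma low_error_eps : (2 * h) ^+ m * M <= 2 ^+ m * M * eps.
Proof.
have t0 := tau_gt0.
rewrite exprMn mulrAC; apply: ler_wpM2l; first by rewrite mulr_ge0// exprn_ge0.
by rewrite lerDr ltW.
Qed.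

Lemma nrm_corrector_term_le :
  nrm (tp (fun l : 'I_N => tau%:C * corrector (theta l) * fc G (freq l))) <=
  16 * source_bound * tau.
Proof.
have t0 := tau_gt0; have [gL2 gn] := source_estimate.
have k0 : 0 <= 16 * tau by rewrite mulr_ge0// ltW.
rewrite mulrAC; apply: le_trans (ler_wpM2l k0 gn).
apply: nrm_trig_proj_le => // l; rewrite cabsM; apply: ler_wpM2r; first exact: cabs_ge0.
rewrite cabsM cabs_real gtr0_norm// mulrC; apply: ler_wpM2r; first exact: ltW.
exact/cabs_corrector/(phase_bound hab N0 eN _ htau).
Qed.

Lemma corrected_low_distance :
  nrm (fun x => U x - P u x) <= (2 * h) ^+ m * M + 16 * source_bound * tau.
Proof.
have PL2 := tp_in_L2 a b (@low_coef R a b N u).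
have n1 : nrm (tp (fun l : 'I_N => fc u (freq l) - low_coef a b u l)) <= (2 * h) ^+ m * M.
  apply: le_trans (low_proj_error hab N0 eN m2 uP uM); rewrite -[leRHS]mul1r.
  apply: nrm_trig_proj_le => //; first exact: in_L2B.
  by move=> l; rewrite mul1r fourier_coefB// fourier_coef_tp.
rewrite (_ : (fun x => _) = (fun x => tp (fun l : 'I_N => fc u (freq l) - low_coef a b u l) x +
    tp (fun l : 'I_N => tau%:C * corrector (theta l) * fc G (freq l)) x)); last first.
  apply/funext => x; rewrite tpB tpD; congr (tp _ x); apply/funext => l.
  by rewrite /corrected_coef addrAC.
apply: le_trans (ler_nrmD (tp_in_L2 _ _ _) (tp_in_L2 _ _ _)) _.
exact: lerD n1 nrm_corrector_term_le.
Qed.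

Lemma double_low_distance_le :
  2 * ((2 * h) ^+ m * M) + 16 * source_bound * tau <= corrector_error * eps.
Proof.
have h0 := mesh_gt0 hab N0; have le := low_error_eps.
have hm0 : 0 <= h ^+ m by rewrite exprn_ge0// ltW.
have gh := mulr_ge0 source_bound_ge0 hm0.
by rewrite /corrector_error; clear - hab N0 eN m2 h1 htau MV0 Wm WM uP uM uL2 M0 le gh; lra.
Qed.

Lemma corrected_low_error : nrm (fun x => U x - P u x) <= corrector_error * eps.
Proof.
have h0 := mesh_gt0 hab N0; have n1 := corrected_low_distance.
have n2 := double_low_distance_le.
have q0 : 0 <= (2 * h) ^+ m * M by rewrite mulr_ge0// exprn_ge0// mulr_ge0// ltW.
by clear - hab N0 eN m2 h1 htau MV0 Wm WM uP uM uL2 M0 n1 n2 q0; lra.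
Qed.

Lemma corrected_error : nrm (fun x => u x - U x) <= corrector_error * eps.
Proof.
have n1 := ler_nrm_split uL2 (tp_in_L2 a b (@low_coef R a b N u)) (tp_in_L2 a b corrected_coef).
have n2 := low_proj_error hab N0 eN m2 uP uM; have n3 := corrected_low_distance.
have n4 := double_low_distance_le; rewrite nrmBC in n3.
by clear - hab N0 eN m2 h1 htau MV0 Wm WM uP uM uL2 M0 n1 n2 n3 n4; lra.
Qed.

Lemma nrm_corrected_le : nrm U <= M + 16 * source_bound.
Proof.
have t0 := tau_gt0; have t1 := tau_le1.
have n1 : nrm (tp (fun l : 'I_N => fc u (freq l))) <= M.
  apply: le_trans (uM (leq0n m)); rewrite -[leRHS]mul1r.
  by apply: nrm_trig_proj_le => // l; rewrite mul1r.
have n2 := nrm_corrector_term_le; have g0 := source_bound_ge0.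
rewrite (_ : U = (fun x => tp (fun l : 'I_N => fc u (freq l)) x +
    tp (fun l : 'I_N => tau%:C * corrector (theta l) * fc G (freq l)) x)); last first.
  by apply/funext => x; rewrite tpD.
apply: le_trans (ler_nrmD (tp_in_L2 _ _ _) (tp_in_L2 _ _ _)) _.
apply: lerD => //; apply: le_trans n2 _; rewrite ler_piMr// mulr_ge0//.
Qed.

Lemma cabs_corrected_grid_le (j : 'I_N.+1) : (j < N)%N -> cabs (U (grid j)) <= grid_bound.
Proof.
move=> jN; have h0 := mesh_gt0 hab N0.
have := corrected_low_error; rewrite (funext (fun x => tpB _ _ _ _ x)).
rewrite -(funext (fun x => interpolation_tp hab N0 _ x)).
move=> /(fun H => @cabs_grid_eps_le _ _ j corrector_error_ge0 H jN); rewrite -tpB => c1.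
have gj := grid_itv hab N0 (ltnW jN).
have c2 := cabs_low_proj_le hab N0 eN m2 uP uM gj.
have := cabsD (U (grid j) - P u (grid j)) (P u (grid j)); rewrite subrK.
have : 2 * corrector_error * h <= 2 * corrector_error.
  by rewrite ler_piMr// mulr_ge0// corrector_error_ge0.
by rewrite /grid_bound /sup_bound; lra.
Qed.

(** In order: Taylor remainder of the nonlinear phase, cubic term interpolated from the grid, and
    potential acting on [z - u], where [z] is the interpolant after the phase. *)
Definition consistency_error : R :=
  2 * beta ^+ 2 * grid_bound ^+ 4 * (M + 16 * source_bound) +
  6 * `|beta| * grid_bound ^+ 2 * corrector_error +
  MV * (`|beta| * grid_bound ^+ 2 * (M + 16 * source_bound) + corrector_error).

(** After removal of the isometric propagator, the half step applied to [U] is compared with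
    [U - i tau G]. Both are first-order expansions in [tau]; the difference of their first-order
    terms is [O(eps)]. *)
Lemma step_consistency :
  nrm (tp (fun l : 'I_N => expi (- theta l) *
    ((corrected_coef l - 'i%C * tau%:C * fc G (freq l)) -
     fc (half_step W (fun j => U (grid j))) (freq l)))) <= consistency_error * tau * eps.
Proof.
have t0 := tau_gt0; have h0 := mesh_gt0 hab N0; have e0 := eps_ge0.
have te : tau <= eps by rewrite lerDl exprn_ge0// ltW.
have [gL2 _] := source_estimate; have g0 := source_bound_ge0.
have ce0 := corrector_error_ge0; have S0 := sup_bound_ge0.
pose v (j : 'I_N.+1) := U (grid j).
have UE x : interp v x = U x by exact: interpolation_tp.
have UL2 : in2 U by exact: tp_in_L2.
have PL2 : in2 (P u) by exact: tp_in_L2.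
pose B := grid_bound; have B0 : 0 <= B by rewrite addr_ge0// mulr_ge0.
have [B20 B40 b20 b0] := And4 (sqr_ge0 B) (exprn_ge0 4 B0) (sqr_ge0 beta) (normr_ge0 beta).
have t20 := sqr_ge0 tau; have t0' := ltW t0.
have SB : sup_bound <= B by rewrite lerDl mulr_ge0.
have vB (j : 'I_N.+1) : (j < N)%N -> cabs (v j) <= B := @cabs_corrected_grid_le j.
have [rL2 _] := in_L2Z ('i%C * tau%:C) gL2.
have := nrm_phase_le (fun l => - theta l) (in_L2B UL2 rL2) (half_step_in_L2 v).
rewrite (_ : (fun l : 'I_N => _) = (fun l : 'I_N => expi (- theta l) *
    (corrected_coef l - 'i%C * tau%:C * fc G (freq l) - fc (half_step W v) (freq l)))); last first.
  apply/funext => l; rewrite fourier_coefB// fourier_coef_tp// fourier_coefZ//.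
move=> H; apply: le_trans H _.
pose z := interp (fun j => nlphase tau beta (v j)).
pose A := interp (fun j => nlphase tau beta (v j) -
  (v j - 'i%C * (tau * beta)%:C * cubic (v j))).
pose Q := interp (fun j : 'I_N.+1 => cubic (v j) - cubic (P u (grid j))).
have zL2 : in2 z := interpolation_in_L2 _.
have AL2 : in2 A := interpolation_in_L2 _.
have QL2 : in2 Q := interpolation_in_L2 _.
have uS x : a < x < b -> cabs (u x) <= B.
  move=> /andP[ax xb]; apply: le_trans SB.
  by apply: (cabs_Hper_le hab m2 uP uM); rewrite !ltW.
have PS x : a <= x <= b -> cabs (P u x) <= B.
  by move=> xab; apply: le_trans SB; exact: (cabs_low_proj_le hab N0 eN m2 uP uM).
have PS' x : a < x < b -> cabs (P u x) <= B.
  by move=> /andP[ax xb]; apply: PS; rewrite !ltW.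
(* Here aliasing is avoided: the low-frequency cube serves as the intermediate point between the
   interpolated cube of [U] and the cube of [u]. *)
have Pgrid x : interp (fun j : 'I_N.+1 => cubic (P u (grid j))) x = cubic (P u x).
  have lK (l : 'I_N) : ~~ (absz (freq l) <= cutoff_freq N)%N -> low_coef a b u l = 0.
    by move=> Kl; rewrite /low_coef (negbTE Kl).
  exact: (interpolated_cubic hab N0 eN (cutoff_freq3 N0 eN) lK).
have nU := nrm_corrected_le.
pose MU := M + 16 * source_bound.
have MU0 : 0 <= MU by rewrite addr_ge0// mulr_ge0.
have nA : nrm A <= 2 * tau ^+ 2 * beta ^+ 2 * B ^+ 4 * MU.
  have k0 : 0 <= 2 * tau ^+ 2 * beta ^+ 2 * B ^+ 4.
    by do 3!apply: mulr_ge0 => //.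
  apply: le_trans (ler_wpM2l k0 nU); rewrite -(funext UE).
  apply: (nrm_interpolation_le hab N0) => // j jN.
  by apply: nlphase_taylor; [exact: ltW|exact: vB].
have ePU := low_proj_error hab N0 eN m2 uP uM.
have e1 : 2 ^+ m * M * eps <= corrector_error * eps.
  apply: ler_wpM2r => //; rewrite /corrector_error.
  have : 0 <= 2 ^+ m * M by rewrite mulr_ge0// exprn_ge0.
  by move: (2 ^+ m) => q; lra.
have nQ : nrm Q <= 3 * B ^+ 2 * (corrector_error * eps).
  have k0 : 0 <= 3 * B ^+ 2 by rewrite mulr_ge0// sqr_ge0.
  apply: le_trans (ler_wpM2l k0 corrected_low_error).
  have -> : (fun x => U x - P u x) = interp (fun j : 'I_N.+1 => v j - P u (grid j)).
    by apply/funext => x; rewrite interpolationB UE interpolation_tp.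
  apply: (nrm_interpolation_le hab N0) => // j jN.
  by apply: cubic_lipschitz; [exact: vB|exact: PS (grid_itv hab N0 (ltnW jN))].
have [cL2 nc] := nrm_cubic_sub_le PL2 uL2 B0 PS' uS.
have {}nc : nrm (fun x => cubic (P u x) - cubic (u x)) <= 3 * B ^+ 2 * (corrector_error * eps).
  have k0 : 0 <= 3 * B ^+ 2 by rewrite mulr_ge0// sqr_ge0.
  apply: le_trans nc _; apply: ler_wpM2l => //; rewrite nrmBC.
  exact: le_trans ePU (le_trans low_error_eps e1).
have nz : nrm (fun x => z x - U x) <= tau * `|beta| * B ^+ 2 * MU.
  have k0 : 0 <= tau * `|beta| * B ^+ 2 by do 2!apply: mulr_ge0 => //.
  apply: le_trans (ler_wpM2l k0 nU); rewrite -(funext UE) /z.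
  rewrite -(funext (fun x => interpolationB a b _ _ x)).
  apply: (nrm_interpolation_le hab N0) => // j jN.
  by apply: nlphase_sub; [exact: ltW|exact: vB].
have nzu : nrm (fun x => z x - u x) <= tau * `|beta| * B ^+ 2 * MU + corrector_error * eps.
  apply: le_trans (ler_nrm_split zL2 UL2 uL2) _; apply: lerD => //.
  by rewrite nrmBC; exact: corrected_error.
have [pL2 np] := nrm_potential_le MV0 Wm WM (in_L2B zL2 uL2).
have [L1 n1] := in_L2Z ('i%C * (tau * beta)%:C) (in_L2D QL2 cL2).
have [L2 n2] := in_L2Z ('i%C * tau%:C) pL2.
rewrite (_ : (fun x => _) = (fun x => 'i%C * (tau * beta)%:C * (Q x + (cubic (P u x) - cubic (u x))) +
    'i%C * tau%:C * ((W x)%:C * (z x - u x)) - A x)); last first.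
  apply/funext => x; rewrite /half_step -/z /A /Q !interpolationB interpolationZ UE Pgrid -/z.
  by rewrite /source !rmorphM /=; ring.
apply: le_trans (ler_nrmB (in_L2D L1 L2) AL2) _.
have n3 := ler_nrmD L1 L2; have n4 := ler_nrmD QL2 cL2.
rewrite cabsM cabs_i mul1r cabs_real normrM gtr0_norm// in n1.
rewrite cabsM cabs_i mul1r cabs_real gtr0_norm// in n2.
have tb0 : 0 <= tau * `|beta| by rewrite mulr_ge0// ltW.
have {}n1 := le_trans n1 (ler_wpM2l tb0 (le_trans n4 (lerD nQ nc))).
have {}n2 := le_trans n2 (ler_wpM2l (ltW t0) (le_trans np (ler_wpM2l MV0 nzu))).
apply: le_trans (lerD (le_trans n3 (lerD n1 n2)) nA) _.
rewrite /consistency_error -/B -/MU.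
(* Terms of order [tau^2] are weakened to [tau * eps] to match the form of the bound. *)
have q1 : tau * (2 * beta ^+ 2 * B ^+ 4 * MU) * tau <= tau * (2 * beta ^+ 2 * B ^+ 4 * MU) * eps.
  by apply: ler_wpM2l => //; do 5?apply: mulr_ge0 => //.
have q2 : tau * (MV * (`|beta| * B ^+ 2 * MU)) * tau <= tau * (MV * (`|beta| * B ^+ 2 * MU)) * eps.
  by apply: ler_wpM2l => //; do 5?apply: mulr_ge0 => //.
by clear - hab N0 eN m2 h1 htau MV0 Wm WM uP uM uL2 M0 q1 q2; lra.
Qed.

End Consistency.
End Potential.
End OneStep.

(** * Error propagation *)

(** By uniqueness, any weak derivative [g] can replace the representative chosen by [wderiv]. *)
Lemma H1_norm_le {R : realType} (a b : R) (u g : R -> R[i]) :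
  in_L2 a b u -> in_L2 a b g -> weak_derivative a b u g ->
  (H_norm a b 1 u <= (nrm a b u + nrm a b g)%:E)%E.
Proof.
move=> uL2 gL2 ug.
have uH : in_H a b 1 u by split=> // -[] // _; exists g.
have W := in_H_weak_derivative uH (ltnSn 0).
have wL2 := in_H_wderivn uH (leqnn 1).
have [_ E] := in_L2_ae gL2 (in_L2_cmeas wL2) (weak_derivative_unique uL2 wL2 gL2 W ug).
rewrite H_normE// lee_fin !big_ord_recr big_ord0 /= add0r -[wderiv a b u]/(wderivn a b 1 u) E.
have A0 := nrm_ge0 a b u; have B0 := nrm_ge0 a b g.
move: (nrm a b u) (nrm a b g) A0 B0 => A B A0 B0.
rewrite -ler_sqr ?nnegrE ?sqrtr_ge0 ?addr_ge0// sqr_sqrtr ?addr_ge0 ?sqr_ge0//.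
by have := mulr_ge0 A0 B0; rewrite sqrrD -mulr_natr; lra.
Qed.

Section Convergence.
Context {R : realType}.
Variables (a b beta T : R) (V : R -> R -> R) (psi : R -> R -> R[i]) (m : nat).
Variables (MV M Lp Lg : R).
Hypotheses (hab : a < b) (m2 : (2 <= m)%N).
Notation leb := (@lebesgue_measure R).
Notation in2 := (in_L2 a b).
Notation nrm := (nrm a b).
Notation tp := (tp a b).
Notation mu := (mu a b).
Notation fc := (fourier_coef a b).
Notation interp := (interpolation a b).
Notation wderivn := (wderivn a b).
Notation g t := (source beta (V t) (psi t)).
Hypotheses (MV0 : 0 <= MV) (Lp0 : 0 <= Lp) (Lg0 : 0 <= Lg).
Hypothesis Vm : forall t, 0 <= t <= T -> measurable_fun `]a, b[ (V t).
Hypothesis VM : forall t, 0 <= t <= T -> {ae leb, forall x, a < x < b -> `|V t x| <= MV}.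
Hypothesis pP : forall t, 0 <= t <= T -> in_Hper a b m (psi t).
Hypothesis pM : forall t, 0 <= t <= T ->
  forall k, (k <= m)%N -> nrm (wderivn k (psi t)) <= M.
Hypothesis pLip : forall s r, 0 <= s <= T -> 0 <= r <= T ->
  nrm (fun x => psi s x - psi r x) <= Lp * `|s - r|.
Hypothesis gLip : forall s r, 0 <= s <= T -> 0 <= r <= T ->
  nrm (fun x => g s x - g r x) <= Lg * `|s - r|.
Hypothesis ode : forall s l, 0 < s < T ->
  cder (fun r => fc (psi r) l) s (- 'i%C * ((mu l ^+ 2)%:C * fc (psi s) l + fc (g s) l)).

Let ce := corrector_error a b beta m MV M.
(** The margin 1 accommodates the grid error of the numerical solution, kept below 1 by the later
    hypothesis [hC]. *)
Let B := grid_bound a b beta m MV M + 1.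
(** 17 = 1 + 16: freezing the source over one step, and the change of the corrector term over that
    step. *)
Definition local_error : R := 17 * Lg + consistency_error a b beta m MV M.
Definition growth : R := MV + 2 * `|beta| * B ^+ 2 * (1 + MV).
Definition global_error : R := (2 * ce + T * local_error) * expR (T * growth).

Let pL2 t : 0 <= t <= T -> in2 (psi t).
Proof. by move=> tT; have [[]] := pP tT. Qed.

Let gL2 t : 0 <= t <= T -> in2 (g t).
Proof. by move=> tT; have [] := source_estimate beta hab m2 MV0 (Vm tT) (VM tT) (pP tT) (pM tT). Qed.

Section Discretization.
Variables (N : nat) (tau : R) (psi0 : R -> R[i]).
Hypotheses (N0 : (0 < N)%N) (eN : ~~ odd N).
Notation h := (mesh a b N).
Notation grid := (grid a b N).
Hypotheses (h1 : h <= 1) (htau : 0 < tau <= h ^+ 2 / pi).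
Hypothesis hC : 2 * global_error * h <= 1.
Hypothesis initial : forall x, a <= x <= b -> psi 0 x = psi0 x.
Local Notation eps := (tau + h ^+ m).
Local Notation theta l := (tau * mu (freq l) ^+ 2).
Notation w t := (@corrected_coef R a b beta N tau (V t) (psi t)).
Notation Psi n := (LTSeFP a b beta V psi0 tau n : 'I_N.+1 -> R[i]).

(** The telescoping: by [corrector_identity] the Duhamel defect cancels against the corrector at
    time [t] before and after propagation. What remains is the corrector applied to
    [g(t + tau) - g(t)], of size [tau^2]. *)
Lemma corrected_step t : 0 <= t -> t + tau <= T ->
  nrm (tp (fun l : 'I_N => w (t + tau) l -
    expi (- theta l) * (w t l - 'i%C * tau%:C * fc (g t) (freq l)))) <= 17 * Lg * tau ^+ 2.
Proof.
move=> t0 tT; have tau0 := tau_gt0 htau.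
have tT1 : 0 <= t <= T by have := tau0; lra.
have tT2 : 0 <= t + tau <= T by have := tau0; lra.
have n1 := frozen_source_error hab N Lp0 Lg0 pL2 gL2 pLip gLip ode t0 tau0 tT.
have k0 : 0 <= 16 * tau by rewrite mulr_ge0// ltW.
have n2 : nrm (tp (fun l : 'I_N => tau%:C * corrector (theta l) *
    (fc (g (t + tau)) (freq l) - fc (g t) (freq l)))) <= 16 * Lg * tau ^+ 2.
  apply: (@le_trans _ _ (16 * tau * nrm (fun x => g (t + tau) x - g t x))).
    apply: nrm_trig_proj_le => //; first exact: (in_L2B (gL2 tT2) (gL2 tT1)).
    move=> l; rewrite fourier_coefB//; [|exact: gL2|exact: gL2].
    rewrite cabsM; apply: ler_wpM2r; first exact: cabs_ge0.
    rewrite cabsM cabs_real gtr0_norm// mulrC; apply: ler_wpM2r; first exact: ltW.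
    exact/cabs_corrector/(phase_bound hab N0 eN _ htau).
  have := ler_wpM2l k0 (gLip tT2 tT1).
  rewrite addrAC subrr add0r gtr0_norm//.
  by rewrite (_ : 16 * tau * (Lg * tau) = 16 * Lg * tau ^+ 2)//; ring.
have := ler_nrmD (tp_in_L2 a b _) (tp_in_L2 a b _) => H.
have {}H := le_trans (H _ _ _ _) (lerD n1 n2).
move: H; rewrite (funext (fun x => tpD _ _ _ _ x)).
rewrite (_ : (fun l : 'I_N => _ + _) = (fun l : 'I_N => w (t + tau) l -
    expi (- theta l) * (w t l - 'i%C * tau%:C * fc (g t) (freq l)))); last first.
  apply/funext => l; rewrite /corrected_coef.
  have /andP[_ thpi] := phase_bound hab N0 eN l htau.
  have I := corrector_identity tau0 (sqr_ge0 (mu (freq l))) thpi.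
  have {}I : expi (- theta l) * duhamel (mu (freq l) ^+ 2) tau =
      tau%:C * corrector (theta l) * (1 - expi (- theta l)) +
      'i%C * tau%:C * expi (- theta l) by rewrite I subrK.
  have K (p q e t' c y y' : R[i]) : p - e * q + (c * (1 - e) + t' * e) * y + c * (y' - y) =
    p + c * y' - e * (q + c * y - t' * y) by ring.
  by rewrite /= I; exact: K.
by move=> H; rewrite (_ : 17 * Lg * _ = Lg * tau ^+ 2 + 16 * Lg * tau ^+ 2)//; ring.
Qed.

Lemma corrector_error_ge t : 0 <= t <= T -> 0 <= ce /\ 2 * (2 ^+ m * M) <= ce.
Proof.
move=> tT; split.
  exact: (corrector_error_ge0 beta hab m2 MV0 (Vm tT) (VM tT) (pP tT) (pM tT)).
rewrite /ce /corrector_error mulrA lerDl mulr_ge0//.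
exact: (source_bound_ge0 beta hab m2 MV0 (Vm tT) (VM tT) (pP tT) (pM tT)).
Qed.

Lemma corrected_interpolation t (v : 'I_N.+1 -> R[i]) x :
  interp (fun j : 'I_N.+1 => tp (w t) (grid j) - v j) x = tp (w t) x - interp v x.
Proof. by rewrite interpolationB (interpolation_tp hab N0). Qed.

(** The data are sampled, not projected; both sides are compared with the low-frequency projection
    of [psi 0], and each distance is at most [ce * eps]. *)
Lemma initial_error : 0 <= T ->
  nrm (interp (fun j : 'I_N.+1 => tp (w 0) (grid j) - psi0 (grid j))) <= 2 * ce * eps.
Proof.
move=> T_ge0; have tT : 0 <= (0 : R) <= T by rewrite lexx.
pose p := tp (@low_coef R a b N (psi 0)).
have [c0 c1] := corrector_error_ge tT; have e0 := eps_ge0 m hab N0 htau.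
have n1 := corrected_low_error beta hab N0 eN m2 htau MV0 (Vm tT) (VM tT) (pP tT) (pM tT).
have n2 := interpolation_low_proj_error hab N0 eN m2 (pP tT) (pM tT).
have n3 := low_error_eps htau (pM tT).
have n4 := ler_wpM2r e0 c1.
have pL : in2 p := tp_in_L2 a b _.
rewrite (_ : interp _ = (fun x => (tp (w 0) x - p x) -
    interp (fun j : 'I_N.+1 => psi 0 (grid j) - p (grid j)) x)); last first.
  apply/funext => x; rewrite corrected_interpolation interpolationB (interpolation_tp hab N0).
  rewrite (@eq_interpolation _ _ _ _ _ (fun j : 'I_N.+1 => psi 0 (grid j))).
    by rewrite opprB addrA subrK.
  by move=> j jN; rewrite initial// (grid_itv hab N0 (ltnW jN)).
apply: le_trans (ler_nrmB (in_L2B (tp_in_L2 a b _) pL) (interpolation_in_L2 a b _)) _.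
move: n1 n2 n3 n4; rewrite -/ce -/p; move: (2 ^+ m * M) (eps) => X e.
move: ((2 * h) ^+ m * M) => Y; lra.
Qed.

Lemma local_error_ge0 t : 0 <= t <= T -> 0 <= local_error.
Proof.
move=> tT; have s0 := source_bound_ge0 beta hab m2 MV0 (Vm tT) (VM tT) (pP tT) (pM tT).
have M0 : 0 <= M := le_trans (nrm_ge0 _ _ _) (pM tT (leq0n m)).
have [c0 _] := corrector_error_ge tT.
have S0 : 0 <= M + 16 * source_bound a b beta MV M by rewrite addr_ge0// mulr_ge0.
have [b2 g2 g4] := And3 (sqr_ge0 beta) (sqr_ge0 (grid_bound a b beta m MV M))
  (sqr_ge0 (grid_bound a b beta m MV M ^+ 2)).
rewrite -exprM in g4.
rewrite /local_error /consistency_error -/ce.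
by repeat first [done | apply: addr_ge0 | apply: mulr_ge0].
Qed.

Lemma growth_ge0 : 0 <= growth.
Proof. by rewrite /growth addr_ge0// mulr_ge0 ?addr_ge0// mulr_ge0 ?sqr_ge0// mulr_ge0. Qed.

Lemma gronwall_bound n : n%:R * tau <= T ->
  (2 * ce + n%:R * tau * local_error) * (1 + tau * growth) ^+ n <= global_error.
Proof.
move=> nT; have t0 := tau_gt0 htau; have nt0 : 0 <= n%:R * tau by rewrite mulr_ge0// ltW.
have tT : 0 <= n%:R * tau <= T by rewrite nt0.
have [c0 _] := corrector_error_ge tT; have l0 := local_error_ge0 tT; have g0 := growth_ge0.
apply: ler_pM.
- by rewrite addr_ge0// mulr_ge0.
- by rewrite exprn_ge0// addr_ge0// mulr_ge0// ltW.
- by rewrite lerD2l ler_wpM2r.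
apply: (@le_trans _ _ (expR (n%:R * (tau * growth)))).
  rewrite expRM_natl; apply: lerXn2r; rewrite ?nnegrE ?expR_ge0 ?expR_ge1Dx//.
  by rewrite addr_ge0// mulr_ge0// ltW.
by rewrite ler_expR mulrA ler_wpM2r.
Qed.

(** Error split into the step of the corrected solution, its consistency with the scheme, and the
    stability of the scheme. *)
Lemma scheme_step n (E : R) : n.+1%:R * tau <= T ->
  (forall j : 'I_N.+1, (j < N)%N -> cabs (Psi n j) <= B) ->
  nrm (interp (fun j : 'I_N.+1 => tp (w (n%:R * tau)) (grid j) - Psi n j)) <= E ->
  nrm (interp (fun j : 'I_N.+1 => tp (w (n.+1%:R * tau)) (grid j) - Psi n.+1 j)) <=
  local_error * tau * eps + (1 + tau * growth) * E.
Proof.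
move=> nT PB nE; have t0 := tau_gt0 htau; have h0 := mesh_gt0 hab N0.
set t := n%:R * tau in nE *.
have tE : n.+1%:R * tau = t + tau by rewrite -natr1 mulrDl mul1r.
rewrite tE in nT *; have tge0 : 0 <= t by rewrite mulr_ge0// ltW.
have tT : 0 <= t <= T by have := t0; lra.
have UB (j : 'I_N.+1) : (j < N)%N -> cabs (tp (w t) (grid j)) <= B.
  move=> jN; have := cabs_corrected_grid_le beta hab N0 eN m2 h1 htau MV0 (Vm tT) (VM tT)
    (pP tT) (pM tT) jN; rewrite /B; lra.
have n1 := corrected_step tge0 nT.
have n2 := step_consistency beta hab N0 eN m2 h1 htau MV0 (Vm tT) (VM tT) (pP tT) (pM tT).
have n3 := step_stability beta hab N0 h1 htau MV0 (Vm tT) (VM tT) UB PB.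
have g0 : 0 <= 1 + tau * growth by rewrite addr_ge0// mulr_ge0 ?growth_ge0// ltW.
have {}n3 := le_trans n3 (ler_wpM2l g0 nE).
have e0 : tau <= eps by rewrite lerDl exprn_ge0// ltW.
have H := le_trans (ler_nrmD (tp_in_L2 a b _) (tp_in_L2 a b _)) (lerD n1 n2).
have {}H := le_trans (ler_nrmD (in_L2D (tp_in_L2 a b _) (tp_in_L2 a b _)) (tp_in_L2 a b _)) (lerD H n3).
rewrite (_ : interp _ = (fun x =>
    tp (fun l : 'I_N => w (t + tau) l -
      expi (- theta l) * (w t l - 'i%C * tau%:C * fc (g t) (freq l))) x +
    tp (fun l : 'I_N => expi (- theta l) * (w t l - 'i%C * tau%:C * fc (g t) (freq l) -
      fc (half_step a b beta tau (V t) (fun j : 'I_N.+1 => tp (w t) (grid j))) (freq l))) x +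
    tp (fun l : 'I_N => expi (- theta l) *
      (fc (half_step a b beta tau (V t) (fun j : 'I_N.+1 => tp (w t) (grid j))) (freq l) -
       fc (half_step a b beta tau (V t) (Psi n)) (freq l))) x)); last first.
  apply/funext => x; rewrite corrected_interpolation (interpolation_step beta tau hab N0).
  have K (A e y z z' : R[i]) : A - e * z' = A - e * y + e * (y - z) + e * (z - z') by ring.
  by rewrite tpB !tpD; congr (tp _ x); apply/funext => l; exact: K.
apply: le_trans H _.
rewrite -/growth lerD2r /local_error; move: (17 : R) (ler0n R 17) => k k0.
rewrite !mulrDl lerD2r expr2 mulrA; apply: ler_wpM2l => //.
by apply: mulr_ge0; [exact: mulr_ge0|exact: ltW].
Qed.

(** A bootstrap: stability needs grid bounds on the numerical solution, and these follow from the
    error bound just established for the same [n]. *)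
Lemma scheme_error n : n%:R * tau <= T ->
  nrm (interp (fun j : 'I_N.+1 => tp (w (n%:R * tau)) (grid j) - Psi n j)) <=
  (2 * ce + n%:R * tau * local_error) * (1 + tau * growth) ^+ n * eps.
Proof.
have t0 := tau_gt0 htau; have e0 := eps_ge0 m hab N0 htau; have g0 := growth_ge0.
elim: n => [|n IH] nT.
  rewrite mul0r in nT *; rewrite mul0r addr0 expr0 mulr1; exact: initial_error.
have nT' : n%:R * tau <= T by apply: le_trans nT; rewrite ler_wpM2r ?ler_nat// ltW.
have {}IH := IH nT'.
have tT : 0 <= n%:R * tau <= T by rewrite nT' mulr_ge0// ltW.
have GE := gronwall_bound nT'.
have [c0 _] := corrector_error_ge tT; have l0 := local_error_ge0 tT.
have PB (j : 'I_N.+1) : (j < N)%N -> cabs (Psi n j) <= B.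
  move=> jN; have G0 : 0 <= global_error.
    apply: le_trans GE; rewrite mulr_ge0//.
      by rewrite addr_ge0// mulr_ge0// mulr_ge0// ltW.
    by rewrite exprn_ge0// addr_ge0// mulr_ge0// ltW.
  have k := cabs_grid_eps_le hab N0 m2 h1 htau G0
    (le_trans IH (ler_wpM2r e0 GE)) jN.
  have k2 := cabs_corrected_grid_le beta hab N0 eN m2 h1 htau MV0 (Vm tT) (VM tT)
    (pP tT) (pM tT) jN.
  have := cabsB (tp (w (n%:R * tau)) (grid j)) (tp (w (n%:R * tau)) (grid j) - Psi n j).
  rewrite opprB addrC subrK /B; move: k k2 hC; lra.
apply: le_trans (scheme_step nT PB IH) _.
(* The new local error is multiplied by this power so as to fit the closed form of the bound. *)
have q1 : 1 <= (1 + tau * growth) ^+ n.+1.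
  by apply: exprn_ege1; rewrite lerDl mulr_ge0// ltW.
have q2 := ler_wpM2l (mulr_ge0 (mulr_ge0 l0 (ltW t0)) e0) q1.
rewrite mulr1 in q2.
rewrite (_ : (1 + tau * growth) * _ = (2 * ce + n%:R * tau * local_error) *
  (1 + tau * growth) ^+ n.+1 * eps); last by rewrite [in RHS]exprS; ring.
rewrite -natr1; move: q2; move: ((1 + _) ^+ n.+1) (eps) => G e; lra.
Qed.

Lemma inverse_inequality (d : 'I_N -> R[i]) :
  nrm (tp (fun l => 'i%C * (mu (freq l))%:C * d l)) <= pi / h * nrm (tp d).
Proof.
have h0 := mesh_gt0 hab N0; apply: nrm_trig_proj_le => //.
- by rewrite divr_ge0 ?pi_ge0// ltW.
- exact: tp_in_L2.
move=> l; rewrite fourier_coef_tp// !cabsM cabs_i mul1r cabs_real.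
by apply: ler_wpM2r; [exact: cabs_ge0|exact: mu_freq_le].
Qed.

Lemma corrected_scheme_error n : n%:R * tau <= T ->
  nrm (fun x => tp (w (n%:R * tau)) x - interp (Psi n) x) <= global_error * eps.
Proof.
move=> nT; rewrite -(funext (corrected_interpolation _ _)).
apply: le_trans (scheme_error nT) _; apply: ler_wpM2r; last exact: gronwall_bound.
exact: (eps_ge0 m hab N0 htau).
Qed.

Lemma L2_error n : n%:R * tau <= T ->
  nrm (fun x => psi (n%:R * tau) x - interp (Psi n) x) <= (ce + global_error) * eps.
Proof.
move=> nT; have t0 := tau_gt0 htau.
have tT : 0 <= n%:R * tau <= T by rewrite nT mulr_ge0// ltW.
apply: le_trans (ler_nrm_split (pL2 tT) (tp_in_L2 a b (w (n%:R * tau))) (interpolation_in_L2 a b _)) _.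
rewrite mulrDl; apply: lerD; last exact: corrected_scheme_error.
exact: (corrected_error beta hab N0 eN m2 htau MV0 (Vm tT) (VM tT) (pP tT) (pM tT)).
Qed.

(** Because [sqrt tau <= h]; this is where half an order in time is lost in H^1. *)
Lemma sqrt_tau_le : tau <= h * Num.sqrt tau.
Proof.
have t0 := tau_gt0 htau; have h0 := mesh_gt0 hab N0.
rewrite -{1}(sqr_sqrtr (ltW t0)) expr2; apply: ler_wpM2r; first exact: sqrtr_ge0.
have := tau_le_sqr_mesh htau; rewrite -(ler_sqrt _ (sqr_ge0 h)) => /le_trans; apply.
by rewrite sqrtr_sqr ger0_norm// ltW.
Qed.

Lemma eps_le_mesh : eps <= h * (Num.sqrt tau + h ^+ m.-1).
Proof.
rewrite mulrDr -exprS prednK ?(ltnW m2)// lerD2r; exact: sqrt_tau_le.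
Qed.

Definition H1_error : R := 2 ^+ m.-1 * M + pi * (ce + global_error).

(** The inverse inequality holds only on [X_N], so the comparison passes through the low-frequency
    projection: its derivative is accurate to order [h^(m-1)], and its distance to the numerical
    solution pays the factor [pi / h]. *)
Lemma derivative_error n : n%:R * tau <= T ->
  nrm (fun x => wderivn 1 (psi (n%:R * tau)) x -
    tp (fun l : 'I_N => 'i%C * (mu (freq l))%:C *
      discrete_fourier_coef a b (Psi n) (freq l)) x) <=
  H1_error * (Num.sqrt tau + h ^+ m.-1).
Proof.
move=> nT; have t0 := tau_gt0 htau; have h0 := mesh_gt0 hab N0.
set t := n%:R * tau in nT *.
have tT : 0 <= t <= T by rewrite nT mulr_ge0// ltW.
have M0 : 0 <= M := le_trans (nrm_ge0 _ _ _) (pM tT (leq0n m)).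
pose d (l : 'I_N) := discrete_fourier_coef a b (Psi n) (freq l).
pose c := @low_coef R a b N (psi t).
have [n1 _] := low_proj'_error hab N0 eN m2 (pP tT) (pM tT).
have L1 := in_H_wderivn (in_Hper_in_H (pP tT)) (ltnW m2).
have n2 : nrm (fun x => tp c x - interp (Psi n) x) <= (ce + global_error) * eps.
  apply: le_trans (ler_nrm_split (tp_in_L2 a b c) (tp_in_L2 a b (w t)) (interpolation_in_L2 a b _)) _.
  rewrite mulrDl; apply: lerD; last exact: corrected_scheme_error.
  rewrite nrmBC.
  exact: (corrected_low_error beta hab N0 eN m2 htau MV0 (Vm tT) (VM tT) (pP tT) (pM tT)).
have n3 := inverse_inequality (fun l => c l - d l).
have E : (fun x => tp c x - interp (Psi n) x) = tp (fun l => c l - d l).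
  by apply/funext => x; rewrite interpolationE tpB.
rewrite E in n2.
have ph : 0 <= pi / h by rewrite divr_ge0 ?pi_ge0// ltW.
have {}n3 := le_trans n3 (ler_wpM2l ph n2).
apply: le_trans (ler_nrm_split L1
  (tp_in_L2 a b (fun l : 'I_N => 'i%C * (mu (freq l))%:C * c l)) (tp_in_L2 a b _)) _.
have {}n3 : nrm (fun x => tp (fun l : 'I_N => 'i%C * (mu (freq l))%:C * c l) x -
    tp (fun l : 'I_N => 'i%C * (mu (freq l))%:C * d l) x) <= pi / h * ((ce + global_error) * eps).
  apply: le_trans n3; rewrite le_eqVlt; apply/orP; left; apply/eqP; congr nrm.
  apply/funext => x; rewrite tpB; congr (tp _ x); apply/funext => l.
  by rewrite mulrBr.
apply: le_trans (lerD n1 n3) _.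
have [c0 _] := corrector_error_ge tT.
have G0 : 0 <= global_error.
  rewrite /global_error mulr_ge0 ?expR_ge0// addr_ge0// mulr_ge0 ?(local_error_ge0 tT)//.
  by have /andP[s0 sT] := tT; exact: le_trans sT.
have k0 : 0 <= ce + global_error by rewrite addr_ge0.
rewrite /H1_error [leRHS]mulrDl; apply: lerD.
  rewrite exprMn mulrAC; apply: ler_wpM2l.
    by rewrite mulr_ge0// exprn_ge0.
  by rewrite lerDr sqrtr_ge0.
apply: le_trans (ler_wpM2l ph (ler_wpM2l k0 eps_le_mesh)) _.
rewrite le_eqVlt; apply/orP; left; apply/eqP.
move: (ce + global_error) (Num.sqrt tau + h ^+ m.-1) (pi : R) => x y p.
have hn0 : h != 0 by rewrite gt_eqF.
by move: (h) hn0 => z z0; field.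
Qed.

End Discretization.
End Convergence.

Unset Implicit Arguments.
Set Strict Implicit.
Set Printing Implicit Defensive.

Theorem theorem3p1 (R : realType) (m : nat) (a b beta T : R) (Tmax : \bar R)
    (V : R -> R -> R) (psi0 : R -> R[i]) (psi : R -> R -> R[i])
    (hm : (2 <= m)%N) (hab : a < b)
    (hT : 0 < T) (hTmax : (T%:E < Tmax)%E)
    (hpsi : maximal_GPE_solution a b beta V psi0 Tmax psi)
    (hV_Linfty :
       C0_time (in_Lp a b +oo%E) (Lp_norm a b +oo%E) T (fun t x => (V t x)%:C))
    (hV_L2 : C1_time (in_L2 a b) (L2_norm a b) T (fun t x => (V t x)%:C))
    (hpsi_Hm : C0_time (in_Hper a b m) (H_norm a b m) T psi)
    (hpsi_L2 : C1_time (in_L2 a b) (L2_norm a b) T psi) :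
  exists h0 C : R, [/\ 0 < h0, 0 < C &
    forall (N : nat) (tau : R),
      (0 < N)%N -> ~~ odd N ->
      let h := mesh a b N in
      0 < h < h0 -> 0 < tau <= h ^+ 2 / pi ->
      forall n : nat, n%:R <= T / tau ->
        let err := fun x =>
          psi (n%:R * tau) x -
          interpolation a b (LTSeFP a b beta V psi0 tau n : 'I_N.+1 -> R[i]) x in
        (L2_norm a b err <= (C * (tau + h ^+ m))%:E)%E /\
        (H_norm a b 1 err <= (C * (Num.sqrt tau + h ^+ m.-1))%:E)%E].
Proof.
have [_ sol _] := hpsi; have [initial _ _ _] := sol.
have [MV MV0 VM] := C0_time_Linfty_bounded hab hV_Linfty.
have Vm t : 0 <= t <= T -> measurable_fun `]a, b[ (V t).
  by move=> tT; have [vL _] := hV_Linfty; have [] := vL t tT.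
have [LV LV0 VLip] := C1_time_lipschitz hab hT hV_L2.
have VL2 t : 0 <= t <= T -> in_L2 a b (fun x => (V t x)%:C).
  by move=> tT; have [[vL2 _] _] := hV_L2; exact: vL2.
have [M pM] := C0_time_H_bounded hT hpsi_Hm.
have [pP _] := hpsi_Hm.
have [Lp Lp0 pLip] := C1_time_lipschitz hab hT hpsi_L2.
have pL2 t : 0 <= t <= T -> in_L2 a b (psi t) by move=> tT; have [[]] := pP t tT.
have T_ge0 : 0 <= (0 : R) <= T by rewrite lexx ltW.
have S0 := sup_bound_ge0 (pM 0 T_ge0).
pose S := sup_bound a b M.
have pS t x : 0 <= t <= T -> a < x < b -> cabs (psi t x) <= S.
  move=> tT /andP[ax xb]; apply: (cabs_Hper_le hab hm (pP t tT) (pM t tT)).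
  by rewrite !ltW.
(* Lipschitz constant in time of the source, as given by [source_lipschitz]. *)
pose Lg := (MV + 3 * `|beta| * S ^+ 2) * Lp + S * LV.
have k0 : 0 <= MV + 3 * `|beta| * S ^+ 2 by rewrite addr_ge0// mulr_ge0 ?sqr_ge0// mulr_ge0.
have Lg0 : 0 <= Lg by rewrite addr_ge0// mulr_ge0.
have gLip s r : 0 <= s <= T -> 0 <= r <= T ->
    nrm a b (fun x => source beta (V s) (psi s) x - source beta (V r) (psi r) x) <=
    Lg * `|s - r|.
  move=> sT rT.
  apply: le_trans (source_lipschitz beta MV0 S0 (Vm s sT) (VM s sT) (VL2 r rT) (VL2 s sT)
    (pL2 s sT) (pL2 r rT) (fun x => pS s x sT) (fun x => pS r x rT)) _.
  rewrite -/S /Lg [leRHS]mulrDl; apply: lerD; rewrite -[leRHS]mulrA; apply: ler_wpM2l => //.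
    exact: pLip.
  exact: VLip.
have ode s l : 0 < s < T -> cder (fun r => fourier_coef a b (psi r) l) s
    (- 'i%C * ((mu a b l ^+ 2)%:C * fourier_coef a b (psi s) l +
      fourier_coef a b (source beta (V s) (psi s)) l)).
  move=> sT; have sT' : 0 <= s <= T by lra.
  apply: (GPE_fourier_ode hab l hm hTmax sol pP sT).
  by have [] := source_estimate beta hab hm MV0 (Vm s sT') (VM s sT') (pP s sT') (pM s sT').
pose ce := corrector_error a b beta m MV M.
pose G := global_error a b beta T m MV M Lg.
pose H := H1_error a b beta T m MV M Lg.
(* The H^1 norm needs the sum of the function and derivative constants; the 1 makes [C] positive. *)
pose C := `|ce + G| + `|H| + 1.
(* Small enough for both [h <= 1] and [2 * G * h <= 1], the condition that closes the bootstrap. *)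
pose h0 := (2 * `|G| + 1)^-1.
have h00 : 0 < h0 by rewrite invr_gt0 ltr_wpDl// mulr_ge0.
have C0 : 0 < C by rewrite ltr_wpDl// addr_ge0.
exists h0, C; split=> // N tau N0 eN h /andP[hp hh0] htau n nT err.
have tau0 : 0 < tau by case/andP: htau.
have {}nT : n%:R * tau <= T by rewrite -ler_pdivlMr.
have h1 : h <= 1.
  apply: le_trans (ltW hh0) _; rewrite invf_le1 ?ltr_wpDl ?mulr_ge0//.
  by rewrite lerDr mulr_ge0.
have hC : 2 * G * h <= 1.
  have : (2 * `|G| + 1) * h <= 1.
    by rewrite mulrC -ler_pdivlMr ?ltr_wpDl ?mulr_ge0// mul1r ltW.
  by have := ler_wpM2r (ltW hp) (ler_norm G); lra.
have tT : 0 <= n%:R * tau <= T by rewrite nT mulr_ge0// ltW.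
have E0 := L2_error hab hm MV0 Lp0 Lg0 Vm VM pP pM pLip gLip ode N0 eN h1 htau hC initial nT.
have E1 := derivative_error hab hm MV0 Lp0 Lg0 Vm VM pP pM pLip gLip ode N0 eN h1 htau hC initial nT.
have [ug _] := in_Hper_pair0 hab (pP _ tT) (ltnW hm).
set v := (LTSeFP a b beta V psi0 tau n : 'I_N.+1 -> R[i]) in err E0 E1 *.
pose d (l : 'I_N) := discrete_fourier_coef a b v (freq l).
have vE : interpolation a b v = tp a b d by exact: interpolationE.
have errL2 : in_L2 a b err by rewrite /err vE; exact: in_L2B (pL2 _ tT) (tp_in_L2 a b d).
have [_ uL wu] := ug; have [_ vL wv] := H1pair_tp hab d.
have werr := weak_derivativeB (pL2 _ tT) (tp_in_L2 a b d) uL vL wu wv.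
have e0 := eps_ge0 m hab N0 htau.
rewrite -/h in e0 E0 E1.
have e1 : 0 <= Num.sqrt tau + h ^+ m.-1.
  by rewrite addr_ge0 ?sqrtr_ge0// exprn_ge0// ltW.
(* The H^1 norm contains the L^2 error, which must be absorbed into the weaker rate. *)
have e2 : tau + h ^+ m <= Num.sqrt tau + h ^+ m.-1.
  by have := eps_le_mesh hab hm N0 htau; rewrite -/h => /le_trans; apply; rewrite ler_piMl.
split.
  rewrite L2_nrm// lee_fin; apply: le_trans E0 _; apply: ler_wpM2r => //.
  have c1 := ler_norm (ce + G); have c2 := normr_ge0 H.
  by rewrite -/ce -/G /C; clear - c1 c2; lra.
have := H1_norm_le errL2 (in_L2B uL vL) _.
rewrite {2 3}/err vE => /(_ werr) K; apply: le_trans K _; rewrite lee_fin.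
apply: le_trans (lerD E0 E1) _.
have c1 := ler_wpM2r e1 (ler_norm H).
have c2 := ler_wpM2r e0 (ler_norm (ce + G)).
have c3 := ler_wpM2l (normr_ge0 (ce + G)) e2.
by rewrite -/ce -/G -/H /C; clear - c1 c2 c3 e1; lra.
Qed.
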